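(* In the setting of the context, let $\xi>0$, let $\{\rho_t\}$, $\{\delta_t\}$ be sequences of positive numbers and $\{N_t\}$ a sequence of positive integers. At each iteration $t$ the lower-level problems are solved by the cubic-regularized Newton method with $M=\overline{\overline L}_g$ for $K_t$ steps, where $$K_t>\max\left\{\frac{256(\overline g_0-\underline g)\big(\overline{\overline L}_g\big)^{1/2}}{9\Big(\min\Big\{\alpha\big(\delta_t,\tfrac{\mu(\delta_t)}{2\overline{\overline L}_g}\big),\tfrac{(\mu(\delta_t))^2}{4\overline{\overline L}_g}\Big\}\Big)^{3/2}},\ \frac{768(\overline g_0-\underline g)\overline{\overline L}_g^{\,2}}{(\mu(\delta_t))^3}\right\}+\frac{256(\overline g_0-\underline g)\big(\overline{\overline L}_g\big)^{1/2}}{9(\mu(\delta_t)\rho_t)^{3/2}}.$$ Then there are constants $C_1(n,\xi)$, $C_2(n,\xi)$ such that, with $$\Delta(\rho,\delta):=C_1(n,\xi)\rho+C_2(n,\xi)\delta^{(n-d)/2},\qquad \sigma^2(N):=\frac{n(\overline f)^2}{N\xi^2},$$ the gradient estimator satisfies the bias and variance bounds (with $K=K_t$, $\rho=\rho_t$, $\delta=\delta_t$, $N=N_t$) $$\Big\|\mathbb{E}\big[\hat\nabla^K_x\phi^{\mathrm{cd}}_\xi(x)\big]-\nabla_x\phi^{\mathrm{cd}}_\xi(x)\Big\|=\Big\|\nabla^K_x\phi^{\mathrm{cd}}_\xi(x)-\nabla_x\phi^{\mathrm{cd}}_\xi(x)\Big\|\le\Delta(\rho,\delta),$$ $$\mathbb{E}\Big[\big\|\hat\nabla^K_x\phi^{\mathrm{cd}}_\xi(x)-\nabla^K_x\phi^{\mathrm{cd}}_\xi(x)\big\|^2\Big]\le\sigma^2(N).$$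 Suppose $\{x_t\}$ is generated by the algorithm with step sizes $0<\beta_t<1/\overline L_{\phi}$, where $\overline L_\phi:=\overline f/\xi^2$, and, for $T\ge1$, let $R\in\{1,\dots,T\}$ be a random index with $$P_R(t)=\mathrm{Prob}\{R=t\}=\frac{\beta_t-\overline L_\phi\beta_t^2}{\sum_{s=1}^T(\beta_s-\overline L_\phi\beta_s^2)},\qquad t=1,\dots,T.$$ Then for any $T\ge1$, $$\mathbb{E}\big[\|\widetilde\Phi_{\mathcal{X},R}\|^2\big]\le\frac{2\overline f+\sum_{t=1}^T\sqrt{\tfrac2\pi}\,\tfrac{\overline f}{\xi}\,\Delta(\rho_t,\delta_t)\beta_t+\sum_{t=1}^T\big(\sigma^2(N_t)+(\Delta(\rho_t,\delta_t))^2\big)\beta_t}{\sum_{t=1}^T(\beta_t-\overline L_\phi\beta_t^2)},$$ where $$\widetilde\Phi_{\mathcal{X},t}:=\frac{x_t-\mathrm{proj}_{\mathcal{X}}\big(x_t-\beta_t\hat\nabla^{K_t}_x\phi^{\mathrm{cd}}_\xi(x_t)\big)}{\beta_t}.$$ In particular, choosing $\rho_t=\frac1{t+1}$, $\delta_t=\frac1{(t+1)^{2/(n-d)}}$, $N_t=t+1$ and constant step size $\beta_t=\beta<1/\overline L_\phi$ yields $$\mathbb{E}\big[\|\widetilde\Phi_{\mathcal{X},R}\|^2\big]\le\mathcal{O}\Big(\frac{\log T}{T}\Big).$$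
   Context: Data: $\mathcal{X}\subseteq\mathbb{R}^n$, real-valued functions $f(x,y)$ and $g(x,y)$ for $x\in\mathcal{X}$, $y\in\mathbb{R}^m$, and a fixed initial point $y_0$. Regularity assumptions: (1) $f$ is continuous and $g$ is twice continuously differentiable on $\mathcal{X}\times\mathbb{R}^m$; (2) $\mathcal{X}$ is convex and compact; (3) $g$ is Lipschitz smooth (has Lipschitz gradient) with constant $\overline L_g$ on $\mathcal{X}\times\mathbb{R}^m$; (4) $\nabla^2_{yy}g$ is Lipschitz continuous with constant $\overline{\overline L}_g$ on $\mathcal{X}\times\mathbb{R}^m$; (5) $g\ge\underline g$ on $\mathcal{X}\times\mathbb{R}^m$; (6) for every $x\in\mathcal{X}$ the sublevel set $\{y:g(x,y)\le g(x,y_0)\}$ is compact and contained in a compact set $\mathcal{Y}\subset\mathbb{R}^m$ independent of $x$; (7) $f$ is Lipschitz continuous with constant $L_f$ on $\{(x,y):x\in\mathcal{X},\ g(x,y)\le g(x,y_0)\}$. $\overline g_0$ and $\overline f$ are constants with $g(x,y_0)\le\overline g_0$ for all $x\in\mathcal{X}$ and $|f(x,y)|\le\overline f$ whenever $x\in\mathcal{X}$, $g(x,y)\le g(x,y_0)$. Bifurcation set: $\widetilde{\mathcal{X}}:=\{x\in\mathcal{X}:g(x,\cdot)\text{ is not Morse}\}$, where $g(x,\cdot)$ is Morse if $\nabla_yg(x,y)=0$ implies $\det\nabla^2_{yy}g(x,y)\ne0$; $\widetilde{\mathcal{X}}_\delta:=\{x\in\mathcal{X}:\mathrm{dist}(x,\widetilde{\mathcal{X}})\le\delta\}$.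 Assume that the upper Minkowski dimension $d:=\limsup_{r\to0}\frac{\log N(\widetilde{\mathcal{X}},r)}{-\log r}$ satisfies $d<n$ ($N(\cdot,r)$ is the number of radius-$r$ balls needed for a cover); this implies $\widetilde{\mathcal{X}}$ has Lebesgue measure zero. Fix a compact $\mathcal{Y}'$ with $\mathcal{Y}\subset\mathrm{int}(\mathcal{Y}')$. $\mu(\delta)>0$ is a function such that for every $x\in\mathcal{X}\setminus\widetilde{\mathcal{X}}_\delta$ and every stationary point $y\in\mathcal{Y}'$ of $g(x,\cdot)$ all eigenvalues $\lambda$ of $\nabla^2_{yy}g(x,y)$ satisfy $|\lambda|\ge\mu(\delta)$. $\alpha(\delta,r)>0$ is a function such that $\|\nabla_yg(x,y)\|\ge\alpha(\delta,r)$ for all $x\in\mathcal{X}\setminus\widetilde{\mathcal{X}}_\delta$ and all $y\in\mathcal{Y}$ with $\mathrm{dist}(y,\{y'\in\mathcal{Y}':\nabla_yg(x,y')=0\})>r$. Lower-level method: the cubic-regularized Newton method with parameter $M$ on $g(x,\cdot)$ started at $y_0$: $s_k$ is a global minimizer over $s$ of $\nabla_yg(x,y_k)^\top s+\frac12s^\top\nabla^2_{yy}g(x,y_k)s+\frac M6\|s\|^3$ and $y_{k+1}=y_k+s_k$. After $K$ steps the output is $\hat y(x)=y_{k^*}$, where $k^*$ minimizes over $0\le k\le K$ the quantity $\max\{\sqrt{\tfrac1M\|\nabla_yg(x,y_k)\|},-\tfrac2{3M}\lambda_{\min}(\nabla^2_{yy}g(x,y_k))\}$. Let $\hat S(x)$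 be the set of accumulation points of $\{y_k\}$ and $y^{\mathrm{cd}}(x)\in\arg\min_{y\in\hat S(x)}f(x,y)$. Assumptions: every point of $\hat S(x)$ is a stationary point of $g(x,\cdot)$; there is $K_0$ with $g(x,y_k)\le g(x,y_0)$ for all $x\in\mathcal{X}$, $k\ge K_0$, and all numbers of lower-level steps are taken $\ge K_0$; the set of discontinuity points of $y^{\mathrm{cd}}$ in $\mathcal{X}\setminus\widetilde{\mathcal{X}}$ has Lebesgue measure zero. Smoothed hyperfunction: $f(x,\cdot)$ is redefined to be the constant $\overline f$ for $x\notin\mathcal{X}$; $\phi^{\mathrm{cd}}(x):=f(x,y^{\mathrm{cd}}(x))$ (so $\phi^{\mathrm{cd}}=\overline f$ outside $\mathcal{X}$); $h_\xi(z)=(2\pi\xi^2)^{-n/2}\exp(-\|z\|^2/(2\xi^2))$; $\phi^{\mathrm{cd}}_\xi(x):=\int_{\mathbb{R}^n}h_\xi(x-z)\phi^{\mathrm{cd}}(z)\,dz$. Inexact gradient: $\nabla^K_x\phi^{\mathrm{cd}}_\xi(x):=\int_{\mathbb{R}^n}\nabla_xh_\xi(x-z)f(z,\hat y(z))\,dz$, with $\hat y(z)$ the output of $K$ cubic Newton steps at $z$. Estimator: $\hat\nabla^K_x\phi^{\mathrm{cd}}_\xi(x):=\frac1{N\xi}\sum_{i=1}^Nu^{(i)}f(x+\xi u^{(i)},\hat y(x+\xi u^{(i)}))$ with $u^{(1)},\dots,u^{(N)}$ i.i.d. $\mathcal{N}(0,I_n)$. Algorithm: starting from an initial point $x_1\in\mathcal{X}$,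 at iteration $t$ draw fresh independent samples $u^{(1)},\dots,u^{(N_t)}$, compute $\hat\nabla^{K_t}_x\phi^{\mathrm{cd}}_\xi(x_t)$ with $N=N_t$, $K=K_t$, and set $x_{t+1}=\mathrm{proj}_{\mathcal{X}}(x_t-\beta_t\hat\nabla^{K_t}_x\phi^{\mathrm{cd}}_\xi(x_t))$. The constants $C_1(n,\xi),C_2(n,\xi)$ depend on $n$ and $\xi$ with the problem data fixed. *)

(* Defs.v *)
From HB Require Import structures.
From mathcomp Require Import all_boot all_order all_algebra.
From mathcomp Require Import finmap.
From mathcomp Require Import all_classical all_reals all_analysis.

Set Implicit Arguments.
Unset Strict Implicit.
Unset Printing Implicit Defensive.

Import Order.TTheory GRing.Theory Num.Theory.
Import numFieldNormedType.Exports.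

Local Open Scope classical_set_scope.
Local Open Scope ring_scope.

(* Vectors of R^n are row vectors 'rV[R]_n.  The library's norm on matrices is
   the sup norm: it is used below only through the topology it induces, and all
   quantitative statements use the Euclidean norm [enorm]. *)

Section Euclidean.
Context {R : realType}.

Definition enorm n (v : 'rV[R]_n) : R := Num.sqrt (\sum_i v 0 i ^+ 2).

(* Extended-real valued, so that the distance to the empty set is +oo. *)
Definition dist n (x : 'rV[R]_n) (A : set 'rV[R]_n) : \bar R :=
  ereal_inf [set (enorm (x - z))%:E | z in A].

(* Spectral norm. *)
Definition opnorm n (A : 'M[R]_n) : R :=
  sup [set enorm (v *m A) | v in [set v : 'rV[R]_n | enorm v <= 1]].

(* The smallest eigenvalue; meant for symmetric matrices. *)
Definition lambda_min n (A : 'M[R]_n) : R := inf [set l | eigenvalue A l].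

Definition proj n (A : set 'rV[R]_n) (v : 'rV[R]_n) : 'rV[R]_n :=
  xget 0 [set p | A p /\ forall z, A z -> enorm (v - p) <= enorm (v - z)].

Definition partial n (i : 'I_n) (F : 'rV[R]_n -> R) (x : 'rV[R]_n) : R :=
  'D_(delta_mx 0 i) F x.

Definition grad n (F : 'rV[R]_n -> R) (x : 'rV[R]_n) : 'rV[R]_n :=
  \row_i partial i F x.

Definition hess n (F : 'rV[R]_n -> R) (x : 'rV[R]_n) : 'M[R]_n :=
  \matrix_(i, j) partial i (partial j F) x.

Definition C1_on n (W : set 'rV[R]_n) (F : 'rV[R]_n -> R) : Prop :=
  forall z, W z -> forall i : 'I_n,
    derivable F z (delta_mx 0 i) /\ {for z, continuous (partial i F)}.

Definition C2_on n (W : set 'rV[R]_n) (F : 'rV[R]_n -> R) : Prop :=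
  C1_on W F /\ forall i : 'I_n, C1_on W (partial i F).

(* A function of (x, y) as a function on R^(n + m). *)
Definition joint n m (F : 'rV[R]_n -> 'rV[R]_m -> R) (z : 'rV[R]_(n + m)) : R :=
  F (lsubmx z) (rsubmx z).

(* Least number of closed balls of radius r covering A, for a bounded A. *)
Definition covering_number n (A : set 'rV[R]_n) (r : R) : R :=
  inf [set k%:R | k in [set k : nat | exists c : 'I_k -> 'rV[R]_n,
    forall z, A z -> exists i, enorm (z - c i) <= r]].

(* As ln 0 = 0 in the library, the empty set gets dimension 0. *)
Definition upper_minkowski_dim n (A : set 'rV[R]_n) : \bar R :=
  limf_esup (fun r : R => (ln (covering_number A r) / - ln r)%:E) 0^'+.

End Euclidean.

Definition rV_display : measure_display. Proof. exact: default_measure_display. Qed.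

(* The product (equivalently, Borel) sigma-algebra on 'rV[R]_n. *)
Section measurable_rV.
Context {R : realType} (n : nat).

Let coord : 'I_n -> 'rV[R]_n -> measurableTypeR R := fun i v => v 0 i.

Let rV_set0 : g_sigma_preimage coord set0.
Proof. exact: sigma_algebra0. Qed.

Let rV_setC A : g_sigma_preimage coord A -> g_sigma_preimage coord (~` A).
Proof. exact: sigma_algebraC. Qed.

Let rV_bigcup (F : (set 'rV[R]_n)^nat) :
  (forall i, g_sigma_preimage coord (F i)) ->
  g_sigma_preimage coord (\bigcup_i (F i)).
Proof. exact: sigma_algebra_bigcup. Qed.

HB.instance Definition _ := @isMeasurable.Build rV_display
  'rV[R]_n (g_sigma_preimage coord) rV_set0 rV_setC rV_bigcup.

End measurable_rV.

Section measurable_rV_lemmas.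
Context {R : realType}.

Lemma measurable_coord n (i : 'I_n) :
  measurable_fun [set: 'rV[R]_n] (fun v : 'rV[R]_n => v 0 i : measurableTypeR R).
Proof.
move=> _ Y mY; rewrite setTI; apply: sub_sigma_algebra => /=.
rewrite -bigcup_seq/=; exists i => /=; first by rewrite mem_index_enum.
by exists Y => //; rewrite setTI.
Qed.

Lemma measurable_fun_rVP d (T : measurableType d) n (f : T -> 'rV[R]_n) :
  (forall i, measurable_fun [set: T] (fun t => f t 0 i : measurableTypeR R)) ->
  measurable_fun [set: T] f.
Proof.
move=> mf _ A mA; rewrite setTI.
suff : preimage_set_system [set: T] f
    (g_sigma_preimage (fun i (v : 'rV[R]_n) => v 0 i : measurableTypeR R))
    `<=` measurable.
  by apply; exists A => //; rewrite setTI.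
rewrite -g_sigma_preimage_comp.
apply: smallest_sub; first exact: sigma_algebra_measurable.
move=> B; rewrite -bigcup_seq/= => -[i _ [C mC <-]].
exact: mf.
Qed.

Definition cons_rV n (p : measurableTypeR R * 'rV[R]_n) : 'rV[R]_n.+1 :=
  row_mx (p.1%:M : 'M[R]_1) p.2.

Definition uncons_rV n (v : 'rV[R]_n.+1) : measurableTypeR R * 'rV[R]_n :=
  (v 0 ord0, rsubmx (v : 'rV[R]_(1 + n))).

Lemma cons_rVK n : cancel (@cons_rV n) (@uncons_rV n).
Proof.
move=> [a v]; rewrite /cons_rV /uncons_rV /= row_mxKr; congr pair.
have -> : (ord0 : 'I_n.+1) = lshift n (ord0 : 'I_1) by exact/val_inj.
by rewrite (@row_mxEl _ 1 1 n) mxE eqxx mulr1n.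
Qed.

Lemma uncons_rVK n : cancel (@uncons_rV n) (@cons_rV n).
Proof.
move=> v; apply/rowP => i; rewrite /cons_rV /uncons_rV /=.
rewrite -[i](@splitK 1 n); case: (fintype.split (i : 'I_(1 + n))) => j /=.
  rewrite (@row_mxEl _ 1 1 n) mxE ord1 eqxx mulr1n; congr (v 0 _).
  exact/val_inj.
by rewrite (@row_mxEr _ 1 1 n) !mxE.
Qed.

Lemma measurable_cons_rV n : measurable_fun setT (@cons_rV n).
Proof.
apply: measurable_fun_rVP => i; rewrite -[i](@splitK 1 n); case: (fintype.split (i : 'I_(1 + n))) => j /=.
  rewrite (_ : (fun _ => _) = fst); first exact: measurable_fst.
  by apply/funext => p; rewrite /cons_rV (@row_mxEl _ 1 1 n) mxE ord1 eqxx mulr1n.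
rewrite (_ : (fun _ => _) = (fun v : 'rV[R]_n => v 0 j) \o snd).
  exact: measurableT_comp (measurable_coord j) measurable_snd.
by apply/funext => p; rewrite /cons_rV /= (@row_mxEr _ 1 1 n).
Qed.

Lemma measurable_uncons_rV n : measurable_fun setT (@uncons_rV n).
Proof.
apply/measurable_fun_pairP; split; first exact: measurable_coord.
apply: measurable_fun_rVP => i.
rewrite (_ : (fun _ => _) = fun v : 'rV[R]_n.+1 => v 0 (rshift 1 i)).
  exact: measurable_coord.
by apply/funext => v; rewrite /= mxE.
Qed.

End measurable_rV_lemmas.

(* Lebesgue measure on R^(n+1), from a measure on R^n and Lebesgue measure on R. *)
Section lebesgue_cons.
Context {R : realType} (n : nat) (mu : {sigma_finite_measure set 'rV[R]_n -> \bar R}).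

Definition lebesgue_cons : set 'rV[R]_n.+1 -> \bar R :=
  pushforward (@lebesgue_measure R \x mu)%E (@cons_rV R n).

Let lebesgue_cons0 : lebesgue_cons set0 = 0%E.
Proof. by rewrite /lebesgue_cons /pushforward preimage_set0 measure0. Qed.

Let lebesgue_cons_ge0 A : (0 <= lebesgue_cons A)%E.
Proof. by rewrite /lebesgue_cons /pushforward measure_ge0. Qed.

Let lebesgue_cons_sigma_additive : semi_sigma_additive lebesgue_cons.
Proof.
move=> F mF tF mUF; rewrite /lebesgue_cons /pushforward preimage_bigcup.
have mc B : measurable B -> measurable (@cons_rV R n @^-1` B).
  by move=> mB; rewrite -[X in measurable X]setTI; exact: measurable_cons_rV.
apply: measure_semi_sigma_additive => [i||].
- exact: mc.
- apply/trivIsetP => /= i j _ _ ij; rewrite -preimage_setI.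
  by move/trivIsetP : tF => /(_ _ _ _ _ ij) ->//; rewrite preimage_set0.
- by rewrite -preimage_bigcup; exact: mc.
Qed.

HB.instance Definition _ := isMeasure.Build _ _ _ lebesgue_cons
  lebesgue_cons0 lebesgue_cons_ge0 lebesgue_cons_sigma_additive.

Let lebesgue_cons_sigma_finite : sigma_finite setT lebesgue_cons.
Proof.
have /sigma_finiteP[F [FT ndF Foo]] := sigma_finiteT (@lebesgue_measure R).
have /sigma_finiteP[G [GT ndG Goo]] := sigma_finiteT mu.
exists (fun k => @uncons_rV R n @^-1` (F k `*` G k)).
  rewrite predeqE => v; split=> // _.
  have : setT (uncons_rV v).1 by [].
  have : setT (uncons_rV v).2 by [].
  rewrite {1}GT {1}FT => -[k _ Gk] [l _ Fl]; exists (maxn k l) => //; split.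
  - by move: Fl; exact/subsetPset/ndF/leq_maxr.
  - by move: Gk; exact/subsetPset/ndG/leq_maxl.
move=> k; have [mF oF] := Foo k; have [mG oG] := Goo k; split.
  rewrite -[X in measurable X]setTI; apply: measurable_uncons_rV => //.
  exact: measurableX.
rewrite /lebesgue_cons /pushforward -comp_preimage.
rewrite (_ : _ \o _ = id); last by apply/funext => p /=; rewrite cons_rVK.
by rewrite preimage_id product_measure1E// lte_mul_pinfty// ge0_fin_numE.
Qed.

HB.instance Definition _ := Measure_isSigmaFinite.Build _ _ _ lebesgue_cons
  lebesgue_cons_sigma_finite.

End lebesgue_cons.

Section analysis_notions.
Context {R : realType}.

Fixpoint lebesgue_rV n : {sigma_finite_measure set 'rV[R]_n -> \bar R} :=
  match n with
  | 0 => \d_(0 : 'rV[R]_0)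
  | n'.+1 => lebesgue_cons (lebesgue_rV n')
  end.

(* Measurability for the completion of Lebesgue measure. *)
Definition Lebesgue_measurable n (F : 'rV[R]_n -> R) : Prop :=
  exists F' : 'rV[R]_n -> R, measurable_fun setT F' /\
    {ae lebesgue_rV n, forall z, F z = F' z}.

Definition gauss n (xi : R) (z : 'rV[R]_n) : R :=
  (2 * pi * xi ^+ 2) `^ (- (n%:R / 2)) *
  expR (- (enorm z ^+ 2 / (2 * xi ^+ 2))).

Definition smoothing n (xi : R) (phi : 'rV[R]_n -> R) (x : 'rV[R]_n) : R :=
  \int[lebesgue_rV n]_z (gauss xi (x - z) * phi z).

(* The integral over z of (grad_x gauss(x - z)) * F z. *)
Definition kernel_grad n (xi : R) (F : 'rV[R]_n -> R) (x : 'rV[R]_n) : 'rV[R]_n :=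
  \row_j \int[lebesgue_rV n]_z (grad (fun x' => gauss xi (x' - z)) x 0 j * F z).

Definition estimator n (xi : R) (F : 'rV[R]_n -> R) (N : nat)
    (u : nat -> 'rV[R]_n) (x : 'rV[R]_n) : 'rV[R]_n :=
  (N%:R * xi)^-1 *: \sum_(i < N) F (x + xi *: u i) *: u i.

End analysis_notions.

Section probability_notions.
Context d {Omega : measurableType d} {R : realType} (P : probability Omega R).

Definition mutually_independent d' (T : measurableType d') (I : choiceType)
    (D : set I) (X : I -> Omega -> T) : Prop :=
  forall (J : {fset I}) (A : I -> set T),
    [set` J] `<=` D -> (forall i, measurable (A i)) ->
    P (\bigcap_(i in [set` J]) X i @^-1` A i) =
    (\prod_(i <- J) P (X i @^-1` A i))%E.

(* Y is independent of the whole family (X i), i in D. *)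
Definition independent_of_family d' d'' (T : measurableType d')
    (T' : measurableType d'') (I : choiceType)
    (D : set I) (X : I -> Omega -> T) (Y : Omega -> T') : Prop :=
  forall (J : {fset I}) (A : I -> set T) (B : set T'),
    [set` J] `<=` D -> (forall i, measurable (A i)) -> measurable B ->
    P (Y @^-1` B `&` \bigcap_(i in [set` J]) X i @^-1` A i) =
    (P (Y @^-1` B) * P (\bigcap_(i in [set` J]) X i @^-1` A i))%E.

Definition standard_gaussian n (U : Omega -> 'rV[R]_n) : Prop :=
  measurable_fun setT U /\
  forall A, measurable A ->
    P (U @^-1` A) = (\int[lebesgue_rV n]_(z in A) (gauss 1 z)%:E)%E.

Definition expectation_rV n (V : Omega -> 'rV[R]_n) : 'rV[R]_n :=
  \row_j fine 'E_P[fun w => V w 0 j].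

End probability_notions.

Section bilevel.
Context {R : realType} (n m : nat).
Implicit Types (X : set 'rV[R]_n) (f g : 'rV[R]_n -> 'rV[R]_m -> R).

Definition morse (G : 'rV[R]_m -> R) : Prop :=
  forall y, grad G y = 0 -> \det (hess G y) != 0.

Definition bifurcation X g : set 'rV[R]_n := [set x | X x /\ ~ morse (g x)].

Definition bifurcation_nbhd X g (delta : R) : set 'rV[R]_n :=
  [set x | X x /\ (dist x (bifurcation X g) <= delta%:E)%E].

Definition cubic_model (M : R) (G : 'rV[R]_m -> R) (y s : 'rV[R]_m) : R :=
  (grad G y *m s^T) 0 0 + 2^-1 * (s *m hess G y *m s^T) 0 0
  + M / 6 * enorm s ^+ 3.

Definition cubic_newton (M : R) (G : 'rV[R]_m -> R) (y0 : 'rV[R]_m)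
    (y : nat -> 'rV[R]_m) : Prop :=
  y 0%N = y0 /\
  forall k, exists s, y k.+1 = y k + s /\
    forall s', cubic_model M G (y k) s <= cubic_model M G (y k) s'.

Definition criterion (M : R) (G : 'rV[R]_m -> R) (y : 'rV[R]_m) : R :=
  Num.max (Num.sqrt (M^-1 * enorm (grad G y)))
          (- (2 / (3 * M)) * lambda_min (hess G y)).

Definition best_index (M : R) (G : 'rV[R]_m -> R) (y : nat -> 'rV[R]_m)
    (K k : nat) : Prop :=
  (k <= K)%N /\
  forall k', (k' <= K)%N -> criterion M G (y k) <= criterion M G (y k').

Definition accumulation_points (y : nat -> 'rV[R]_m) : set 'rV[R]_m :=
  cluster (y @ \oo).

(* f(x, .) redefined as the constant fbar for x outside X. *)
Definition extend X (fbar : R) f (x : 'rV[R]_n) (y : 'rV[R]_m) : R :=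
  if x \in X then f x y else fbar.

(* Lower bound on the number of lower-level steps, for accuracy rho outside
   the delta-neighbourhood of the bifurcation set. *)
Definition steps_bound (g0bar glow Lgg : R) (mu : R -> R) (alpha : R -> R -> R)
    (rho delta : R) : R :=
  Num.max
    (256 * (g0bar - glow) * Lgg `^ (1 / 2) /
      (9 * (Num.min (alpha delta (mu delta / (2 * Lgg)))
                    (mu delta ^+ 2 / (4 * Lgg))) `^ (3 / 2)))
    (768 * (g0bar - glow) * Lgg ^+ 2 / mu delta ^+ 3)
  + 256 * (g0bar - glow) * Lgg `^ (1 / 2) / (9 * (mu delta * rho) `^ (3 / 2)).

Definition bias_bound (d C1 C2 rho delta : R) : R :=
  C1 * rho + C2 * delta `^ ((n%:R - d) / 2).

Definition variance_bound (fbar xi : R) (N : nat) : R :=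
  n%:R * fbar ^+ 2 / (N%:R * xi ^+ 2).

(* Iterations are numbered from 1; [iterate X beta G x1 1 = x1], the value at
   index 0 is irrelevant.  [G t x] is the gradient estimate used at iteration t. *)
Fixpoint iterate X (beta : nat -> R) (G : nat -> 'rV[R]_n -> 'rV[R]_n)
    (x1 : 'rV[R]_n) (t : nat) : 'rV[R]_n :=
  if t is t'.+1 then
    if t' is 0 then x1 else
    let x := iterate X beta G x1 t' in proj X (x - beta t' *: G t' x)
  else x1.

Definition projected_gradient X (beta : nat -> R)
    (G : nat -> 'rV[R]_n -> 'rV[R]_n) (x1 : 'rV[R]_n) (t : nat) : 'rV[R]_n :=
  let x := iterate X beta G x1 t in
  (beta t)^-1 *: (x - proj X (x - beta t *: G t x)).

(* beta_t - L * beta_t^2, the unnormalised weight of the random index. *)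
Definition weight (L : R) (beta : nat -> R) (t : nat) : R :=
  beta t - L * beta t ^+ 2.

End bilevel.

(* Main.v *)
From HB Require Import structures.
Require Import Defs.
From mathcomp Require Import all_boot all_order all_algebra.
From mathcomp Require Import finmap.
From mathcomp Require Import all_classical all_reals all_analysis.
From mathcomp Require Import measurable_realfun.
From mathcomp Require Import ring lra.

Set Implicit Arguments.
Unset Strict Implicit.
Unset Printing Implicit Defensive.

Import Order.TTheory GRing.Theory Num.Theory.
Import numFieldNormedType.Exports.

Local Open Scope classical_set_scope.
Local Open Scope ring_scope.

(** The estimator is an average of [xi^-1 u F (x + xi u)] over Gaussian samples
    [u].  Its mean is the gradient at [x] of the Gaussian smoothing of [F], so the
    bias compares the smoothed gradients of two bounded functions: [phi], built on
    the selected accumulation point, and [F], built on the output of finitely many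
    cubic Newton steps.

    Away from the bifurcation set the two are close.  Each cubic step decreases the
    objective by a multiple of the cube of its length, and that length controls the
    gradient and the negative curvature at the next point.  After enough steps the
    best iterate therefore has a small gradient and an almost nonnegative Hessian.
    The functions [alpha] and [mu] then place it next to a stationary point whose
    Hessian is at least [mu], and this minimizer traps all later iterates, hence
    also every accumulation point ([newton_accuracy]): output and accumulation
    point differ by at most [2 rho].  Near the bifurcation set only the bound
    [fbar] is available.  A set of Minkowski dimension [d] is covered by
    [r ^ (-s)] balls of radius [r] with [s] halfway between [d] and [n], and
    enlarging the balls bounds the volume of its [r]-neighbourhood by a multiple
    of [r ^ ((n - d) / 2)] ([minkowski_nbhd]); since the Gaussian density times the
    norm is bounded, so is the contribution of that neighbourhood to the bias
    ([ggrad_bias], [inexact_gradient_bias]).  The same volume bound shows that the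
    bifurcation set is null, which makes [phi] almost everywhere equal to a Borel
    function ([hyperfunction_measurable]).

    The variance bound adds up the second moments of independent centred terms
    ([sum_second_moment], [estimator_variance]).

    For the algorithm, the smoothing of a function bounded by [B] satisfies a
    quadratic Taylor bound with constant [B / xi ^ 2].  Translating the Gaussian
    measure turns an increment of the smoothed function into the integral of the
    function against [exp (<u, q> - |q| ^ 2 / 2) - 1], whose linearization error
    has mean absolute value at most [|q| ^ 2] ([exp_remainder],
    [gsmooth_taylor]).  This constant gives exactly the weights
    [beta - L beta ^ 2] in the descent inequality of one projected step
    ([projected_step]), whose error terms involve the error of the estimate and the
    exact projected step.  The latter is at most [fbar / xi] long.  An iterate
    depends on past samples only and is independent of the present block of
    samples, so by Tonelli's theorem the expected error terms are those of a fixed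
    point ([expected_step_error], [expected_loss]).  Summing over the iterations
    telescopes, and the random index, being independent of all samples, averages
    the squared steps with the same weights ([expected_random_step]).

    The integrand [F] is measurable only for the completed Lebesgue measure.  Every
    sampling point has a Gaussian conditional law, so almost surely it misses the
    null set where [F] differs from a Borel representative, and the algorithm runs
    as if [F] were that representative ([iterates_ae_eq]). *)

(** * Inner product and Euclidean norm *)
Lemma addrKl (V : zmodType) (y v : V) : y + v - y = v.
Proof. by rewrite addrC addKr. Qed.

Section Euclid.
Context {R : realType}.

Fact dot_key : unit. Proof. exact: tt. Qed.

(** Locked, so that comparing two inner products never unfolds their sums. *)
Definition dot n (u v : 'rV[R]_n) : R :=
  locked_with dot_key (\sum_i u 0 i * v 0 i).

Lemma dot_sum n (u v : 'rV[R]_n) : dot u v = \sum_i u 0 i * v 0 i.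
Proof. by rewrite /dot unlock. Qed.

Lemma dotC n (u v : 'rV[R]_n) : dot u v = dot v u.
Proof. by rewrite !dot_sum; apply: eq_bigr => i _; rewrite mulrC. Qed.

Lemma dotDl n (u v w : 'rV[R]_n) : dot (u + v) w = dot u w + dot v w.
Proof. by rewrite !dot_sum -big_split; apply: eq_bigr => i _; rewrite mxE mulrDl. Qed.

Lemma dotZl n a (u v : 'rV[R]_n) : dot (a *: u) v = a * dot u v.
Proof. by rewrite !dot_sum mulr_sumr; apply: eq_bigr => i _; rewrite mxE mulrA. Qed.

Lemma dotDr n (u v w : 'rV[R]_n) : dot w (u + v) = dot w u + dot w v.
Proof. by rewrite dotC dotDl dotC (dotC v). Qed.

Lemma dotZr n a (u v : 'rV[R]_n) : dot v (a *: u) = a * dot v u.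
Proof. by rewrite dotC dotZl dotC. Qed.

Lemma dotNl n (u v : 'rV[R]_n) : dot (- u) v = - dot u v.
Proof. by rewrite -scaleN1r dotZl mulN1r. Qed.

Lemma dotNr n (u v : 'rV[R]_n) : dot v (- u) = - dot v u.
Proof. by rewrite dotC dotNl dotC. Qed.

Lemma dot0l n (u : 'rV[R]_n) : dot 0 u = 0.
Proof. by rewrite -(scale0r u) dotZl mul0r. Qed.

Lemma dot0r n (u : 'rV[R]_n) : dot u 0 = 0.
Proof. by rewrite dotC dot0l. Qed.

Lemma dot_sumr n (I : Type) (r : seq I) (F : I -> 'rV[R]_n) (u : 'rV[R]_n) :
  dot u (\sum_(i <- r) F i) = \sum_(i <- r) dot u (F i).
Proof.
by elim/big_rec2: _ => [|i x y _ <-]; rewrite ?dot0r// dotDr.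
Qed.

Definition dotE := (dotDl, dotDr, dotZl, dotZr, dotNl, dotNr, dot0l, dot0r).

Lemma dotmx n (u v : 'rV[R]_n) : (u *m v^T) 0 0 = dot u v.
Proof. by rewrite dot_sum mxE; apply: eq_bigr => i _; rewrite mxE. Qed.

Lemma dot_delta n (u : 'rV[R]_n) i : dot u (delta_mx 0 i) = u 0 i.
Proof.
rewrite dot_sum (bigD1 i)//= mxE !eqxx mulr1 big1 ?addr0// => j ji.
by rewrite mxE (negbTE ji) andbF mulr0.
Qed.

Lemma enorm_ge0 n (u : 'rV[R]_n) : 0 <= enorm u.
Proof. exact: sqrtr_ge0. Qed.
#[local] Hint Resolve enorm_ge0 : core.

Lemma dot_ge0 n (u : 'rV[R]_n) : 0 <= dot u u.
Proof. by rewrite dot_sum; apply: sumr_ge0 => i _; rewrite -expr2 sqr_ge0. Qed.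

Lemma enorm_sqr n (u : 'rV[R]_n) : enorm u ^+ 2 = dot u u.
Proof.
rewrite sqr_sqrtr; last by apply: sumr_ge0 => i _; rewrite sqr_ge0.
by rewrite dot_sum; apply: eq_bigr => i _; rewrite expr2.
Qed.

Lemma enormE n (u : 'rV[R]_n) : enorm u = Num.sqrt (dot u u).
Proof. by rewrite -enorm_sqr sqrtr_sqr ger0_norm. Qed.

Lemma enormZ n a (u : 'rV[R]_n) : enorm (a *: u) = `|a| * enorm u.
Proof.
by rewrite !enormE !dotE mulrA -expr2 sqrtrM ?sqr_ge0// sqrtr_sqr.
Qed.

Lemma enormN n (u : 'rV[R]_n) : enorm (- u) = enorm u.
Proof. by rewrite -scaleN1r enormZ normrN1 mul1r. Qed.

Lemma enorm0 n : enorm (0 : 'rV[R]_n) = 0.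
Proof. by rewrite enormE dot0l sqrtr0. Qed.

Lemma enormB n (u v : 'rV[R]_n) : enorm (u - v) = enorm (v - u).
Proof. by rewrite -enormN opprB. Qed.

Lemma coord_le_enorm n (u : 'rV[R]_n) i : `|u 0 i| <= enorm u.
Proof.
rewrite -sqrtr_sqr; apply: ler_wsqrtr; rewrite (bigD1 i)//= lerDl.
by apply: sumr_ge0 => j _; rewrite sqr_ge0.
Qed.

Lemma enorm_eq0 n (u : 'rV[R]_n) : enorm u = 0 -> u = 0.
Proof.
move=> u0; apply/rowP => i; apply/eqP; rewrite mxE -normr_le0 -u0.
exact: coord_le_enorm.
Qed.

Lemma enorm_gt0 n (u : 'rV[R]_n) : u != 0 -> 0 < enorm u.
Proof.
by move=> u0; rewrite lt_def enorm_ge0 andbT; apply: contra u0 => /eqP /enorm_eq0 ->.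
Qed.

Lemma dot_sqr_le n (u v : 'rV[R]_n) : dot u v ^+ 2 <= dot u u * dot v v.
Proof.
have [->|v0] := eqVneq v 0; first by rewrite !dotE mulr0 expr0n.
have vv : 0 < dot v v by rewrite -enorm_sqr exprn_gt0// enorm_gt0.
have := dot_ge0 (dot v v *: u - dot u v *: v).
rewrite !dotE (dotC v u) => h.
have : 0 <= dot v v * (dot u u * dot v v - dot u v ^+ 2) by move: h; lra.
by rewrite pmulr_rge0// subr_ge0.
Qed.

Lemma dot_norm_le n (u v : 'rV[R]_n) : `|dot u v| <= enorm u * enorm v.
Proof.
rewrite -ler_sqr ?nnegrE ?mulr_ge0// real_normK ?num_real//.
by rewrite exprMn !enorm_sqr dot_sqr_le.
Qed.

Lemma dot_le n (u v : 'rV[R]_n) : dot u v <= enorm u * enorm v.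
Proof. exact: le_trans (ler_norm _) (dot_norm_le u v). Qed.

Lemma enormD_sqr n (u v : 'rV[R]_n) :
  enorm (u + v) ^+ 2 = enorm u ^+ 2 + 2 * dot u v + enorm v ^+ 2.
Proof. by rewrite !enorm_sqr !dotE (dotC v u); ring. Qed.

Lemma enormD n (u v : 'rV[R]_n) : enorm (u + v) <= enorm u + enorm v.
Proof.
rewrite -ler_sqr ?nnegrE ?addr_ge0// enormD_sqr.
by have := dot_le u v; nra.
Qed.

Lemma enorm_triangle n (u v w : 'rV[R]_n) :
  enorm (u - w) <= enorm (u - v) + enorm (v - w).
Proof. by rewrite -(subrKA v u) enormD. Qed.

Lemma enorm_delta n (i : 'I_n) : enorm (delta_mx 0 i : 'rV[R]_n) = 1.
Proof. by rewrite enormE dot_delta mxE !eqxx sqrtr1. Qed.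

Lemma row_sum_delta n (u : 'rV[R]_n) : u = \sum_i u 0 i *: delta_mx 0 i.
Proof. exact: row_sum_delta. Qed.

Lemma enorm_sum n (I : Type) (r : seq I) (F : I -> 'rV[R]_n) :
  enorm (\sum_(i <- r) F i) <= \sum_(i <- r) enorm (F i).
Proof.
elim/big_rec2: _ => [|i x y _ h]; first by rewrite enorm0.
by rewrite (le_trans (enormD _ _))// lerD2l.
Qed.

Lemma enorm_le_sum n (u : 'rV[R]_n) : enorm u <= \sum_i `|u 0 i|.
Proof.
rewrite {1}(row_sum_delta u) (le_trans (enorm_sum _ _))//.
by apply: ler_sum => i _; rewrite enormZ enorm_delta mulr1.
Qed.

(** Reduces a bound on a vector to bounds on scalars, which calculus in one
    variable and scalar integration provide. *)
Lemma enorm_le_dual n (u : 'rV[R]_n) c :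
  0 <= c -> (forall v, dot u v <= c * enorm v) -> enorm u <= c.
Proof.
move=> c0 /(_ u); rewrite -enorm_sqr.
have [->|u0] := eqVneq u 0; first by rewrite enorm0.
by rewrite expr2 ler_pM2r// enorm_gt0.
Qed.

Lemma normr_le_enorm n (u : 'rV[R]_n) : `|u| <= enorm u.
Proof.
rewrite [leLHS]mx_normrE; apply: bigmax_le => // -[i j] _ /=.
by rewrite (ord1 i) coord_le_enorm.
Qed.

Lemma coord_le_normr n (u : 'rV[R]_n) i : `|u 0 i| <= `|u|.
Proof.
rewrite [leRHS]mx_normrE.
exact: (le_bigmax _ (fun ij => `|u ij.1 ij.2|) (0, i)).
Qed.

Lemma enorm_le_normr n (u : 'rV[R]_n) : enorm u <= n%:R * `|u|.
Proof.
rewrite (le_trans (enorm_le_sum u))//.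
rewrite (le_trans (ler_sum _ (fun i _ => coord_le_normr u i)))//.
by rewrite sumr_const card_ord mulr_natl.
Qed.

Lemma enorm_row0 n m (v : 'rV[R]_m) : enorm (row_mx (0 : 'rV[R]_n) v) = enorm v.
Proof.
rewrite /enorm big_split_ord/= [X in X + _]big1 ?add0r; last first.
  by move=> i _; rewrite row_mxEl mxE expr0n.
by congr Num.sqrt; apply: eq_bigr => i _; rewrite row_mxEr.
Qed.

Lemma continuous_coord n (i : 'I_n) : continuous (fun u : 'rV[R]_n => u 0 i).
Proof. exact: coord_continuous. Qed.

Lemma continuous_sum (T : topologicalType) (I : Type) (r : seq I) (F : I -> T -> R) :
  (forall i, continuous (F i)) -> continuous (fun x => \sum_(i <- r) F i x).
Proof.
move=> cF; elim: r => [|i r ih] x.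
  by under eq_fun do rewrite big_nil; exact: cvg_cst.
under eq_fun do rewrite big_cons.
by apply: cvgD; [exact: cF|exact: ih].
Qed.

Lemma continuous_enorm n : continuous (@enorm R n).
Proof.
move=> u; apply: (@continuous_comp _ _ _ _ Num.sqrt); last exact: sqrt_continuous.
apply: continuous_sum => i {}u.
rewrite /continuous_at; under eq_fun do rewrite expr2.
rewrite expr2; have cu := @continuous_coord n i u.
exact: (cvgM cu cu).
Qed.

Lemma opnorm_le n (A : 'M[R]_n) (v : 'rV[R]_n) :
  enorm (v *m A) <= opnorm A * enorm v.
Proof.
have [->|v0] := eqVneq v 0; first by rewrite mul0mx enorm0 mulr0.
have vp : 0 < enorm v by rewrite enorm_gt0.
rewrite -ler_pdivrMr//.
have -> : enorm (v *m A) / enorm v = enorm (((enorm v)^-1 *: v) *m A).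
  by rewrite -scalemxAl enormZ mulrC ger0_norm// invr_ge0.
apply: sup_upper_bound; last first.
  by exists ((enorm v)^-1 *: v) => //=; rewrite enormZ ger0_norm ?invr_ge0// mulVf// gt_eqF.
split; first by exists (enorm ((0 : 'rV[R]_n) *m A)), 0 => //=; rewrite enorm0.
exists (\sum_i enorm (row i A)) => _ [w /= w1 <-].
rewrite mulmx_sum_row (le_trans (enorm_sum _ _))//; apply: ler_sum => i _.
by rewrite enormZ ler_piMl// (le_trans (coord_le_enorm _ _)).
Qed.

End Euclid.
#[export] Hint Resolve enorm_ge0 : core.

(** * Differentiation along lines *)
Section calculus.
Context {R : realType}.

(** The difference quotient differs from [l] by at most [C * |h|]. *)
Lemma is_derive_quadratic (V : normedModType R) (F : V -> R) (x v : V) (l C r : R) :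
  0 < r -> (forall h, `|h| <= r -> `|F (x + h *: v) - F x - h * l| <= C * h ^+ 2) ->
  is_derive x v F l.
Proof.
move=> r0 Hq.
have C0 : 0 <= C.
  have := Hq r; rewrite gtr0_norm// => /(_ (lexx _)) /(le_trans (normr_ge0 _)).
  by rewrite pmulr_lge0// exprn_gt0.
have cv : h^-1 *: ((F \o shift x) (h *: v) - F x) @[h --> 0^'] --> l.
  apply/cvgrPdist_le => e e0; near=> h.
  have h0 : h != 0 by near: h; exact: nbhs_dnbhs_neq.
  have hr : `|h| <= r by near: h; apply/dnbhs0_le.
  have hC : `|h| <= e / (C + 1).
    by near: h; apply: dnbhs0_le; rewrite divr_gt0// ltr_wpDl.
  have hp : 0 < `|h| by rewrite normr_gt0.
  rewrite /= [h *: v + x]addrC -(ler_pM2l hp) -normrM.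
  have -> : h * (l - h^-1 *: (F (x + h *: v) - F x)) =
            - (F (x + h *: v) - F x - h * l).
    rewrite /GRing.scale /= mulrBr mulrA mulfV// mul1r; ring.
  rewrite normrN (le_trans (Hq _ hr))// -(real_normK (num_real h)) expr2.
  rewrite mulrCA ler_pM2l//.
  apply: (@le_trans _ _ ((C + 1) * `|h|)); first by rewrite ler_wpM2r// lerDl.
  by rewrite mulrC -ler_pdivlMr// ltr_wpDl.
have dF : derivable F x v by apply/cvg_ex; exists l; exact: cv.
apply: DeriveDef => //; rewrite /derive; exact/cvg_lim.
Unshelve. all: by end_near. Qed.

(** The mean value theorem, applied to [p - q]. *)
Lemma increment_le (p q dp dq : R -> R) :
  (forall t : R, is_derive t 1 p (dp t)) -> (forall t : R, is_derive t 1 q (dq t)) ->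
  (forall t, 0 <= t <= 1 -> dp t <= dq t) -> p 1 - p 0 <= q 1 - q 0.
Proof.
move=> hp hq hle.
pose u : R -> R := fun x => p x - q x.
have d (t : R) : is_derive t 1 u (dp t - dq t) by exact: is_deriveB.
have [|c] := @MVT_segment R u (fun t => dp t - dq t) 0 1 ler01 (fun x _ => d x).
  apply: derivable_within_continuous => x _.
  exact: (@ex_derive _ _ _ _ _ _ _ (d x)).
rewrite in_itv/= => /hle c01; rewrite subr0 mulr1 /u => e; lra.
Qed.

End calculus.

Lemma is_derive_line {R : realType} (V : normedModType R) (F : V -> R) (x v : V) (t : R) :
  derivable F (x + t *: v) v ->
  is_derive t 1 (fun t => F (x + t *: v)) ('D_v F (x + t *: v)).
Proof.
move=> dF.
have E : (fun h : R => h^-1 *: (((fun t => F (x + t *: v)) \o shift t) (h *: 1) - F (x + t *: v)))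
       = (fun h : R => h^-1 *: ((F \o shift (x + t *: v)) (h *: v) - F (x + t *: v))).
  apply/funext => h /=; congr (_ *: (F _ - _)).
  by rewrite scaler1 scalerDl addrCA.
apply: DeriveDef; last by rewrite /derive E.
by rewrite /derivable E.
Qed.

Lemma sumr_le_size {R : realType} (I : Type) (r : seq I) (F : I -> R) (c : R) :
  (forall i, F i <= c) -> \sum_(i <- r) F i <= (size r)%:R * c.
Proof.
move=> Fc; elim: r => [|i r ih]; first by rewrite big_nil mul0r.
by rewrite big_cons /= -addn1 natrD mulrDl mul1r addrC lerD.
Qed.

Section second_order.
Context {R : realType} (m : nat).

(** The path from [y] to [y + v] moves one coordinate at a time, so that the mean
    value theorem applies to each partial derivative; differentiability in every
    direction follows. *)
Lemma lip_grad_expansion (F : 'rV[R]_m -> R) (K : R) :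
  (forall y i, derivable F y (delta_mx 0 i)) ->
  (forall y y' i, `|partial i F y - partial i F y'| <= K * enorm (y - y')) ->
  exists C, forall y v, `|F (y + v) - F y - dot v (grad F y)| <= C * enorm v ^+ 2.
Proof.
move=> dF lF.
have K0 (v : 'rV[R]_m) (i : 'I_m) : 0 <= K.
  have := lF (delta_mx 0 i) 0 i; rewrite subr0 enorm_delta mulr1.
  exact: le_trans (normr_ge0 _).
have step y i (a : R) :
    `|F (y + a *: delta_mx 0 i) - F y - a * partial i F y| <= K * a ^+ 2.
  pose q (t : R) := F (y + (t * a) *: delta_mx 0 i).
  have dq (t : R) : is_derive t 1 q (a * partial i F (y + (t * a) *: delta_mx 0 i)).
    rewrite mulrC; apply: (is_derive1_comp (f := fun t => F (y + t *: delta_mx 0 i))).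
      exact: is_derive_line.
    apply: is_derive_eq; by rewrite scaler0 add0r scaler1.
  have [|c] := @MVT_segment R q _ 0 1 ler01 (fun x _ => dq x).
    apply: derivable_within_continuous => x _.
    exact: (@ex_derive _ _ _ _ _ _ _ (dq x)).
  rewrite in_itv/= => /andP[c0 c1]; rewrite /q mul1r mul0r scale0r addr0 subr0 mulr1 => ->.
  rewrite -mulrBr normrM -(real_normK (num_real a)) expr2 mulrCA ler_wpM2l//.
  rewrite (le_trans (lF _ _ _))// addrKl enormZ enorm_delta mulr1.
  by rewrite ler_wpM2l ?(K0 y i)// normrM ler_piMl// ger0_norm.
(* Each of the m coordinate moves sees a gradient displaced by at most m |v|. *)
exists ((m ^ 2)%:R * K) => y v.
have H (r : seq 'I_m) : `|F (y + \sum_(i <- r) v 0 i *: delta_mx 0 i) - F y -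
    \sum_(i <- r) v 0 i * partial i F y| <= (size r ^ 2)%:R * K * enorm v ^+ 2.
  elim: r => [|i r ih]; first by rewrite !big_nil addr0 subrr subr0 normr0 !mul0r.
  rewrite !big_cons /=; set w := \sum_(j <- r) _.
  have wle : enorm w <= (size r)%:R * enorm v.
    rewrite (le_trans (enorm_sum _ _))//; apply: sumr_le_size => j.
    by rewrite enormZ enorm_delta mulr1 coord_le_enorm.
  have h1 := step (y + w) i (v 0 i).
  have h2 := lF (y + w) y i; rewrite addrKl in h2.
  have vi := coord_le_enorm v i.
  have k0 := K0 y i; have v0 := enorm_ge0 v.
  rewrite (_ : _ - _ = (F (y + w + v 0 i *: 'e_i) - F (y + w) - v 0 i * partial i F (y + w))
      + (v 0 i * (partial i F (y + w) - partial i F y))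
      + (F (y + w) - F y - \sum_(j <- r) v 0 j * partial j F y)); last first.
    by rewrite [_ *: _ + w]addrC addrA; ring.
  rewrite (le_trans (ler_normD _ _))// (le_trans (lerD (ler_normD _ _) (lexx _)))//.
  rewrite normrM.
  have b1 : K * v 0 i ^+ 2 <= K * enorm v ^+ 2.
    by rewrite ler_wpM2l// -(real_normK (num_real (v 0 i))) ler_sqr ?nnegrE.
  have b2 : `|v 0 i| * `|partial i F (y + w) - partial i F y| <=
            (size r)%:R * K * enorm v ^+ 2.
    rewrite (_ : _ * _ ^+ 2 = enorm v * (K * ((size r)%:R * enorm v))); last by ring.
    by rewrite ler_pM// (le_trans h2)// ler_wpM2l.
  have e : ((size r).+1 ^ 2)%:R = (size r ^ 2)%:R + 2 * (size r)%:R + 1 :> R.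
    by rewrite !natrX -addn1 natrD; ring.
  have b3 : 0 <= (size r)%:R * K * enorm v ^+ 2 by rewrite !mulr_ge0.
  clear K0; rewrite e; lra.
have := H (index_enum _); rewrite -row_sum_delta.
have -> : size (index_enum 'I_m) = m.
  by rewrite -[RHS]card_ord -sum1_card -sum1_size.
have -> // : \sum_(i <- index_enum 'I_m) v 0 i * partial i F y = dot v (grad F y).
by rewrite dot_sum; apply: eq_bigr => i _; rewrite mxE.
Qed.

End second_order.

(** * Taylor bounds with a Lipschitz Hessian *)
Section taylor.
Context {R : realType} (m : nat).
Implicit Types (G : 'rV[R]_m -> R) (y s v : 'rV[R]_m).

(** Regularity of one lower-level objective, with a global Lipschitz bound on its
    Hessian; the constant [K] serves to differentiate along arbitrary
    directions. *)
Definition hess_lipschitz G (L : R) : Prop := [/\ 0 <= L,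
  forall y i, derivable G y (delta_mx 0 i),
  forall y i j, derivable (partial i G) y (delta_mx 0 j),
  exists K, forall y y' i, `|partial i G y - partial i G y'| <= K * enorm (y - y')
  & forall y y', opnorm (hess G y - hess G y') <= L * enorm (y - y')].

Lemma is_derive_along (F : 'rV[R]_m -> R) (K : R) :
  (forall y i, derivable F y (delta_mx 0 i)) ->
  (forall y y' i, `|partial i F y - partial i F y'| <= K * enorm (y - y')) ->
  forall y s (t : R), is_derive t 1 (fun t => F (y + t *: s)) (dot s (grad F (y + t *: s))).
Proof.
move=> dF lF y s t; have [C HC] := lip_grad_expansion dF lF.
apply: (@is_derive_quadratic _ _ _ _ _ _ (C * enorm s ^+ 2) 1 ltr01) => h _.
rewrite scaler1 scalerDl addrA; have := HC (y + t *: s) (h *: s).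
by rewrite dotZl enormZ exprMn real_normK ?num_real// -mulrA [_ ^+ 2 * h ^+ 2]mulrC.
Qed.

Lemma hess_lip_bound G L : hess_lipschitz G L ->
  forall y y' v, enorm (v *m (hess G y - hess G y')) <= L * enorm (y - y') * enorm v.
Proof.
move=> [_ _ _ _ h] y y' v; apply: le_trans (opnorm_le _ _) _.
exact: ler_wpM2r (enorm_ge0 v) _ _ (h y y').
Qed.

Lemma grad_derive G L : hess_lipschitz G L -> forall y s v (t : R),
  is_derive t 1 (fun t => dot v (grad G (y + t *: s))) (dot v (s *m hess G (y + t *: s))).
Proof.
move=> hG y s v t; have [_ d1 d2 _ _] := hG.
have lip2 i u u' j : `|partial j (partial i G) u - partial j (partial i G) u'|
    <= L * enorm (u - u').
  have := hess_lip_bound hG u u' (delta_mx 0 j); rewrite enorm_delta mulr1.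
  apply: le_trans; have := coord_le_enorm ((delta_mx 0 j : 'rV_m) *m (hess G u - hess G u')) i.
  by rewrite -rowE !mxE.
have -> : (fun t => dot v (grad G (y + t *: s))) =
          \sum_i (fun t : R => v 0 i * partial i G (y + t *: s)).
  by apply/funext => x; rewrite fct_sumE dot_sum; apply: eq_bigr => i _; rewrite mxE.
have -> : dot v (s *m hess G (y + t *: s)) =
          \sum_i v 0 i * dot s (grad (partial i G) (y + t *: s)).
  rewrite dot_sum; apply: eq_bigr => i _; congr (_ * _); rewrite mxE dot_sum; apply: eq_bigr => j _.
  by rewrite !mxE.
apply: is_derive_sum => i.
exact: (is_deriveZ (v 0 i) (is_derive_along (fun y => d2 y i) (lip2 i) y s t)).
Qed.

(** Along a segment and against a fixed vector the gradient is a scalar function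
    whose derivative is Lipschitz; comparing derivatives gives the factor [1 / 2]. *)
Lemma grad_taylor G L : hess_lipschitz G L -> forall y s,
  enorm (grad G (y + s) - grad G y - s *m hess G y) <= L / 2 * enorm s ^+ 2.
Proof.
move=> hG y s; apply: enorm_le_dual => [|v].
  by have [L0 _ _ _ _] := hG; rewrite mulr_ge0 ?divr_ge0 ?exprn_ge0 ?ler0n ?enorm_ge0.
pose p (t : R) := dot v (grad G (y + t *: s)).
pose q (t : R) := t * dot v (s *m hess G y) + t ^+ 2 * (L / 2 * enorm s ^+ 2 * enorm v).
have := @increment_le R p q (fun t => dot v (s *m hess G (y + t *: s)))
   (fun t => dot v (s *m hess G y) + 2 * t * (L / 2 * enorm s ^+ 2 * enorm v)).
have dp (t : R) : is_derive t 1 p (dot v (s *m hess G (y + t *: s))).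
  exact: (grad_derive hG y s v t).
have dq (t : R) : is_derive t 1 q
    (dot v (s *m hess G y) + 2 * t * (L / 2 * enorm s ^+ 2 * enorm v)).
  rewrite /q; apply: is_derive_eq.
  by rewrite !scaler0 !add0r /GRing.scale /= !mulr1; ring.
move=> /(_ dp dq); have h t : 0 <= t <= 1 -> dot v (s *m hess G (y + t *: s)) <=
   dot v (s *m hess G y) + 2 * t * (L / 2 * enorm s ^+ 2 * enorm v).
  move=> /andP[t0 t1]; rewrite -lerBlDl -dotNr -dotDr -mulmxBr.
  rewrite (le_trans (dot_le _ _))// mulrC.
  have := hess_lip_bound hG (y + t *: s) y s.
  rewrite addrKl enormZ ger0_norm// => h.
  have := ler_wpM2r (enorm_ge0 v) h; lra.
move=> /(_ h); rewrite /p /q !scale1r !scale0r addr0 !mul0r expr0n /= mul0r expr1n.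
rewrite dotC !dotE !(dotC v) => h1; lra.
Qed.

Fact bilin_key : unit. Proof. exact: tt. Qed.

Definition bilin (A : 'M[R]_m) u v : R := locked_with bilin_key (dot (u *m A) v).

Lemma bilinE A u v : bilin A u v = dot (u *m A) v.
Proof. by rewrite /bilin unlock. Qed.

Lemma bilinDl A u v w : bilin A (u + v) w = bilin A u w + bilin A v w.
Proof. by rewrite !bilinE mulmxDl dotE. Qed.
Lemma bilinDr A u v w : bilin A w (u + v) = bilin A w u + bilin A w v.
Proof. by rewrite !bilinE dotE. Qed.
Lemma bilinZl A a u v : bilin A (a *: u) v = a * bilin A u v.
Proof. by rewrite !bilinE -scalemxAl dotE. Qed.
Lemma bilinZr A a u v : bilin A u (a *: v) = a * bilin A u v.
Proof. by rewrite !bilinE dotE. Qed.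

Lemma bilin0l (A : 'M[R]_m) v : bilin A 0 v = 0.
Proof. by rewrite !bilinE mul0mx dot0l. Qed.

Lemma bilinBm (A B : 'M[R]_m) u v : bilin (A - B) u v = bilin A u v - bilin B u v.
Proof. by rewrite !bilinE mulmxBr !dotE. Qed.

(** The sign [sg] proves both one-sided bounds at once.  The increment is compared
    with a cubic polynomial of the parameter, whose derivative is controlled by
    [grad_taylor]. *)
Lemma taylor_upper G L (sg : bool) : hess_lipschitz G L -> forall y s,
  (-1) ^+ sg * (G (y + s) - G y - dot s (grad G y) - 2^-1 * bilin (hess G y) s s)
  <= L / 6 * enorm s ^+ 3.
Proof.
move=> hG y s; have [_ d1 _ [K lK] _] := hG.
pose p (t : R) := (-1) ^+ sg * G (y + t *: s).
pose q (t : R) := (-1) ^+ sg * (t * dot s (grad G y) + t ^+ 2 * (2^-1 * bilin (hess G y) s s))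
   + t ^+ 3 * (L / 6 * enorm s ^+ 3).
have dp (t : R) : is_derive t 1 p ((-1) ^+ sg * dot s (grad G (y + t *: s))).
  exact: (is_deriveZ ((-1) ^+ sg) (is_derive_along d1 lK y s t)).
have dq (t : R) : is_derive t 1 q
    ((-1) ^+ sg * (dot s (grad G y) + t * bilin (hess G y) s s)
     + t ^+ 2 * (L / 2 * enorm s ^+ 3)).
  rewrite /q; apply: is_derive_eq.
  by rewrite !scaler0 !add0r /GRing.scale /= !mulr1; field.
have /(_ _)  := increment_le dp dq.
have h t : 0 <= t <= 1 -> (-1) ^+ sg * dot s (grad G (y + t *: s)) <=
    (-1) ^+ sg * (dot s (grad G y) + t * bilin (hess G y) s s)
     + t ^+ 2 * (L / 2 * enorm s ^+ 3).
  move=> /andP[t0 t1]; rewrite -lerBlDl -mulrBr.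
  rewrite (le_trans (ler_norm _))// normrM normr_sign mul1r.
  rewrite (_ : _ - _ = dot s (grad G (y + t *: s) - grad G y - (t *: s) *m hess G y)); last first.
    by rewrite !dotE -scalemxAl dotE bilinE (dotC (s *m _)); ring.
  rewrite (le_trans (dot_norm_le _ _))//.
  have := ler_wpM2l (enorm_ge0 s) (grad_taylor hG y (t *: s)).
  rewrite enormZ exprMn real_normK ?num_real//; lra.
move=> /(_ h); rewrite /p /q !scale1r !scale0r addr0 !mul0r !expr0n /= !mul0r !expr1n.
move=> h1; move: h1; lra.
Qed.

Lemma taylor2 G L : hess_lipschitz G L -> forall y s,
  `|G (y + s) - G y - dot s (grad G y) - 2^-1 * bilin (hess G y) s s|
  <= L / 6 * enorm s ^+ 3.
Proof.
move=> hG y s; rewrite ler_norml.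
have h0 := taylor_upper false hG y s; have h1 := taylor_upper true hG y s.
rewrite expr0 mul1r in h0; rewrite expr1 mulN1r in h1.
by rewrite h0 andbT lerNl.
Qed.

Lemma small_quadratic_eq0 (a C : R) :
  (forall e, 0 < e -> `|e ^+ 2 * a| <= C * e ^+ 3) -> a = 0.
Proof.
move=> h; apply/eqP; rewrite -normr_le0 leNgt; apply/negP => a0.
have C0 : 0 <= C.
  by have := h 1 ltr01; rewrite !expr1n mul1r mulr1; apply: le_trans.
pose e := `|a| / (2 * (C + 1)).
have e0 : 0 < e by rewrite divr_gt0// mulr_gt0// ltr_wpDl.
have := h _ e0; rewrite normrM ger0_norm ?sqr_ge0// (exprS e 2) mulrA [C * e]mulrC [_ * e ^+ 2]mulrC.
rewrite ler_pM2l ?exprn_gt0//; apply/negP; rewrite -ltNge /e.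
rewrite mulrC mulrA ltr_pdivrMr ?mulr_gt0 ?ltr_wpDl//.
by have := a0; nra.
Qed.

Lemma hess_sym_arith (g3 g2 g1 ds dt dt' bss bst bts btt btt' e1 e1' e2 e3 e4 e5 : R) :
  `|g3 - g1 - (ds + dt) - 2^-1 * (bss + bst + (bts + btt))| <= e1 ->
  `|g3 - g2 - dt' - 2^-1 * btt'| <= e2 ->
  `|g2 - g1 - ds - 2^-1 * bss| <= e3 ->
  `|dt' - dt - bst| <= e4 -> `|btt' - btt| <= e5 -> e1 <= e1' ->
  `|bst - bts| <= 2 * (e1' + e2 + e5 / 2 + e3 + e4).
Proof.
rewrite !ler_norml => /andP[? ?] /andP[? ?] /andP[? ?] /andP[? ?] /andP[? ?] ?.
by apply/andP; split; lra.
Qed.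

(** Symmetry comes from the Taylor expansions alone: expanding [G (y + s + t)]
    directly and through [y + s] gives the two mixed terms up to cubic errors in
    [s] and [t], and scaling both vectors to zero removes the errors. *)
Lemma hess_sym G L : hess_lipschitz G L -> forall y u v,
  bilin (hess G y) u v = bilin (hess G y) v u.
Proof.
move=> hG y s0 t0; apply/eqP; rewrite -subr_eq0; apply/eqP.
set H := hess G y.
pose C (s t : 'rV[R]_m) := 2 * (L / 6 * (enorm s + enorm t) ^+ 3 + L / 6 * enorm t ^+ 3 +
  L * enorm s * enorm t ^+ 2 / 2 + L / 6 * enorm s ^+ 3 + L / 2 * enorm s ^+ 2 * enorm t).
have key s t : `|bilin H s t - bilin H t s| <= C s t.
  have t1 := taylor2 hG y (s + t).
  have t2 := taylor2 hG (y + s) t.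
  have t3 := taylor2 hG y s.
  have t4 : `|dot t (grad G (y + s) - grad G y - s *m H)| <= L / 2 * enorm s ^+ 2 * enorm t.
    rewrite (le_trans (dot_norm_le _ _))// [leLHS]mulrC; exact: ler_wpM2r (enorm_ge0 t) _ _ (grad_taylor hG y s).
  have t5 : `|bilin (hess G (y + s) - H) t t| <= L * enorm s * enorm t ^+ 2.
    rewrite !bilinE (le_trans (dot_norm_le _ _))//.
    have := hess_lip_bound hG (y + s) y t; rewrite addrKl => h.
    by have := ler_wpM2r (enorm_ge0 t) h; rewrite expr2 mulrA.
  have t6 : L / 6 * enorm (s + t) ^+ 3 <= L / 6 * (enorm s + enorm t) ^+ 3.
    have [L0 _ _ _ _] := hG; rewrite ler_wpM2l ?divr_ge0//.
    apply: lerXn2r; rewrite ?nnegrE ?addr_ge0 ?enorm_ge0//.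
    exact: enormD.
  rewrite bilinDl !bilinDr -/H dotDl in t1.
  rewrite -/H in t3; rewrite !dotDr !dotNr (dotC t (s *m H)) -bilinE in t4.
  rewrite bilinBm in t5.
  rewrite addrA in t1.
  exact: (hess_sym_arith t1 t2 t3 t4 t5 t6).
apply: (@small_quadratic_eq0 _ (C s0 t0)) => e e0.
have := key (e *: s0) (e *: t0).
rewrite !(bilinZl, bilinZr) /C !enormZ (gtr0_norm e0) => h.
rewrite (_ : e ^+ 2 * _ = e * (e * bilin H s0 t0) - e * (e * bilin H t0 s0)); last by ring.
by apply: le_trans h _; rewrite le_eqVlt; apply/orP; left; apply/eqP; ring.
Qed.

End taylor.

(** * The smallest eigenvalue *)
Section eigen.
Context {R : realType}.

(** Lets first-order perturbations be compared without taking limits. *)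
Lemma ge0_of_small (p q : R) : (forall e, 0 < e <= 1 -> 0 <= p + e * q) -> 0 <= p.
Proof.
move=> h; rewrite leNgt; apply/negP => p0.
have q0 : 0 < q by have := h 1; rewrite ltr01 lexx => /(_ isT); lra.
pose e := Num.min 1 (- p / (2 * q)).
have e0 : 0 < e <= 1.
  by rewrite lt_min ltr01 ge_min lexx andbT divr_gt0 ?oppr_gt0// mulr_gt0.
have := h _ e0; have : e * q <= - p / 2.
  rewrite -ler_pdivlMr//.
  have -> : - p / 2 / q = - p / (2 * q) by field; rewrite gt_eqF.
  by rewrite ge_min lexx orbT.
lra.
Qed.

Lemma eq0_of_small (p q : R) : (forall e, `|e| <= 1 -> 0 <= e * p + e ^+ 2 * q) -> p = 0.
Proof.
move=> h; apply/le_anti/andP; split.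
  rewrite -oppr_ge0; apply: (@ge0_of_small _ q) => e /andP[e0 e1].
  have := h (- e); rewrite normrN gtr0_norm// => /(_ e1) h1.
  by rewrite -(pmulr_rge0 _ e0); lra.
apply: (@ge0_of_small _ q) => e /andP[e0 e1].
have := h e; rewrite gtr0_norm// => /(_ e1) h1.
by rewrite -(pmulr_rge0 _ e0); lra.
Qed.

(** The quadratic form attains its minimum on the unit sphere, by compactness.
    Perturbing the minimizer to first order shows that it is an eigenvector, and
    no eigenvalue is below the minimum. *)
Lemma lambda_min_spec m (A : 'M[R]_m) : (0 < m)%N ->
  (forall u v, bilin A u v = bilin A v u) ->
  eigenvalue A (lambda_min A) /\
  forall v, lambda_min A * enorm v ^+ 2 <= bilin A v v.
Proof.
case: m A => // m A _ symA.
pose S := [set v : 'rV[R]_m.+1 | enorm v = 1].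
have S0 : S !=set0 by exists (delta_mx 0 ord0); exact: enorm_delta.
have cS : compact S.
  apply: bounded_closed_compact.
    exists 1; split; first exact: num_real.
    move=> x x1 v /= Sv; rewrite (le_trans (normr_le_enorm v))// Sv; exact: ltW.
  rewrite (_ : S = (@enorm R m.+1) @^-1` [set 1]); last by [].
  apply: closed_comp; last exact: closed_eq.
  by move=> v _; exact: continuous_enorm.
have cB : continuous (fun v : 'rV[R]_m.+1 => bilin A v v).
  move=> v; under eq_fun do rewrite bilinE dot_sum.
  have h : continuous (fun v : 'rV[R]_m.+1 => \sum_i (v *m A) 0 i * v 0 i).
    apply: continuous_sum => i {}v.
    have c1 : continuous (fun v : 'rV[R]_m.+1 => (v *m A) 0 i).
      under eq_fun do rewrite mxE.
      apply: continuous_sum => j {}v.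
      exact: cvgM (@continuous_coord _ _ j v) (cvg_cst (A j i)).
    exact: cvgM (c1 v) (@continuous_coord _ _ i v).
  exact: h.
(* v0 minimizes the quadratic form on the unit sphere and c is its value. *)
have [v0 /[!inE] v01 vmin] := @EVT_min_rV R m.+1 _ S S0 cS (continuous_subspaceT cB).
set c := bilin A v0 v0 in vmin.
have lb v : c * enorm v ^+ 2 <= bilin A v v.
  have [->|v_0] := eqVneq v 0; first by rewrite enorm0 expr0n mulr0 bilin0l.
  have vp := enorm_gt0 v_0.
  have := vmin ((enorm v)^-1 *: v); rewrite inE /S/= enormZ ger0_norm ?invr_ge0 ?enorm_ge0//.
  rewrite mulVf ?gt_eqF// => /(_ erefl); rewrite bilinZl bilinZr mulrA -expr2 exprVn.
  by rewrite mulrC ler_pdivlMr// exprn_gt0.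
have v0c : v0 *m A = c *: v0.
  apply/eqP; rewrite -subr_eq0; apply/eqP/enorm_eq0/le_anti; rewrite enorm_ge0 andbT.
  apply: enorm_le_dual => // w; rewrite mul0r !dotE -bilinE le_eqVlt; apply/orP; left.
  apply/eqP/(@eq0_of_small _ ((bilin A w w - c * enorm w ^+ 2) / 2)) => e _.
  have := lb (v0 + e *: w).
  rewrite !(bilinDl, bilinDr, bilinZl, bilinZr) (symA w) enormD_sqr enormZ exprMn.
  rewrite real_normK ?num_real// v01 dotZr -/c; lra.
have eigc : eigenvalue A c.
  apply/eigenvalueP; exists v0 => //; apply/eqP => v00.
  by have := v01; rewrite /S/= v00 enorm0 => /eqP; rewrite eq_sym oner_eq0.
have lbe l : eigenvalue A l -> c <= l.
  move=> /eigenvalueP[v vl v_0]; have := lb v.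
  by rewrite bilinE vl dotE -enorm_sqr ler_pM2r// exprn_gt0// enorm_gt0.
have -> : lambda_min A = c; last by [].
apply/le_anti/andP; split.
  by apply: ge_inf => //; exists c => l; exact: lbe.
by apply: lb_le_inf; [exists c|move=> l /lbe].
Qed.

End eigen.

Lemma ler_distl_dist_lower (R : realType) (a b c : R) : `|a - b| <= c -> b - c <= a.
Proof. by rewrite ler_norml => /andP[+ _]; lra. Qed.

(** * One cubic Newton step *)

Section cubic_step.
Context {R : realType} (m : nat) (G : 'rV[R]_m -> R) (L : R).
Hypothesis hG : hess_lipschitz G L.

Let H y := hess G y.

Lemma cubic_modelE y s :
  cubic_model L G y s = dot (grad G y) s + 2^-1 * bilin (H y) s s + L / 6 * enorm s ^+ 3.
Proof. by rewrite /cubic_model !dotmx bilinE. Qed.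

Variables (y s : 'rV[R]_m).
Hypothesis smin : forall s', cubic_model L G y s <= cubic_model L G y s'.

Lemma L_ge0 : 0 <= L. Proof. by case: hG. Qed.

(** The cube of the norm is not smooth at the origin, so its expansion is obtained
    from that of the square through an identity in the two norms. *)
Lemma enorm_step (v : 'rV[R]_m) (e : R) : `|e| <= 1 ->
  enorm (s + e *: v) ^+ 3 <= enorm s ^+ 3 + e * (3 * enorm s * dot s v)
    + e ^+ 2 * (3 / 2 * enorm s * enorm v ^+ 2 + enorm v ^+ 2 * (3 / 2 * enorm s + enorm v)).
Proof.
move=> e1; set b := enorm (s + _); set a := enorm s.
have hb : b ^+ 2 = a ^+ 2 + 2 * (e * dot s v) + e ^+ 2 * enorm v ^+ 2.
  by rewrite /b enormD_sqr dotZr enormZ exprMn real_normK ?num_real.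
have ba : `|b - a| <= `|e| * enorm v.
  rewrite ler_norml; apply/andP; split.
    have := enormD (s + e *: v) (- (e *: v)); rewrite addrK enormN enormZ -/b -/a; lra.
  by have := enormD s (e *: v); rewrite enormZ -/b -/a; lra.
have d2 : (b - a) ^+ 2 <= e ^+ 2 * enorm v ^+ 2.
  rewrite -(real_normK (num_real (b - a))) -(real_normK (num_real e)) -exprMn.
  by rewrite ler_sqr ?nnegrE ?mulr_ge0 ?normr_ge0 ?enorm_ge0.
have ev : `|e| * enorm v <= enorm v by rewrite ler_piMl ?enorm_ge0.
have b0 : 0 <= b by exact: enorm_ge0.
have a0 : 0 <= a by exact: enorm_ge0.
have ble : b + a / 2 <= 3 / 2 * a + enorm v.
  by move: ba; rewrite ler_norml => /andP[_]; lra.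
have h1 : (b - a) ^+ 2 * (b + a / 2) <= e ^+ 2 * enorm v ^+ 2 * (3 / 2 * a + enorm v).
  by apply: ler_pM; rewrite ?sqr_ge0 ?addr_ge0 ?divr_ge0 ?enorm_ge0.
have -> : b ^+ 3 = 3 / 2 * a * b ^+ 2 - a ^+ 3 / 2 + (b - a) ^+ 2 * (b + a / 2) by field.
rewrite hb; lra.
Qed.

(** The first-order term of the model along [s + e v]. *)
Lemma cubic_first_order v :
  dot (grad G y) v + bilin (H y) s v + L / 2 * enorm s * dot s v = 0.
Proof.
apply: (@eq0_of_small _ _ (2^-1 * bilin (H y) v v +
  L / 6 * (3 / 2 * enorm s * enorm v ^+ 2 + enorm v ^+ 2 * (3 / 2 * enorm s + enorm v)))) => e e1.
have := smin (s + e *: v); rewrite !cubic_modelE.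
rewrite !(bilinDl, bilinDr, bilinZl, bilinZr) (hess_sym hG _ v s) !dotDr !dotZr.
have L6 : 0 <= L / 6 by rewrite divr_ge0 ?L_ge0.
have := ler_wpM2l L6 (enorm_step v e1); lra.
Qed.

(** Global minimality gives more curvature than local minimality.  If [s] is not
    orthogonal to [w], the reflected point [s - c w] has the same norm as [s], so
    the cubic terms cancel when the two values of the model are compared and the
    first-order condition leaves exactly the quadratic form at [w].  Vectors
    orthogonal to [s] are limits of such [w]. *)
Lemma cubic_second_order v :
  0 <= bilin (H y) v v + L / 2 * enorm s * enorm v ^+ 2.
Proof.
have L6 : 0 <= L / 6 by rewrite divr_ge0 ?L_ge0.
have [s0|s0] := eqVneq s 0.
  rewrite s0 enorm0 mulr0 mul0r addr0; apply: (@ge0_of_small _ _ (2 * (L / 6 * enorm v ^+ 3))).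
  move=> e /andP[e0 e1]; have := smin (e *: v); have := cubic_first_order v.
  rewrite !cubic_modelE s0 !(bilinZl, bilinZr) !(dotE, enorm0, expr0n) /=.
  rewrite !bilin0l => f1 h.
  have f2 : dot (grad G y) v = 0 by lra.
  rewrite f2 in h.
  rewrite -(pmulr_rge0 _ (exprn_gt0 2 e0)).
  move: h; rewrite enormZ (gtr0_norm e0); lra.
have nonorth w : dot s w != 0 -> 0 <= bilin (H y) w w + L / 2 * enorm s * enorm w ^+ 2.
  move=> sw.
  have w0 : 0 < enorm w by apply/enorm_gt0/eqP => w0; rewrite w0 dot0r eqxx in sw.
  (* Reflection of s in the hyperplane orthogonal to w. *)
  pose c := 2 * dot s w / enorm w ^+ 2.
  have c0 : c != 0 by rewrite !mulf_neq0// invr_neq0// expf_neq0// gt_eqF.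
  have cw : dot s w = c * enorm w ^+ 2 / 2.
    by rewrite /c; field; rewrite gt_eqF.
  have e : enorm (s - c *: w) = enorm s.
    apply/eqP; rewrite -(@eqrXn2 _ 2) ?enorm_ge0// enormD_sqr enormN enormZ exprMn real_normK ?num_real//.
    by rewrite dotNr dotZr cw; apply/eqP; field.
  have := smin (s - c *: w); rewrite !cubic_modelE e.
  have := cubic_first_order w.
  rewrite -scaleNr !(bilinDl, bilinDr, bilinZl, bilinZr) (hess_sym hG _ w s) !dotDr !dotZr cw.
  move=> f1 f2; rewrite -(pmulr_rge0 _ (_ : 0 < c ^+ 2 / 2)); last first.
    by rewrite divr_gt0// exprn_even_gt0.
  have f3 : c * (dot (grad G y) w + bilin (H y) s w + L / 2 * enorm s * (c * enorm w ^+ 2 / 2)) = 0.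
    by rewrite f1 mulr0.
  lra.
have [sv|/nonorth//] := eqVneq (dot s v) 0.
(* v is orthogonal to s: perturb it by e s and let e tend to zero. *)
pose q := bilin (H y) v s + bilin (H y) s v.
apply: (@ge0_of_small _ _ (`|q| + `|bilin (H y) s s + L / 2 * enorm s * enorm s ^+ 2|)) => e /andP[e0 e1].
have := nonorth (v + e *: s).
have ss : 0 < dot s s by rewrite -enorm_sqr exprn_gt0// enorm_gt0.
rewrite dotDr dotZr sv add0r mulf_neq0 ?gt_eqF// => /(_ isT).
rewrite !(bilinDl, bilinDr, bilinZl, bilinZr) enormD_sqr enormZ exprMn real_normK ?num_real//.
rewrite dotZr dotC sv !mulr0 addr0.
have h1 : e * q <= e * `|q| by rewrite ler_pM2l// ler_norm.
set z := bilin _ s s + _ in h1 *.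
have h2 : e ^+ 2 * z <= e * `|z|.
  by rewrite expr2 -mulrA ler_pM2l// (le_trans (ler_norm _))// normrM gtr0_norm// ler_piMl.
move: h1 h2; rewrite /z /q; lra.
Qed.

(** The model overestimates [G], and at its minimizer the two optimality conditions
    tested against [s] itself bound the value of the model. *)
Lemma cubic_descent : G (y + s) <= G y - L / 12 * enorm s ^+ 3.
Proof.
have := taylor2 hG y s; rewrite ler_norml => /andP[_].
have := cubic_first_order s; have := cubic_second_order s.
rewrite dotC -enorm_sqr -/(H y); lra.
Qed.

(** Stationarity of the model makes the gradient predicted at [y + s] equal to
    [- (L / 2) |s| s], and the prediction is off by at most [L / 2 |s| ^ 2]. *)
Lemma cubic_grad : enorm (grad G (y + s)) <= L * enorm s ^+ 2.
Proof.
have h : grad G y + s *m H y = - (L / 2 * enorm s) *: s.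
  apply/eqP; rewrite scaleNr -addr_eq0; apply/eqP/enorm_eq0/le_anti; rewrite enorm_ge0 andbT.
  by apply: enorm_le_dual => // v; rewrite mul0r !dotDl dotZl -bilinE cubic_first_order.
have -> : grad G (y + s) = (grad G (y + s) - grad G y - s *m H y) + (grad G y + s *m H y).
  by rewrite addrA -(addrA _ _ (grad G y)) [- _ + grad G y]addrC addrA subrK subrK.
rewrite (le_trans (enormD _ _))// h enormZ normrN ger0_norm; last first.
  by rewrite mulr_ge0 ?divr_ge0 ?enorm_ge0 ?L_ge0.
have := grad_taylor hG y s; rewrite -/(H y); lra.
Qed.

Lemma hess_perturb (y1 y2 v : 'rV[R]_m) :
  bilin (hess G y1) v v - L * enorm (y2 - y1) * enorm v ^+ 2 <= bilin (hess G y2) v v.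
Proof.
have h : `|bilin (hess G y2 - hess G y1) v v| <= L * enorm (y2 - y1) * enorm v * enorm v.
  rewrite bilinE; apply: le_trans (dot_norm_le _ _) _.
  exact: ler_wpM2r (enorm_ge0 v) _ _ (hess_lip_bound hG y2 y1 v).
move: h; rewrite bilinBm => /ler_distl_dist_lower h.
by rewrite expr2 mulrA.
Qed.

Lemma cubic_hess v : - (3 / 2 * L * enorm s) * enorm v ^+ 2 <= bilin (hess G (y + s)) v v.
Proof.
have arith (b b' a q : R) : b - L * a * q <= b' -> 0 <= b + L / 2 * a * q ->
  - (3 / 2 * L * a) * q <= b' by lra.
have h1 := hess_perturb y (y + s) v; rewrite (addrKl y s) in h1.
exact: arith h1 (cubic_second_order v).
Qed.

(** The criterion is scaled so that the length of a step bounds it at the next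
    point. *)
Lemma cubic_criterion : (0 < m)%N -> 0 < L -> criterion L G (y + s) <= enorm s.
Proof.
move=> m0 L0; rewrite /criterion ge_max; apply/andP; split.
  rewrite -(ger0_norm (enorm_ge0 s)) -sqrtr_sqr ler_wsqrtr// mulrC ler_pdivrMr// mulrC.
  exact: cubic_grad.
have [/eigenvalueP[v vl v0] _] := lambda_min_spec m0 (hess_sym hG (y + s)).
have := cubic_hess v; rewrite bilinE vl dotE -enorm_sqr ler_pM2r; last first.
  by rewrite exprn_gt0// enorm_gt0.
move=> h; rewrite mulNr lerNl -ler_pdivrMl ?divr_gt0 ?mulr_gt0//.
by apply: le_trans h; rewrite le_eqVlt; apply/orP; left; apply/eqP; field; rewrite gt_eqF.
Qed.

End cubic_step.

(** * Cubic Newton iterates *)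
Section newton.
Context {R : realType} (m : nat) (G : 'rV[R]_m -> R) (L : R).
Hypothesis m0 : (0 < m)%N.
Hypothesis L0 : 0 < L.
Hypothesis hG : hess_lipschitz G L.
Variables (y0 : 'rV[R]_m) (y : nat -> 'rV[R]_m).
Hypothesis newt : cubic_newton L G y0 y.

Lemma newton_decrease k : exists2 r, 0 <= r &
  G (y k.+1) <= G (y k) - L / 12 * r ^+ 3 /\ criterion L G (y k.+1) <= r.
Proof.
have [_ /(_ k)[s [-> smin]]] := newt.
exists (enorm s); first exact: enorm_ge0.
split; first exact: (cubic_descent hG smin).
exact: (cubic_criterion hG smin m0 L0).
Qed.

Lemma newton_nonincreasing k l : (k <= l)%N -> G (y l) <= G (y k).
Proof.
move=> /subnK <-; elim: (l - k)%N => // j ih; rewrite addSn.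
have [r r0 [h _]] := newton_decrease (j + k); apply: le_trans ih.
by rewrite (le_trans h)// lerBlDr lerDl mulr_ge0 ?exprn_ge0// divr_ge0// ltW.
Qed.

Lemma newton_le0 k : G (y k) <= G y0.
Proof. by have [<- _] := newt; exact: newton_nonincreasing. Qed.

Lemma criterion_ge0 z : 0 <= criterion L G z.
Proof. by rewrite /criterion le_max sqrtr_ge0. Qed.

(** The decreases of the [K] steps telescope, and each is at least a multiple of
    the cube of the best criterion. *)
Lemma best_criterion glow K k : (forall z, glow <= G z) -> best_index L G y K k ->
  K%:R * (L * criterion L G (y k) ^+ 3) <= 12 * (G y0 - glow).
Proof.
move=> hlow [_ kbest].
have gen (c : R) : 0 <= c -> (forall k', (k' <= K)%N -> c <= criterion L G (y k')) ->
    K%:R * (L * c ^+ 3) <= 12 * (G y0 - glow).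
  move=> {k} c0 {}kbest.
  have h j : (j <= K)%N -> j%:R * (L * c ^+ 3) <= 12 * (G y0 - G (y j)).
    elim: j => [_|j ih jK].
      by have [<- _] := newt; rewrite mul0r subrr mulr0.
    have [r r0 [h1 h2]] := newton_decrease j.
    have h3 := ih (ltnW jK).
    have cr : L * c ^+ 3 <= L * r ^+ 3.
      have cr : c <= r by exact: le_trans (kbest _ jK) h2.
      by apply: ler_wpM2l; rewrite ?(ltW L0)// lerXn2r.
    rewrite -addn1 natrD mulrDl mul1r addn1.
    have arith (a b g0 g1 g2 z : R) : z <= 12 * (g0 - g1) -> a <= b ->
      g2 <= g1 - L / 12 * r ^+ 3 -> b = L * r ^+ 3 -> z + a <= 12 * (g0 - g2) by lra.
    exact: (arith _ _ _ _ _ _ h3 cr h1 erefl).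
  apply: le_trans (h K (leqnn K)) _; rewrite ler_pM2l//; apply: lerB => //.
exact: gen (criterion_ge0 _) kbest.
Qed.

Lemma criterion_grad z : enorm (grad G z) <= L * criterion L G z ^+ 2.
Proof.
rewrite -ler_pdivrMl//.
rewrite -(sqr_sqrtr (_ : 0 <= L^-1 * enorm (grad G z))); last first.
  by rewrite mulr_ge0 ?enorm_ge0 ?invr_ge0 ?(ltW L0).
by rewrite lerXn2r ?nnegrE ?sqrtr_ge0 ?criterion_ge0// /criterion le_max lexx.
Qed.

Lemma criterion_hess z v :
  - (3 / 2 * L * criterion L G z) * enorm v ^+ 2 <= bilin (hess G z) v v.
Proof.
have [_ h] := lambda_min_spec m0 (hess_sym hG z).
apply: le_trans (h v); rewrite ler_wpM2r ?exprn_ge0 ?enorm_ge0//.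
have : - (2 / (3 * L)) * lambda_min (hess G z) <= criterion L G z.
  by rewrite /criterion le_max lexx orbT.
rewrite mulNr lerNl -ler_pdivrMl ?divr_gt0 ?mulr_gt0// => h2.
by apply: le_trans h2; rewrite le_eqVlt; apply/orP; left; apply/eqP; field; rewrite gt_eqF.
Qed.

Section basin.
Variables (ys : 'rV[R]_m) (mu : R).
Hypothesis mu0 : 0 < mu.
Hypothesis ys0 : grad G ys = 0.
Hypothesis ysmu : forall v, mu * enorm v ^+ 2 <= bilin (hess G ys) v v.

(** Taylor expansion of the gradient at [ys], tested against [z - ys]. *)
Lemma basin_dist z : (mu - L / 2 * enorm (z - ys)) * enorm (z - ys) <= enorm (grad G z).
Proof.
set u := z - ys; have zE : z = ys + u by rewrite addrC subrK.
have [u0|u0] := eqVneq u 0.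
  by rewrite u0 enorm0 mulr0 enorm_ge0.
have up := enorm_gt0 u0.
have arith (g t b : R) : b - t <= L / 2 * enorm u ^+ 2 * enorm u ->
    t <= g * enorm u -> mu * enorm u ^+ 2 <= b -> (mu - L / 2 * enorm u) * enorm u <= g.
  by move=> h1 h2 h3; rewrite -(ler_pM2r up); lra.
have h1 := grad_taylor hG ys u; rewrite -zE ys0 subr0 in h1.
apply: (@arith _ (dot (grad G z - 0) u) (bilin (hess G ys) u u)).
- rewrite subr0 bilinE -dotNl -dotDl -enormB in h1 *; apply: le_trans (dot_le _ _) _.
  exact: ler_wpM2r (enorm_ge0 u) _ _ h1.
- by rewrite subr0; exact: dot_le.
- exact: ysmu.
Qed.

(** Otherwise the new distance exceeds the old one.  The stationarity equation of
    the step, tested against the new offset [u'], then contradicts the lower bound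
    on the Hessian: the regularization term has the favourable sign precisely
    because the offset has grown. *)
Lemma basin_step z s : (forall s', cubic_model L G z s <= cubic_model L G z s') ->
  3 / 2 * L * enorm (z - ys) < mu -> enorm (z + s - ys) <= enorm (z - ys).
Proof.
move=> smin zmu; set u := z - ys; set u' := z + s - ys.
have sE : s = u' - u.
  by rewrite /u' /u opprB addrA subrK [z + s]addrC addrK.
rewrite leNgt; apply/negP => uu'.
set t := enorm u in zmu uu' *; set t' := enorm u' in uu' *.
have t0 : 0 <= t by exact: enorm_ge0.
have arith (g b a d : R) : `|g| <= L / 2 * t ^+ 2 * t' -> (mu - L * t) * t' ^+ 2 <= b ->
    0 <= a -> t' ^+ 2 - t * t' <= d -> b = g - L / 2 * a * d -> False.
  rewrite ler_norml => /andP[_ h1] h2 a0 h3 h4.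
  have tp : 0 < t' by exact: le_lt_trans uu'.
  have d0 : 0 <= d by apply: le_trans h3; nra.
  have ad : 0 <= L / 2 * a * d by rewrite !mulr_ge0 ?divr_ge0 ?(ltW L0).
  have : (mu - L * t) * t' ^+ 2 <= L / 2 * t ^+ 2 * t' by lra.
  rewrite expr2 mulrA ler_pM2r// => h5.
  have tt : L / 2 * t ^+ 2 <= L / 2 * (t * t').
    by rewrite expr2 ler_wpM2l ?divr_ge0 ?(ltW L0)// ler_wpM2l// ltW.
  have h6 : (mu - 3 / 2 * L * t) * t' <= 0 by lra.
  have : 0 < (mu - 3 / 2 * L * t) * t' by rewrite mulr_gt0// subr_gt0.
  lra.
have h1 := grad_taylor hG z (- u).
have zu : z - u = ys by rewrite /u opprB addrC subrK.
rewrite zu ys0 mulNmx opprK sub0r enormN -/t in h1.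
have sd : dot s u' = enorm u' ^+ 2 - dot u u' by rewrite sE dotDl dotNl enorm_sqr.
have b1 : bilin (hess G z) u' u' = bilin (hess G z) s u' + bilin (hess G z) u u'.
  by rewrite -bilinDl sE subrK.
apply: (@arith (bilin (hess G z) u u' - dot (grad G z) u') (bilin (hess G z) u' u')
   (enorm s) (dot s u')).
- rewrite bilinE -dotNl -dotDl addrC; apply: le_trans (dot_norm_le _ _) _.
  exact: ler_wpM2r (enorm_ge0 u') _ _ h1.
- apply: le_trans _ (hess_perturb hG ys z u'); rewrite mulrBl lerB//; exact: ysmu.
- exact: enorm_ge0.
- by rewrite sd lerB//; exact: dot_le.
- rewrite b1; have := cubic_first_order hG smin u'.
  move: (bilin (hess G z) s u') => b0 h2.
  by apply/eqP; rewrite -subr_eq0 -h2; apply/eqP; ring.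
Qed.

End basin.
End newton.

(** * Accuracy of the lower-level output *)
Section accuracy.
Context {R : realType}.

Lemma powR_half (a : R) : 0 <= a -> a `^ (1 / 2) = Num.sqrt a.
Proof. by move=> a0; rewrite mul1r powR12_sqrt. Qed.

Lemma powR_three_halves (a : R) : 0 <= a -> a `^ (3 / 2) = Num.sqrt a ^+ 3.
Proof.
by move=> a0; rewrite mulrC powRrM powR12_sqrt// powR_mulrn// sqrtr_ge0.
Qed.

(** Solves the bound of [best_criterion] for the criterion; the numerical constants
    of the step count are those that give [9 / 16] and, below, [4]. *)
Lemma grad_accuracy (D M e c k : R) : 0 < M -> 0 < e -> 0 <= c -> 0 < k ->
  k * (M * c ^+ 3) <= 12 * D -> 256 * D * M `^ (1 / 2) / (9 * e `^ (3 / 2)) <= k ->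
  M * c ^+ 2 <= 9 / 16 * e.
Proof.
move=> M0 e0 c0 k0 h1; rewrite (powR_half (ltW M0)) (powR_three_halves (ltW e0)).
set q := Num.sqrt M; set w := Num.sqrt e.
have q0 : 0 < q by rewrite sqrtr_gt0.
have w0 : 0 < w by rewrite sqrtr_gt0.
have qM : q ^+ 2 = M by rewrite sqr_sqrtr// ltW.
have we : w ^+ 2 = e by rewrite sqr_sqrtr// ltW.
rewrite ler_pdivrMr ?mulr_gt0 ?exprn_gt0// => h2.
have h3 : k * (4 * (q * c)) ^+ 3 <= k * (3 * w) ^+ 3.
  have := ler_wpM2r (ltW q0) h1; rewrite -qM => h3; lra.
have h4 : 4 * (q * c) <= 3 * w.
  rewrite -(ler_pXn2r (_ : 0 < 3)%N) ?nnegrE ?mulr_ge0 ?ler0n ?(ltW q0) ?(ltW w0)//.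
  by rewrite -(ler_pM2l k0).
have h5 : (4 * (q * c)) ^+ 2 <= (3 * w) ^+ 2.
  by rewrite lerXn2r ?nnegrE ?mulr_ge0 ?ler0n ?(ltW q0) ?(ltW w0).
by rewrite -qM -we; lra.
Qed.

Lemma hess_accuracy (D M mu c k : R) : 0 < M -> 0 < mu -> 0 <= c -> 0 < k ->
  k * (M * c ^+ 3) <= 12 * D -> 768 * D * M ^+ 2 / mu ^+ 3 <= k -> 4 * M * c <= mu.
Proof.
move=> M0 mu0 c0 k0 h1; rewrite ler_pdivrMr ?exprn_gt0// => h2.
rewrite -(ler_pXn2r (_ : 0 < 3)%N) ?nnegrE ?mulr_ge0 ?ler0n ?(ltW M0) ?(ltW mu0)//.
rewrite -(ler_pM2l k0).
by have := ler_wpM2r (sqr_ge0 M) h1 => h3; lra.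
Qed.

Lemma continuous_enormB n (v : 'rV[R]_n) : continuous (fun u : 'rV[R]_n => enorm (u - v)).
Proof.
move=> u; have h : (fun u : 'rV[R]_n => u - v) @ u --> u - v.
  exact: (cvgB (@cvg_id _ (nbhs u)) (cvg_cst v)).
exact: continuous_comp h (@continuous_enorm R n (u - v)).
Qed.

Lemma closed_enorm_ball n (v : 'rV[R]_n) (r : R) :
  closed [set u : 'rV[R]_n | enorm (u - v) <= r].
Proof.
rewrite (_ : mkset _ = (fun u : 'rV[R]_n => enorm (u - v)) @^-1` [set x | x <= r]); last by [].
apply: closed_comp; last exact: closed_le.
by move=> u _; exact: continuous_enormB.
Qed.

Lemma max_add_lt (a1 a2 a3 k : R) : 0 <= a1 -> 0 <= a3 -> Num.max a1 a2 + a3 < k ->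
  [/\ a1 <= k, a2 <= k, a3 <= k & 0 < k].
Proof.
move=> h1 h3 hk.
have : a1 <= Num.max a1 a2 by rewrite le_max lexx.
have : a2 <= Num.max a1 a2 by rewrite le_max lexx orbT.
by move: hk; move: (Num.max a1 a2) => x; split; lra.
Qed.

Lemma steps_term_ge0 (a b c e : R) : 0 <= a -> 0 <= b -> 0 <= c ->
  0 <= 256 * a * b `^ c / (9 * e `^ (3 / 2)).
Proof.
move=> a0 b0 c0; apply: divr_ge0; last by rewrite mulr_ge0 ?ler0n ?powR_ge0.
exact: mulr_ge0 (mulr_ge0 (ler0n _ 256) a0) (powR_ge0 _ _).
Qed.

(** The gradient at the output is below [alpha], so a stationary point lies within
    about [mu / (2 L)]; there the Hessian is still almost nonnegative, hence at
    least [mu] since no eigenvalue lies strictly between [- mu] and [mu].  The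
    third part of the step count makes the output [rho]-close to this minimizer, and
    the later iterates do not move away from it, so both the output and any
    accumulation point lie in the same ball of radius [rho]. *)
Lemma newton_accuracy m (G : 'rV[R]_m -> R) (L : R) (y0 : 'rV[R]_m) (y : nat -> 'rV[R]_m)
   (glow g0bar : R) (mu : R -> R) (alpha : R -> R -> R) (rho delta : R)
   (Y' : set 'rV[R]_m) (K k : nat) :
  (0 < m)%N -> 0 < L -> hess_lipschitz G L -> cubic_newton L G y0 y ->
  (forall z, glow <= G z) -> G y0 <= g0bar -> 0 < rho -> 0 < mu delta ->
  0 < alpha delta (mu delta / (2 * L)) ->
  (forall z l, Y' z -> grad G z = 0 -> eigenvalue (hess G z) l -> mu delta <= `|l|) ->
  (forall z, G z <= G y0 ->
    ((mu delta / (2 * L))%:E < dist z [set y' | Y' y' /\ (grad G y' = 0)%R])%E ->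
    alpha delta (mu delta / (2 * L)) <= enorm (grad G z)) ->
  steps_bound g0bar glow L mu alpha rho delta < K%:R -> best_index L G y K k ->
  forall z, accumulation_points y z -> enorm (y k - z) <= 2 * rho.
Proof.
move=> m0 L0 hG newt hlow hg0 rho0 mu0 al0 heig hal hK kbest z zacc.
set mud := mu delta in mu0 al0 heig hal.
set al := alpha delta (mud / (2 * L)) in al0 hal.
have Dge : 0 <= g0bar - glow by rewrite subr_ge0 (le_trans (hlow y0)).
have LL : 0 <= L `^ (1 / 2) by exact: powR_ge0.
pose e1 := Num.min al (mud ^+ 2 / (4 * L)).
have e10 : 0 < e1 by rewrite lt_min al0 divr_gt0 ?exprn_gt0 ?mulr_gt0.
pose D := g0bar - glow.
have A1 : 0 <= 256 * D * L `^ (1 / 2) / (9 * e1 `^ (3 / 2)).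
  by apply: steps_term_ge0 => //; exact: ltW.
have A3 : 0 <= 256 * D * L `^ (1 / 2) / (9 * (mud * rho) `^ (3 / 2)).
  by apply: steps_term_ge0 => //; exact: ltW.
have [h1 h2 h3 K0] := max_add_lt A1 A3 hK.
clear hK A1 A3.
have hc := best_criterion m0 L0 hG newt hlow kbest.
have hgr := criterion_grad G L0 (y k).
have hhe := criterion_hess m0 L0 hG (y k).
have c0 := criterion_ge0 G L (y k).
have yk0 := newton_le0 m0 L0 hG newt k.
move: c0 hc hgr hhe; move: (criterion L G (y k)) => c c0 hc hgr hhe.
have hcD : K%:R * (L * c ^+ 3) <= 12 * D.
  by apply: le_trans hc _; rewrite ler_pM2l// lerD2r.
have g1 := le_trans hgr (grad_accuracy L0 e10 c0 K0 hcD h1).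
have g3 := le_trans hgr (grad_accuracy L0 (mulr_gt0 mu0 rho0) c0 K0 hcD h3).
have c4 := hess_accuracy L0 mu0 c0 K0 hcD h2.
have small : enorm (grad G (y k)) < al.
  apply: le_lt_trans g1 _; have : e1 <= al by rewrite /e1 ge_min lexx.
  by move: e10; clear; lra.
have hd : (dist (y k) [set y' | Y' y' /\ (grad G y' = 0)%R] <= (mud / (2 * L))%:E)%E.
  by rewrite leNgt; apply/negP => /(hal _ yk0); rewrite leNgt small.
have [ys [Y'ys ys0] ysd] : exists2 ys, Y' ys /\ grad G ys = 0 & L * enorm (y k - ys) <= 9 / 16 * mud.
  have : (dist (y k) [set y' | Y' y' /\ (grad G y' = 0)%R] < (9 / 16 * (mud / L))%:E)%E.
    apply: le_lt_trans hd _; rewrite lte_fin.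
    have -> : mud / (2 * L) = 1 / 2 * (mud / L) by field; rewrite gt_eqF.
    by rewrite ltr_pM2r ?divr_gt0//; lra.
  move=> /ereal_inf_lt[_ [ys ysS <-]]; rewrite lte_fin => h.
  exists ys; first exact: ysS.
  rewrite [leLHS]mulrC -ler_pdivlMr// -(mulrA (9 / 16)).
  exact: ltW h.
clear hd small g1 h1 h2 h3.
have ysmu v : mud * enorm v ^+ 2 <= bilin (hess G ys) v v.
  have [eig lbv] := lambda_min_spec m0 (hess_sym hG ys).
  have := heig _ _ Y'ys ys0 eig; move: eig lbv; move: (lambda_min _) => l eig lbv hl.
  apply: le_trans (lbv v); apply: ler_wpM2r; first by rewrite exprn_ge0 ?enorm_ge0.
  have [w wl w0] := eigenvalueP eig.
  have wp : 0 < enorm w ^+ 2 by rewrite exprn_gt0 ?enorm_gt0.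
  have arith (b t : R) : L * t <= 9 / 16 * mud ->
     - (3 / 2 * L * c) * enorm w ^+ 2 <= b -> b - L * t * enorm w ^+ 2 <= l * enorm w ^+ 2 ->
     - mud < l.
    move=> q1 q2 q3; rewrite -(ltr_pM2r wp).
    apply: lt_le_trans q3; apply: lt_le_trans (lerB q2 (ler_wpM2r (ltW wp) q1)).
    by rewrite -mulrBl ltr_pM2r//; move: c4 mu0; clear; lra.
  have h := hess_perturb hG (y k) ys w.
  rewrite [X in _ <= X]bilinE wl dotZl -enorm_sqr enormB in h.
  have := arith _ _ ysd (hhe w) h.
  move: hl; case: (ger0P l) => // l0; clear; lra.
pose tau := enorm (y k - ys).
have tau0 : 0 <= tau by exact: enorm_ge0.
have taurho : tau <= rho.
  have h := le_trans (basin_dist hG ys0 ysmu (y k)) g3.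
  rewrite -/tau in h ysd.
  have h1 : (mud - 9 / 32 * mud) * tau <= 9 / 16 * (mud * rho).
    by apply: le_trans h; rewrite ler_wpM2r//; move: ysd; clear; lra.
  have : mud * tau <= mud * rho.
    have : 0 <= mud * rho by rewrite mulr_ge0 ?ltW.
    by move: h1; clear; lra.
  by rewrite ler_pM2l.
(* Since 3/2 L tau <= 27/32 mu, no later step increases the distance to ys. *)
have stay j : enorm (y (j + k)%N - ys) <= tau.
  elim: j => [|j ih]; first by rewrite add0n.
  have [_ /(_ (j + k)%N)[s [ysE smin]]] := newt.
  have h := ler_wpM2l (ltW L0) ih.
  rewrite addSn ysE; apply: le_trans ih; apply: (basin_step L0 hG ys0 ysmu smin).
  by move: h ysd mu0; rewrite -/tau; clear; lra.
have zin : enorm (z - ys) <= tau.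
  move: zacc; rewrite /accumulation_points clusterE.
  have cl : closed [set u : 'rV[R]_m | enorm (u - ys) <= tau].
    exact: closed_enorm_ball.
  move=> /(_ [set u | enorm (u - ys) <= tau]).
  rewrite closure_id in cl; rewrite -cl; apply.
  exists k => // j /= kj; rewrite -(subnK kj); exact: stay.
apply: le_trans (enorm_triangle _ ys _) _.
by rewrite (enormB ys) mulr_natl mulr2n lerD// (le_trans zin).
Qed.

End accuracy.

(** * Partial functions of a function of two variables *)
Section slices.
Context {R : realType} (n m : nat).

Lemma delta_rshift (i : 'I_m) :
  delta_mx 0 (rshift n i) = row_mx 0 (delta_mx 0 i) :> 'rV[R]_(n + m).
Proof.
apply/rowP => j; rewrite mxE eqxx /=; case: (fintype.splitP j) => k jk.
  have -> : j = lshift m k by exact/val_inj.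
  by rewrite row_mxEl mxE eq_lrshift.
have -> : j = rshift n k by exact/val_inj.
by rewrite row_mxEr mxE eqxx eq_rshift.
Qed.

Lemma slice_quotient (F : 'rV[R]_(n + m) -> R) x y (v : 'rV[R]_m) :
  (fun h : R => h^-1 *: ((F \o shift (row_mx x y)) (h *: row_mx 0 v) - F (row_mx x y))) =
  (fun h : R => h^-1 *: (((fun y => F (row_mx x y)) \o shift y) (h *: v) - F (row_mx x y))).
Proof.
apply/funext => h /=; congr (_ *: (F _ - _)).
by rewrite scale_row_mx scaler0 add_row_mx add0r.
Qed.

Lemma partial_slice (F : 'rV[R]_(n + m) -> R) x y (i : 'I_m) :
  partial i (fun y => F (row_mx x y)) y = partial (rshift n i) F (row_mx x y).
Proof. by rewrite /partial delta_rshift /derive slice_quotient. Qed.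

Lemma derivable_slice (F : 'rV[R]_(n + m) -> R) x y (i : 'I_m) :
  derivable F (row_mx x y) (delta_mx 0 (rshift n i)) ->
  derivable (fun y => F (row_mx x y)) y (delta_mx 0 i).
Proof. by rewrite /derivable delta_rshift slice_quotient. Qed.

Lemma jointE (g : 'rV[R]_n -> 'rV[R]_m -> R) x : g x = (fun y => joint g (row_mx x y)).
Proof. by apply/funext => y; rewrite /joint row_mxKl row_mxKr. Qed.

(** Freezing [x] turns the joint assumptions on [g] into the regularity that the
    lower-level analysis uses. *)
Lemma hess_lipschitz_slice (X : set 'rV[R]_n) (g : 'rV[R]_n -> 'rV[R]_m -> R) (Lg Lgg : R)
    (W : set 'rV[R]_(n + m)) :
  (forall x y, X x -> W (row_mx x y)) -> C2_on W (joint g) ->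
  (forall x x' y y', X x -> X x' ->
    enorm (grad (joint g) (row_mx x y) - grad (joint g) (row_mx x' y')) <=
    Lg * enorm (row_mx x y - row_mx x' y')) ->
  0 < Lgg ->
  (forall x x' y y', X x -> X x' ->
    opnorm (hess (g x) y - hess (g x') y') <=
    Lgg * enorm (row_mx x y - row_mx x' y')) ->
  forall x, X x -> hess_lipschitz (g x) Lgg.
Proof.
move=> WX [C1 C2] lipg L0 liph x Xx.
have rowB y y' : enorm (row_mx x y - row_mx x y') = enorm (y - y').
  by rewrite opp_row_mx add_row_mx subrr enorm_row0.
split.
- exact: ltW.
- move=> y i; rewrite jointE; apply: derivable_slice.
  by have [] := C1 _ (WX x y Xx) (rshift n i).
- move=> y i j; rewrite jointE.
  have -> : partial i (fun y => joint g (row_mx x y)) =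
    (fun y => partial (rshift n i) (joint g) (row_mx x y)).
    by apply/funext => z; rewrite partial_slice.
  apply: derivable_slice.
  by have [] := C2 (rshift n i) _ (WX x y Xx) (rshift n j).
- exists Lg => y y' i; rewrite jointE !partial_slice -rowB.
  apply: le_trans (lipg x x y y' Xx Xx); set D := _ - grad _ _.
  have := coord_le_enorm D (rshift n i).
  by rewrite /D !mxE.
- by move=> y y'; rewrite -rowB; exact: liph.
Qed.

End slices.

(** * Projection onto a compact convex set *)
Section projection.
Context {R : realType} (n : nat) (X : set 'rV[R]_n).
Hypothesis cvxX : convex_set X.
Hypothesis cptX : compact X.
Hypothesis X0 : X !=set0.

Lemma proj_spec v : X (Defs.proj X v) /\ forall z, X z -> enorm (v - Defs.proj X v) <= enorm (v - z).
Proof.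
suff ex : exists p, [set p | X p /\ forall z, X z -> enorm (v - p) <= enorm (v - z)] p.
  exact: (xgetPex 0 ex).
have [p /[!inE] Xp pmin] := @EVT_min_rV R n (fun u => enorm (u - v)) X X0 cptX
  (continuous_subspaceT (@continuous_enormB R n v)).
exists p; split => // z Xz; rewrite !(enormB v).
by apply: pmin; rewrite inE.
Qed.

Lemma proj_in v : X (Defs.proj X v). Proof. by have [] := proj_spec v. Qed.

Lemma segment_in x y (t : R) : X x -> X y -> 0 <= t <= 1 -> X (x + t *: (y - x)).
Proof.
move=> Xx Xy /andP[t0 t1].
have [t_0|tn0] := eqVneq t 0; first by rewrite t_0 scale0r addr0.
have [t_1|tn1] := eqVneq t 1; first by rewrite t_1 scale1r addrC subrK.
have tlt : 0 < t by rewrite lt_def tn0.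
have tlt1 : t < 1 by rewrite lt_neqAle tn1.
pose k : {i01 R} := Itv01 t0 t1.
have := cvxX k (mem_set Xy) (mem_set Xx); rewrite inE.
suff -> : conv k (y : convex_lmodType _) (x : convex_lmodType _) = x + t *: (y - x) by [].
by rewrite /conv /= /unstable.onem; apply/rowP => i; rewrite !mxE; ring.
Qed.

(** Moving from the projection towards a point of the convex set does not decrease
    the distance; the first-order term of its square gives the inequality. *)
Lemma proj_obtuse v z : X z -> dot (v - Defs.proj X v) (z - Defs.proj X v) <= 0.
Proof.
move=> Xz; set p := Defs.proj X v; have [Xp pmin] := proj_spec v; rewrite -/p in Xp pmin.
rewrite -oppr_ge0; apply: (@ge0_of_small _ _ (enorm (z - p) ^+ 2 / 2)).
move=> e /andP[e0 e1]; have := pmin _ (segment_in Xp Xz (introT andP (conj (ltW e0) e1))).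
have -> : v - (p + e *: (z - p)) = (v - p) + (- e) *: (z - p).
  by rewrite opprD addrA scaleNr.
rewrite -ler_sqr ?nnegrE ?enorm_ge0// (enormD_sqr (v - p)).
rewrite enormZ normrN (gtr0_norm e0) dotZr => h.
by rewrite -(pmulr_rge0 _ e0); move: h; clear; lra.
Qed.

Lemma proj_nonexpansive v w : enorm (Defs.proj X v - Defs.proj X w) <= enorm (v - w).
Proof.
have h1 := proj_obtuse v (proj_in w); have h2 := proj_obtuse w (proj_in v).
set p := Defs.proj X v in h1 h2 *; set q := Defs.proj X w in h1 h2 *.
have [->|pq] := eqVneq (enorm (p - q)) 0; first exact: enorm_ge0.
have pq0 : 0 < enorm (p - q) by rewrite lt_def pq enorm_ge0.
rewrite -(ler_pM2r pq0) -expr2; apply: le_trans (dot_le _ _).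
rewrite enorm_sqr !dotDl !dotDr !dotNl !dotNr.
by move: h1 h2; rewrite !dotDl !dotDr !dotNl !dotNr (dotC q p); lra.
Qed.

Lemma proj_id x : X x -> Defs.proj X x = x.
Proof.
move=> Xx; have [_ /(_ x Xx)] := proj_spec x; rewrite subrr enorm0 => h.
have := enorm_eq0 (le_anti (introT andP (conj h (enorm_ge0 _)))).
by move/eqP; rewrite subr_eq0 => /eqP.
Qed.

End projection.

(** * Borel sets and measurable maps on row vectors *)
Section measurable_rV_sets.
Context {R : realType}.

Definition rat_box n (p : 'rV[rat]_n * nat) : set 'rV[R]_n :=
  [set z | forall i, `|z 0 i - ratr (p.1 0 i)| < p.2.+1%:R^-1].

Lemma measurable_rat_box n (p : 'rV[rat]_n * nat) : measurable (rat_box p).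
Proof.
rewrite (_ : rat_box p = \bigcap_(i in [set: 'I_n])
    ((fun z : 'rV[R]_n => z 0 i) @^-1` [set t | `|t - ratr (p.1 0 i)| < p.2.+1%:R^-1])).
  apply: fin_bigcap_measurable => //.
  move=> i _; rewrite -[X in measurable X]setTI; apply: measurable_coord => //.
  have -> : [set t : R | `|t - ratr (p.1 0 i)| < p.2.+1%:R^-1] =
     `]ratr (p.1 0 i) - p.2.+1%:R^-1, ratr (p.1 0 i) + p.2.+1%:R^-1[%classic.
    by apply/seteqP; split => t; rewrite /= in_itv/= ltr_distl.
  exact: measurable_itv.
by apply/seteqP; split => z /= h i => [_|]; [exact: (h i)|exact: (h i I)].
Qed.

(** An open set is the union of the boxes with rational centre and radius that it
    contains, and there are countably many of them. *)
Lemma open_measurable_rV n (A : set 'rV[R]_n) : open A -> measurable A.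
Proof.
move=> oA.
rewrite (_ : A = \bigcup_(p : 'rV[rat]_n * nat)
    (if `[< rat_box p `<=` A >] then rat_box p else set0)).
  apply: countable_bigcupT_measurable; first exact: countableP.
  by move=> p; case: ifP => _; [exact: measurable_rat_box|exact: measurable0].
apply/seteqP; split => [z Az|z [p _]]; last by case: asboolP => // h /h.
have /nbhs_ballP[r /= r0 rA] : nbhs z A by exact: open_nbhs_nbhs.
have [k kr] : exists k, k.+1%:R^-1 < r / 2.
  by have [k] := ltr_add_invr (divr_gt0 r0 (ltr0n R 2)); rewrite add0r; exists k.
have [q hq] : exists q : 'rV[rat]_n, forall i, `|z 0 i - ratr (q 0 i)| < k.+1%:R^-1.
  have h i : exists c : rat, `|z 0 i - ratr c| < k.+1%:R^-1.
    have [|c /=] := @rat_in_itvoo R (z 0 i - k.+1%:R^-1) (z 0 i + k.+1%:R^-1).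
      by rewrite ltrBlDr -addrA ltrDl addr_gt0.
    rewrite in_itv/= => /andP[c1 c2]; exists c.
    by rewrite distrC ltr_norml ltrBrDl c1 ltrBlDl.
  exists (\row_i projT1 (cid (h i))) => i; rewrite mxE; by case: cid.
exists (q, k) => //; case: asboolP => //= nsub; exfalso; apply: nsub => w hw; apply: rA.
rewrite mx_norm_ball /ball_ /=.
have e0 : 0 <= k.+1%:R^-1 :> R by rewrite invr_ge0.
rewrite /rat_box /= in hw; move: (k.+1%:R^-1) e0 kr hq hw => e e0 er hq hw.
have r2 : `|z - w| <= e + e.
  rewrite [leLHS]mx_normrE; apply: bigmax_le => [|[a i] _ /=]; first exact: addr_ge0.
  rewrite (ord1 a) !mxE; apply: le_trans (ler_distD (ratr (q 0 i)) _ _) _.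
  by apply: lerD; apply/ltW; [exact: hq|rewrite distrC; exact: hw].
by apply: (le_lt_trans r2); move: er; clear; lra.
Qed.

Lemma continuous_measurable_rV n (F : 'rV[R]_n -> R) : continuous F -> measurable_fun setT F.
Proof.
move=> cF; apply: (measurability _ (measurable_realfun.RGenOpens.measurableE R)).
by move=> _ [_ [a [b ->] <-]]; rewrite setTI; apply: open_measurable_rV; apply: open_comp => // x _; exact: cF.
Qed.

Lemma continuous_measurable_rVrV n m (F : 'rV[R]_n -> 'rV[R]_m) : continuous F -> measurable_fun setT F.
Proof.
move=> cF; apply: measurable_fun_rVP => i; apply: continuous_measurable_rV.
move=> x; exact: (continuous_comp (cF x) (@coord_continuous R 1 m 0 i (F x))).
Qed.

Section fun_rV.
Context d (T : measurableType d) (n : nat).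
Implicit Types f g : T -> 'rV[R]_n.

Lemma measurable_rV_coord f i : measurable_fun setT f ->
  measurable_fun setT (fun t => f t 0 i : R).
Proof. by move=> mf; apply: (measurableT_comp (measurable_coord i) mf). Qed.

Lemma measurable_rVD f g : measurable_fun setT f -> measurable_fun setT g ->
  measurable_fun setT (fun t => f t + g t).
Proof.
move=> mf mg; apply: measurable_fun_rVP => i; under eq_fun do rewrite mxE.
by apply: measurable_funD; exact: measurable_rV_coord.
Qed.

Lemma measurable_rVZ (k : T -> R) f : measurable_fun setT k -> measurable_fun setT f ->
  measurable_fun setT (fun t => k t *: f t).
Proof.
move=> mk mf; apply: measurable_fun_rVP => i; under eq_fun do rewrite mxE.
by apply: measurable_funM => //; exact: measurable_rV_coord.
Qed.

Lemma measurable_rVN f : measurable_fun setT f -> measurable_fun setT (fun t => - f t).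
Proof.
move=> mf; apply: measurable_fun_rVP => i; under eq_fun do rewrite mxE.
by apply: measurable_funN => //; exact: measurable_rV_coord.
Qed.

Lemma measurable_dot f g : measurable_fun setT f -> measurable_fun setT g ->
  measurable_fun setT (fun t => dot (f t) (g t)).
Proof.
move=> mf mg; under eq_fun do rewrite dot_sum.
by apply: measurable_sum => i; apply: measurable_funM; exact: measurable_rV_coord.
Qed.

Lemma measurable_enorm f : measurable_fun setT f -> measurable_fun setT (fun t => enorm (f t)).
Proof.
move=> mf; exact: (measurableT_comp (continuous_measurable_rV (@continuous_enorm R n)) mf).
Qed.

End fun_rV.
End measurable_rV_sets.

(** * Lebesgue measure and affine maps *)
Section affine_change.
Context {R : realType}.
Local Notation leb := (@lebesgue_measure R).

Lemma measurable_affine1 (a xi : R) :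
  measurable_fun setT ((fun t => a + xi * t) : measurableTypeR R -> measurableTypeR R).
Proof. by apply: measurable_funD => //; apply: measurable_funM. Qed.

(** Uniqueness of the Lebesgue measure: both sides agree on intervals. *)
Lemma lebesgue_affine1 (a xi : R) (A : set (measurableTypeR R)) : 0 < xi -> measurable A ->
  leb A = (xi%:E * leb ((fun t : measurableTypeR R => a + xi * t)%R @^-1` A))%E.
Proof.
move=> xi0 mA.
pose k : {nonneg R} := NngNum (ltW xi0).
pose T : measurableTypeR R -> measurableTypeR R := fun t => a + xi * t.
pose nu : {measure set (measurableTypeR R) -> \bar R} :=
  measure_function_pushforward__canonical__measure_function_Measure leb (measurable_affine1 a xi).
have h : forall X, ocitv X -> leb X = mscale k nu X.
  move=> _ [[p q] _ <-]; rewrite /mscale /nu /= /pushforward.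
  rewrite (_ : T @^-1` _ = `](p - a) / xi, (q - a) / xi]%classic); last first.
    apply/seteqP; split => t; rewrite /T /= !in_itv/= ltr_pdivrMr// ler_pdivlMr//.
      by rewrite ltrBlDl lerBrDl mulrC.
    by rewrite ltrBlDl lerBrDl mulrC.
  rewrite !lebesgue_measure_itv /= !lte_fin ltr_pM2r ?invr_gt0// ltrD2r.
  case: ifP => _; last by rewrite mule0.
  by rewrite -!EFinB -EFinM; congr EFin; field; rewrite gt_eqF.
exact: (@lebesgue_measure_unique R (mscale k nu) h A mA).
Qed.

Lemma ge0_integral_affine1 (a xi : R) (G : measurableTypeR R -> \bar R) : 0 < xi ->
  measurable_fun setT G -> (forall t, 0 <= G t)%E ->
  (\int[leb]_t G t = xi%:E * \int[leb]_t G (a + xi * t)%R)%E.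
Proof.
move=> xi0 mG G0.
pose k : {nonneg R} := NngNum (ltW xi0).
pose T : measurableTypeR R -> measurableTypeR R := fun t => a + xi * t.
pose nu : {measure set (measurableTypeR R) -> \bar R} :=
  measure_function_pushforward__canonical__measure_function_Measure leb (measurable_affine1 a xi).
rewrite (@eq_measure_integral _ _ _ setT (mscale k nu)); last first.
  by move=> A mA _; exact: lebesgue_affine1.
rewrite ge0_integral_mscale//; congr (_ * _)%E.
by rewrite ge0_integral_pushforward//; exact: measurable_affine1.
Qed.

Lemma ge0_integral_cons n (G : 'rV[R]_n.+1 -> \bar R) :
  measurable_fun setT G -> (forall z, 0 <= G z)%E ->
  (\int[lebesgue_rV n.+1]_z G z =
   \int[leb]_t \int[lebesgue_rV n]_z G (cons_rV (t, z)))%E.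
Proof.
move=> mG G0.
transitivity (\int[pushforward (leb \x lebesgue_rV n)%E (@cons_rV R n)]_z G z)%E => //.
rewrite ge0_integral_pushforward//; last exact: measurable_cons_rV.
rewrite preimage_setT fubini_tonelli1//.
  exact: measurableT_comp mG (@measurable_cons_rV R n).
by move=> p; exact: G0.
Qed.

Lemma measurable_consr n (G : 'rV[R]_n.+1 -> \bar R) t : measurable_fun setT G ->
  measurable_fun setT (fun z => G (cons_rV (t, z))).
Proof.
move=> mG; apply: (measurableT_comp mG).
by apply: (measurableT_comp (@measurable_cons_rV R n)); exact: measurable_fun_pair.
Qed.

Lemma measurable_fubini_cons n (G : 'rV[R]_n.+1 -> \bar R) : measurable_fun setT G ->
  (forall z, 0 <= G z)%E ->
  measurable_fun setT (fun t => \int[lebesgue_rV n]_z G (cons_rV (t, z)))%E.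
Proof.
move=> mG G0.
apply: (@measurable_fun_fubini_tonelli_F _ _ _ _ _ (lebesgue_rV n) (G \o @cons_rV R n)).
  exact: measurableT_comp mG (@measurable_cons_rV R n).
by move=> p; exact: G0.
Qed.

Lemma cons_affine n (x : 'rV[R]_n.+1) (xi t : R) (z : 'rV[R]_n) :
  x + xi *: cons_rV (t, z) =
  cons_rV (x 0 ord0 + xi * t, rsubmx (x : 'rV[R]_(1 + n)) + xi *: z).
Proof.
apply/rowP => i; rewrite /cons_rV /= [LHS]mxE [X in _ + X]mxE.
rewrite -[i](@splitK 1 n); case: (fintype.split (i : 'I_(1 + n))) => j /=.
  rewrite !(@row_mxEl _ 1 1 n) !mxE (ord1 j) eqxx !mulr1n.
  by congr (x 0 _ + _); exact/val_inj.
by rewrite !(@row_mxEr _ 1 1 n) !mxE.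
Qed.

Lemma measurable_affine n (x : 'rV[R]_n) (xi : R) :
  measurable_fun setT (fun z : 'rV[R]_n => x + xi *: z).
Proof.
by apply: measurable_rVD => //; apply: measurable_rVZ.
Qed.

(** One coordinate at a time, by Tonelli's theorem. *)
Lemma ge0_integral_affine n (x : 'rV[R]_n) (xi : R) (G : 'rV[R]_n -> \bar R) : 0 < xi ->
  measurable_fun setT G -> (forall z, 0 <= G z)%E ->
  (\int[lebesgue_rV n]_z G z = (xi ^+ n)%:E * \int[lebesgue_rV n]_z G (x + xi *: z)%R)%E.
Proof.
move=> xi0; elim: n x G => [|n ih] x G mG G0.
  rewrite expr0 mul1e; apply: eq_integral => z _; congr G.
  by rewrite [LHS]thinmx0 [RHS]thinmx0.
have mGa : measurable_fun setT (fun z : 'rV[R]_n.+1 => G (x + xi *: z)).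
  exact: measurableT_comp mG (@measurable_affine _ x xi).
rewrite ge0_integral_cons// [in RHS]ge0_integral_cons//.
rewrite [LHS](@ge0_integral_affine1 (x 0 ord0) xi)//; last 2 first.
- exact: measurable_fubini_cons.
- by move=> t; apply: integral_ge0.
rewrite exprS EFinM -muleA; congr (_ * _)%E.
rewrite -ge0_integralZl//; last 3 first.
- exact: (measurable_fubini_cons mGa (fun z => G0 _)).
- by move=> t _; apply: integral_ge0.
- by rewrite lee_fin exprn_ge0// ltW.
apply: eq_integral => t _.
rewrite (ih (rsubmx (x : 'rV[R]_(1 + n)))); last 2 first.
- exact: measurable_consr.
- by move=> z; exact: G0.
by congr (_ * _)%E; apply: eq_integral => z _; rewrite cons_affine.
Qed.

End affine_change.

(** * The Gaussian density and measure *)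
Section gauss_density.
Context {R : realType}.
Implicit Types xi : R.

Lemma gauss_ge0 n xi (z : 'rV[R]_n) : 0 <= gauss xi z.
Proof. by rewrite mulr_ge0 ?powR_ge0 ?expR_ge0. Qed.

Lemma measurable_gauss n xi : measurable_fun setT (@gauss R n xi).
Proof.
apply: measurable_funM => //; apply: measurableT_comp => //; apply: measurable_funN.
apply: measurable_funM => //; apply: measurable_funX; exact: measurable_enorm.
Qed.

Lemma gauss_scale n xi (u : 'rV[R]_n) : 0 < xi ->
  gauss xi (xi *: u) * xi ^+ n = gauss 1 u.
Proof.
move=> xi0; rewrite /gauss enormZ gtr0_norm// exprMn expr1n !mulr1.
have p0 : 0 <= 2 * pi :> R by rewrite mulr_ge0 ?pi_ge0.
have -> : (2 * pi * xi ^+ 2) `^ (- (n%:R / 2)) = (2 * pi) `^ (- (n%:R / 2)) * (xi ^+ n)^-1.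
  rewrite powRM ?sqr_ge0//; congr (_ * _).
  rewrite -[xi ^+ 2]powR_mulrn ?ltW// -powRrM.
  have -> : 2%:R * - (n%:R / 2) = - n%:R :> R by field.
  by rewrite powRN powR_mulrn// ltW.
rewrite mulrAC -(mulrA _ _ (xi ^+ n)) mulVf ?mulr1; last by rewrite expf_neq0// gt_eqF.
by congr (_ * expR _); field; rewrite gt_eqF.
Qed.

Lemma gauss_shift n (u q : 'rV[R]_n) :
  gauss 1 (u - q) = gauss 1 u * expR (dot u q - enorm q ^+ 2 / 2).
Proof.
rewrite /gauss -[RHS]mulrA -expRD; congr (_ * expR _).
by rewrite enormD_sqr enormN dotNr expr1n; field.
Qed.

Lemma gauss_sym n xi (u : 'rV[R]_n) : gauss xi (- u) = gauss xi u.
Proof. by rewrite /gauss enormN. Qed.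

Lemma enorm_cons n t (z : 'rV[R]_n) : enorm (cons_rV (t, z)) ^+ 2 = t ^+ 2 + enorm z ^+ 2.
Proof.
rewrite !enorm_sqr !dot_sum big_ord_recl; congr (_ + _).
  have -> : (ord0 : 'I_n.+1) = lshift n (ord0 : 'I_1) by exact/val_inj.
  by rewrite /cons_rV (@row_mxEl _ 1 1 n) mxE eqxx mulr1n expr2.
apply: eq_bigr => i _; rewrite /cons_rV /=.
have -> : lift ord0 i = rshift 1 i by exact/val_inj.
by rewrite (@row_mxEr _ 1 1 n).
Qed.

(** Reduces the Gaussian density to one-dimensional normal densities, whose total
    mass is known. *)
Lemma gauss_cons n t (z : 'rV[R]_n) :
  gauss 1 (cons_rV (t, z)) = normal_pdf 0 1 t * gauss 1 z.
Proof.
rewrite normal_pdfE ?oner_neq0// /normal_fun /normal_peak /gauss enorm_cons.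
rewrite !expr1n !mulr1 mul1r subr0 mulrACA -expRD; congr (_ * expR _); last by field.
have -> : - (n.+1%:R / 2) = - 2^-1 + - (n%:R / 2) :> R by rewrite -natr1; field.
have p0 : 0 < 2 * pi :> R by rewrite mulr_gt0 ?pi_gt0.
have -> : (2 * pi) `^ (- 2^-1 - n%:R / 2) = (2 * pi) `^ (- 2^-1) * (2 * pi) `^ (- (n%:R / 2)) :> R.
  by rewrite powRD ?(gt_eqF p0) ?implybT.
by congr (_ * _); rewrite powRN powR12_sqrt ?(ltW p0)// mulr_natl.
Qed.

Lemma integral_gauss n : (\int[lebesgue_rV n]_(z in [set: 'rV[R]_n]) (gauss 1 z)%:E = 1)%E.
Proof.
elim: n => [|n ih].
  rewrite integral_dirac//=; last first.
    by apply/measurable_EFinP; exact: (@measurable_gauss 0 1).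
  rewrite /gauss mul0r oppr0 powRr0 mul1r /enorm big_ord0 sqrtr0 expr0n mul0r oppr0 expR0.
  by rewrite diracT mul1e.
rewrite ge0_integral_cons//; last 2 first.
- by apply/measurable_EFinP; exact: measurable_gauss.
- by move=> z; rewrite lee_fin gauss_ge0.
under eq_integral => t _.
  under eq_integral do rewrite gauss_cons EFinM.
  rewrite ge0_integralZl//; last 3 first.
  - by apply/measurable_EFinP; exact: measurable_gauss.
  - by move=> z _; rewrite lee_fin gauss_ge0.
  - by rewrite lee_fin normal_pdf_ge0.
  rewrite ih mule1; over.
exact: integral_normal_pdf.
Qed.

End gauss_density.

Section gauss_measure.
Context {R : realType} (n : nat).
Local Notation lam := (lebesgue_rV n : {sigma_finite_measure set 'rV[R]_n -> \bar R}).

Definition gaussian (A : set 'rV[R]_n) : \bar R := (\int[lam]_(z in A) (gauss 1 z)%:E)%E.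

Let mg : measurable_fun setT (fun z : 'rV[R]_n => (gauss 1 z)%:E).
Proof. by apply/measurable_EFinP; exact: measurable_gauss. Qed.

Let g0 (z : 'rV[R]_n) : (0 <= (gauss 1 z)%:E)%E.
Proof. by rewrite lee_fin gauss_ge0. Qed.

Let gaussian0 : gaussian set0 = 0%E.
Proof. by rewrite /gaussian integral_set0. Qed.

Let gaussian_ge0 A : (0 <= gaussian A)%E.
Proof. by apply: integral_ge0 => z _; exact: g0. Qed.

Let gaussian_sigma_additive : semi_sigma_additive gaussian.
Proof.
move=> F mF tF mUF; rewrite /gaussian ge0_integral_bigcup//; last first.
  by apply: measurable_funTS.
apply: is_cvg_ereal_nneg_natsum_cond => k _ _; exact: gaussian_ge0.
Qed.

HB.instance Definition _ := isMeasure.Build _ _ _ gaussian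
  gaussian0 gaussian_ge0 gaussian_sigma_additive.

Let gaussian_setT : gaussian setT = 1%E.
Proof. exact: integral_gauss. Qed.

HB.instance Definition _ := Measure_isProbability.Build _ _ _ gaussian gaussian_setT.

Import HBNNSimple.

Let integral_gaussian_indic E : measurable E ->
  (\int[gaussian]_x (\1_E x)%:E = \int[lam]_x ((gauss 1 x)%:E * (\1_E x)%:E))%E.
Proof.
move=> mE; rewrite integral_indic//= setIT /gaussian [LHS]integral_mkcond.
apply: eq_integral => x _; rewrite patchE indicE.
by case: ifP => _; rewrite ?mule1 ?mule0.
Qed.

Let integral_gaussian_nnsfun (f : {nnsfun 'rV[R]_n >-> R}) :
  (\int[gaussian]_x (f x)%:E = \int[lam]_x ((gauss 1 x)%:E * (f x)%:E))%E.
Proof.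
under [LHS]eq_integral do rewrite fimfunE -fsumEFin//.
rewrite [LHS]ge0_integral_fsum//; last 2 first.
  - by move=> r; exact/measurable_EFinP/measurableT_comp.
  - by move=> k x _; rewrite EFinM nnfun_muleindic_ge0.
under [RHS]eq_integral.
  move=> x xD; rewrite fimfunE -fsumEFin// ge0_mule_fsumr; last first.
    by move=> r; rewrite EFinM nnfun_muleindic_ge0.
  over.
rewrite [RHS]ge0_integral_fsum//; last 2 first.
  - move=> r; apply: emeasurable_funM => //.
    by apply/measurable_EFinP; do 2 apply/measurableT_comp => //.
  - by move=> k x _; rewrite mule_ge0 ?g0// EFinM nnfun_muleindic_ge0.
apply: eq_fsbigr => r; rewrite inE => -[x _ fxr].
have r0 : 0 <= r by rewrite -fxr.
under [LHS]eq_integral do rewrite EFinM.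
rewrite ge0_integralZl//; last exact/measurable_EFinP/measurable_indic.
rewrite integral_gaussian_indic// -ge0_integralZl//; last 2 first.
- by apply: emeasurable_funM => //; exact/measurable_EFinP/measurable_indic.
- by move=> z _; rewrite mule_ge0 ?g0// lee_fin.
by apply: eq_integral => z _; rewrite EFinM muleCA.
Qed.

Lemma ge0_integral_gaussian (f : 'rV[R]_n -> \bar R) :
  measurable_fun setT f -> (forall x, 0 <= f x)%E ->
  (\int[gaussian]_x f x = \int[lam]_x ((gauss 1 x)%:E * f x))%E.
Proof.
move=> mf f0.
pose f_ := nnsfun_approx measurableT mf.
transitivity (lim (\int[gaussian]_x (f_ n x)%:E @[n --> \oo])%E).
  rewrite -monotone_convergence//=.
  - apply: eq_integral => ? /[!inE] xD; apply/esym/cvg_lim => //=.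
    exact: cvg_nnsfun_approx.
  - by move=> k; exact/measurable_EFinP/measurable_funTS.
  - by move=> k ? _; rewrite lee_fin.
  - by move=> ? _ ? ? mn; rewrite lee_fin; exact/lefP/nd_nnsfun_approx.
rewrite [RHS](_ : _ = lim (\int[lam]_x ((gauss 1 x)%:E * (f_ n x)%:E) @[n --> \oo])%E).
  by apply: congr_lim; apply/funext => k /=; exact: integral_gaussian_nnsfun.
rewrite -monotone_convergence//=.
- apply: eq_integral => x _; apply/esym/cvg_lim => //.
  by apply: cvgeZl => //; exact: cvg_nnsfun_approx.
- by move=> k; apply: emeasurable_funM => //; exact/measurable_EFinP/measurable_funTS.
- by move=> k x _; rewrite mule_ge0// lee_fin.
- by move=> x _ ? ? ?; apply: lee_wpmul2l => //; rewrite lee_fin; exact/lefP/nd_nnsfun_approx.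
Qed.

End gauss_measure.

(** * Integrals up to null sets *)
Section ae_integral.
Context d (T : measurableType d) (R : realType) (mu : {measure set T -> \bar R}).

Import HBNNSimple.

(** The integral is a supremum over simple functions, and a simple function below
    [f], multiplied by the indicator of the complement of [N], keeps its integral
    and lies below [g]. *)
Lemma ge0_integral_ae_le (f g : T -> \bar R) (N : set T) :
  measurable N -> mu N = 0%E ->
  (forall x, 0 <= f x)%E -> (forall x, 0 <= g x)%E -> (forall x, ~ N x -> f x <= g x)%E ->
  (\int[mu]_x f x <= \int[mu]_x g x)%E.
Proof.
move=> mN N0 f0 g0 fg; rewrite !ge0_integralE// !patch_setT.
apply: ge_ereal_sup => _ [h /= hf <-].
pose h' : {nnsfun T >-> R} := mul_nnsfun h (indic_nnsfun R (measurableC mN)).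
have -> : sintegral mu h = sintegral mu h'.
  rewrite -!integralT_nnsfun; apply: ge0_ae_eq_integral => //.
  - exact/measurable_EFinP.
  - exact/measurable_EFinP.
  - by move=> x _; rewrite lee_fin.
  - by move=> x _; rewrite lee_fin.
  exists N; split => // x /= nx; apply: contrapT => Nx; apply: nx => _.
  by rewrite /h' /= mindicE mem_set ?mulr1.
apply: ereal_sup_ubound; exists h' => // x /=; rewrite mindicE.
have [xN|xN] := pselect (N x).
  by rewrite memNset ?mulr0 ?g0//=; exact.
by rewrite mem_set// mulr1 (le_trans (hf x))// fg.
Qed.

Lemma integral_ae_eq (f g : T -> \bar R) (N : set T) :
  measurable N -> mu N = 0%E -> (forall x, ~ N x -> f x = g x)%E ->
  (\int[mu]_x f x = \int[mu]_x g x)%E.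
Proof.
move=> mN N0 fg; rewrite integralE [RHS]integralE.
by congr (_ - _)%E; apply/eqP; rewrite eq_le; apply/andP; split;
  apply: (ge0_integral_ae_le mN N0) => // x /fg e; rewrite ?funeposE ?funenegE e.
Qed.

Lemma Rintegral_ae_eq (f g : T -> R) (N : set T) :
  measurable N -> mu N = 0%E -> (forall x, ~ N x -> f x = g x) ->
  \int[mu]_x f x = \int[mu]_x g x.
Proof.
by move=> mN N0 fg; congr fine; apply: (integral_ae_eq mN N0) => x /fg ->.
Qed.

Lemma integrable_le (f g : T -> R) : measurable_fun setT f -> (forall x, `|f x| <= g x) ->
  mu.-integrable setT (EFin \o g) -> mu.-integrable setT (EFin \o f).
Proof.
move=> mf fg; apply: le_integrable => //; first exact/measurable_EFinP.
by move=> x _; rewrite !abse_EFin lee_fin (le_trans (fg x))// ler_norm.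
Qed.

Lemma ge0_integrable (f : T -> R) (c : \bar R) : measurable_fun setT f -> (forall x, 0 <= f x) ->
  (\int[mu]_x (f x)%:E <= c)%E -> (c < +oo)%E -> mu.-integrable setT (EFin \o f).
Proof.
move=> mf f0 fc coo; apply/integrableP; split; first exact/measurable_EFinP.
apply: le_lt_trans coo; apply: le_trans fc; rewrite le_eqVlt; apply/orP; left; apply/eqP.
by apply: eq_integral => x _ /=; rewrite ger0_norm.
Qed.

Lemma integrable_addr (f g : T -> R) : mu.-integrable setT (EFin \o f) ->
  mu.-integrable setT (EFin \o g) -> mu.-integrable setT (EFin \o (fun x => f x + g x)).
Proof. by move=> hf hg; exact: (integrableD measurableT hf hg). Qed.

Lemma integrable_subr (f g : T -> R) : mu.-integrable setT (EFin \o f) ->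
  mu.-integrable setT (EFin \o g) -> mu.-integrable setT (EFin \o (fun x => f x - g x)).
Proof. by move=> hf hg; exact: (integrableB measurableT hf hg). Qed.

Lemma integrable_scaler (k : R) (f : T -> R) : mu.-integrable setT (EFin \o f) ->
  mu.-integrable setT (EFin \o (fun x => k * f x)).
Proof. by move=> hf; exact: (integrableZl measurableT k hf). Qed.

Lemma integrable_measurable (f : T -> R) : mu.-integrable setT (EFin \o f) ->
  measurable_fun setT f.
Proof. by move=> hf; exact/measurable_EFinP/(measurable_int mu). Qed.

Lemma integrable_normr (f : T -> R) : mu.-integrable setT (EFin \o f) ->
  mu.-integrable setT (EFin \o (fun x => `|f x|)).
Proof.
move=> hf; have mf := integrable_measurable hf.
apply/integrableP; split; first exact/measurable_EFinP/measurableT_comp.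
have /integrableP[_] := hf; apply: le_lt_trans; rewrite le_eqVlt; apply/orP; left; apply/eqP.
by apply: eq_integral => x _ /=; rewrite normr_id.
Qed.

Lemma Rintegral_EFin (f : T -> R) : mu.-integrable setT (EFin \o f) ->
  (\int[mu]_x (f x)%:E)%E = (\int[mu]_x f x)%:E.
Proof. by move=> h; rewrite fineK//; exact: integrable_fin_num. Qed.

End ae_integral.

Section probability_integral.
Context d (T : measurableType d) (R : realType) (P : probability T R).

Lemma integrable_bounded (f : T -> R) (c : R) : measurable_fun setT f ->
  (forall x, `|f x| <= c) -> P.-integrable setT (EFin \o f).
Proof.
move=> mf fc; apply: (@integrable_le _ _ _ _ f (cst c)) => //.
exact: finite_measure_integrable_cst.
Qed.

Lemma integrable_cst1 (c : R) : P.-integrable setT (EFin \o (fun _ => c)).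
Proof. exact: finite_measure_integrable_cst. Qed.

Lemma Rintegral_cst1 (c : R) : \int[P]_x c = c.
Proof. by rewrite /Rintegral integral_cst// -[RHS]/(fine c%:E) -[in RHS](mule1 c%:E) -(probability_setT P). Qed.

End probability_integral.

(** * Translating and rescaling the Gaussian measure *)
Section gaussian_calculus.
Context {R : realType} (n : nat).
Local Notation lam := (lebesgue_rV n : {sigma_finite_measure set 'rV[R]_n -> \bar R}).
Local Notation Gam := (@gaussian R n).

Lemma ge0_gaussian_kernel (x : 'rV[R]_n) (xi : R) (f : 'rV[R]_n -> \bar R) : 0 < xi ->
  measurable_fun setT f -> (forall z, 0 <= f z)%E ->
  (\int[lam]_z ((gauss xi (x - z))%:E * f z) = \int[Gam]_u f (x + xi *: u)%R)%E.
Proof.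
move=> xi0 mf f0.
have mfa : measurable_fun setT (fun u : 'rV[R]_n => f (x + xi *: u)).
  exact: measurableT_comp mf (measurable_affine x xi).
have mgx : measurable_fun setT (fun z : 'rV[R]_n => (gauss xi (x - z))%:E).
  apply/measurable_EFinP; apply: (measurableT_comp (@measurable_gauss R n xi)).
  by apply: measurable_rVD => //; exact: measurable_rVN.
rewrite (ge0_integral_affine x xi0); last 2 first.
- exact: emeasurable_funM.
- by move=> z; rewrite mule_ge0// lee_fin gauss_ge0.
rewrite ge0_integral_gaussian// -ge0_integralZl//; last 3 first.
- exact: (emeasurable_funM (measurableT_comp mgx (measurable_affine x xi)) mfa).
- by move=> z _; rewrite mule_ge0// lee_fin gauss_ge0.
- by rewrite lee_fin exprn_ge0// ltW.
apply: eq_integral => u _; rewrite muleA -EFinM; congr (_%:E * _)%E.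
by rewrite opprD addrA subrr sub0r gauss_sym mulrC gauss_scale.
Qed.

(** The image of the Gaussian measure under [u |-> x + xi u] has a density. *)
Lemma gaussian_null (x : 'rV[R]_n) (xi : R) (N : set 'rV[R]_n) : 0 < xi ->
  measurable N -> lam N = 0%E -> Gam ((fun u => x + xi *: u) @^-1` N) = 0%E.
Proof.
move=> xi0 mN N0.
have mA : measurable ((fun u => x + xi *: u) @^-1` N).
  by rewrite -[X in measurable X]setTI; exact: measurable_affine.
have m1 : measurable_fun setT (fun z => (\1_N z : R)%:E).
  exact/measurable_EFinP/measurable_indic.
have h : (\int[lam]_z ((gauss xi (x - z))%:E * (\1_N z)%:E) = 0)%E.
  rewrite -[RHS](integral0 lam setT).
  apply: (integral_ae_eq mN N0) => z Nz.
  by rewrite indicE memNset// mule0.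
rewrite -h (ge0_gaussian_kernel x xi0 m1); last by move=> z; rewrite lee_fin.
by rewrite -[X in Gam X]setIT -integral_indic.
Qed.

(** The translated density is the density times an exponential. *)
Lemma ge0_gaussian_shift (q : 'rV[R]_n) (f : 'rV[R]_n -> \bar R) :
  measurable_fun setT f -> (forall z, 0 <= f z)%E ->
  (\int[Gam]_u f (u + q)%R = \int[Gam]_u ((expR (dot u q - enorm q ^+ 2 / 2))%:E * f u))%E.
Proof.
move=> mf f0.
have me : measurable_fun setT (fun u : 'rV[R]_n => (expR (dot u q - enorm q ^+ 2 / 2))%:E).
  apply/measurable_EFinP; apply: measurableT_comp => //; apply: measurable_funB => //.
  exact: measurable_dot.
have mfa : measurable_fun setT (fun u : 'rV[R]_n => f (u + q)).
  by apply: measurableT_comp mf _; exact: measurable_rVD.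
rewrite ge0_integral_gaussian// ge0_integral_gaussian//; last 2 first.
- exact: emeasurable_funM.
- by move=> z; rewrite mule_ge0// lee_fin expR_ge0.
under [RHS]eq_integral do rewrite muleA -EFinM -gauss_shift.
rewrite [RHS](ge0_integral_affine q ltr01); last 2 first.
- apply: emeasurable_funM => //; apply/measurable_EFinP.
  apply: (measurableT_comp (@measurable_gauss R n 1)).
  exact: measurable_rVD.
- by move=> z; rewrite mule_ge0// lee_fin gauss_ge0.
rewrite expr1n mul1e; apply: eq_integral => u _.
by rewrite scale1r [q + u]addrC addrK.
Qed.

Lemma gaussian_mgf (q : 'rV[R]_n) :
  (\int[Gam]_u (expR (dot u q))%:E = (expR (enorm q ^+ 2 / 2))%:E)%E.
Proof.
have h := @ge0_gaussian_shift q (cst 1%E) (measurable_cst _) (fun _ => lee01).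
have h1 : (\int[Gam]_u cst 1%E (u + q)%R = 1)%E.
  by rewrite integral_cst// mul1e; exact: integral_gauss.
rewrite h1 in h.
have {}h : (1 = \int[Gam]_u (expR (dot u q - enorm q ^+ 2 / 2))%:E)%E.
  by rewrite h; apply: eq_integral => u _; rewrite mule1.
have me : measurable_fun setT (fun u : 'rV[R]_n => (expR (dot u q - enorm q ^+ 2 / 2))%:E).
  apply/measurable_EFinP; apply: measurableT_comp => //.
  by apply: measurable_funB => //; exact: measurable_dot.
rewrite -[RHS]mule1 [in RHS]h -ge0_integralZl//.
apply: eq_integral => u _; rewrite -EFinM -expRD.
by congr (expR _)%:E; rewrite addrC subrK.
Qed.

End gaussian_calculus.

(** * Gaussian moments *)
(** Applies the hypothesis to the positive and the negative part; when both
    integrals are infinite the two sides take the same conventional value. *)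
Lemma signed_integral_eq (R : realType) d1 d2 (T1 : measurableType d1) (T2 : measurableType d2)
    (m1 : {measure set T1 -> \bar R}) (m2 : {measure set T2 -> \bar R})
    (w : T1 -> R) (w' : T2 -> R) (phi : T2 -> T1) :
  (forall x, 0 <= w x) -> (forall y, 0 <= w' y) ->
  (forall f : T1 -> \bar R, measurable_fun setT f -> (forall x, 0 <= f x)%E ->
    \int[m1]_x ((w x)%:E * f x) = \int[m2]_y ((w' y)%:E * f (phi y)))%E ->
  forall H : T1 -> R, measurable_fun setT H ->
    (\int[m1]_x (w x * H x)%:E = \int[m2]_y (w' y * H (phi y))%:E)%E.
Proof.
move=> w0 w'0 h H mH; rewrite integralE [RHS]integralE.
have mH' : measurable_fun setT (fun x => (H x)%:E) by exact/measurable_EFinP.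
have posE (a b : R) : 0 <= a -> (maxe (a * b)%:E 0 = a%:E * maxe b%:E 0)%E.
  by move=> a0; rewrite -!EFin_max -EFinM maxr_pMr// mulr0.
have negE (a b : R) : 0 <= a -> (maxe (- (a * b)%:E) 0 = a%:E * maxe (- b%:E) 0)%E.
  by move=> a0; rewrite -!EFinN -!EFin_max -EFinM maxr_pMr// mulr0 mulrN.
have h1 := h _ (measurable_funepos mH') (funepos_ge0 _).
have h2 := h _ (measurable_funeneg mH') (funeneg_ge0 _).
congr (_ - _)%E.
  transitivity (\int[m1]_x ((w x)%:E * (fun x => (H x)%:E)^\+ x))%E.
    by apply: eq_integral => x _; rewrite !funeposE posE.
  by rewrite h1; apply: eq_integral => y _; rewrite !funeposE posE.
transitivity (\int[m1]_x ((w x)%:E * (fun x => (H x)%:E)^\- x))%E.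
  by apply: eq_integral => x _; rewrite !funenegE negE.
by rewrite h2; apply: eq_integral => y _; rewrite !funenegE negE.
Qed.

Section exp_bounds.
Context {R : realType}.

Lemma expR_sinh_ge (y : R) : 0 <= y -> 2 * y <= expR y - expR (- y).
Proof.
move=> y0.
pose p (t : R) := t * (2 * y).
pose q (t : R) := expR (t * y) - expR (t * - y).
have dp (t : R) : is_derive t 1 p (2 * y).
  by rewrite /p; apply: is_derive_eq; rewrite scaler0 add0r /GRing.scale /= mulr1.
have dq (t : R) : is_derive t 1 q (y * (expR (t * y) + expR (t * - y))).
  rewrite /q; apply: is_derive_eq; rewrite !scaler0 !add0r /GRing.scale /= !mulr1; ring.
have := @increment_le R p q _ _ dp dq.
rewrite /p /q !mul1r !mul0r expR0 subrr !subr0; apply => t _.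
have h1 := expR_ge1Dx (t * y); have h2 := expR_ge1Dx (t * - y).
by rewrite [leLHS]mulrC ler_wpM2l//; lra.
Qed.

(** Dominates the second moment by the moment generating function. *)
Lemma sqr_le_cosh (x : R) : x ^+ 2 <= expR x + expR (- x) - 2.
Proof.
wlog x0 : x / 0 <= x.
  move=> h; have [/h//|/ltW] := leP 0 x; rewrite -oppr_ge0 => /h.
  by rewrite opprK sqrrN [expR x + _]addrC.
have h := expR_sinh_ge (divr_ge0 x0 (ler0n R 2)).
have e1 : expR x = expR (x / 2) ^+ 2 by rewrite -expRM_natl; congr expR; field.
have e2 : expR (- x) = expR (- (x / 2)) ^+ 2 by rewrite -expRM_natl; congr expR; field.
have e3 : expR (x / 2) * expR (- (x / 2)) = 1 by rewrite -expRD subrr expR0.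
rewrite e1 e2; move: h e3; move: (expR _) (expR _) => b a h e3.
have : x ^+ 2 <= (a - b) ^+ 2.
  rewrite -ler_sqrt; last exact: sqr_ge0.
  by rewrite !sqrtr_sqr ger0_norm// (le_trans _ (ler_norm _))//; lra.
have -> : (a - b) ^+ 2 = a ^+ 2 + b ^+ 2 - 2 * (a * b) by ring.
by rewrite e3 mulr1.
Qed.

Lemma expR_le_inv (s : R) : s < 1 -> expR s <= (1 - s)^-1.
Proof.
move=> s1; rewrite -[expR s]invrK -expRN lef_pV2 ?posrE ?expR_gt0 ?subr_gt0//.
exact: expR_ge1Dx.
Qed.

Lemma expR_le_quad (s : R) : 0 <= s <= 1 / 4 -> expR s - 1 - s <= s ^+ 2.
Proof.
move=> /andP[s0 s1].
have e1 : expR s = expR (s / 2) ^+ 2 by rewrite -expRM_natl; congr expR; field.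
have h : expR (s / 2) <= (1 - s / 2)^-1 by apply: expR_le_inv; lra.
have d0 : 0 < 1 - s / 2 by lra.
have h2 : expR s <= ((1 - s / 2) ^+ 2)^-1.
  by rewrite e1 -exprVn lerXn2r ?nnegrE ?expR_ge0 ?invr_ge0 ?(ltW d0).
have : ((1 - s / 2) ^+ 2)^-1 <= 1 + s + s ^+ 2.
  rewrite -[leLHS]mul1r ler_pdivrMr ?exprn_gt0//.
  have : 0 <= s ^+ 2 * (1 / 4 - 3 / 4 * s + s ^+ 2 / 4).
    by apply: mulr_ge0; [exact: sqr_ge0|have := sqr_ge0 s; lra].
  lra.
lra.
Qed.

End exp_bounds.

Section moments.
Context {R : realType} (n : nat).
Local Notation lam := (lebesgue_rV n : {sigma_finite_measure set 'rV[R]_n -> \bar R}).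
Local Notation Gam := (@gaussian R n).

Lemma gaussian_kernel (x : 'rV[R]_n) (xi : R) (H : 'rV[R]_n -> R) : 0 < xi ->
  measurable_fun setT H ->
  (\int[lam]_z (gauss xi (x - z) * H z)%:E = \int[Gam]_u (H (x + xi *: u))%:E)%E.
Proof.
move=> xi0 mH.
transitivity (\int[Gam]_u (cst 1 u * H (x + xi *: u))%:E)%E; last first.
  by apply: eq_integral => u _; rewrite mul1r.
apply: (@signed_integral_eq R _ _ _ _ lam Gam (fun z => gauss xi (x - z)) (cst 1)
  (fun u => x + xi *: u) (fun z => gauss_ge0 _ _) (fun _ => ler01)) => // f mf f0.
by rewrite ge0_gaussian_kernel//; apply: eq_integral => u _; rewrite mul1e.
Qed.

Lemma gaussian_shift (q : 'rV[R]_n) (H : 'rV[R]_n -> R) : measurable_fun setT H ->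
  (\int[Gam]_u (H (u + q))%:E = \int[Gam]_u (expR (dot u q - enorm q ^+ 2 / 2) * H u)%:E)%E.
Proof.
move=> mH.
transitivity (\int[Gam]_u (cst 1 u * H (u + q))%:E)%E.
  by apply: eq_integral => u _; rewrite mul1r.
apply/esym/(@signed_integral_eq R _ _ _ _ Gam Gam (fun u => expR (dot u q - enorm q ^+ 2 / 2))
  (cst 1) (fun u => u + q) (fun u => expR_ge0 _) (fun _ => ler01)) => // f mf f0.
by rewrite -ge0_gaussian_shift//; apply: eq_integral => u _; rewrite mul1e.
Qed.

Lemma measurable_dotr (q : 'rV[R]_n) : measurable_fun setT (fun u => dot u q).
Proof. exact: measurable_dot. Qed.
#[local] Hint Resolve measurable_dotr : core.

Lemma measurable_expdot (q : 'rV[R]_n) : measurable_fun setT (fun u => expR (dot u q)).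
Proof. exact: measurableT_comp. Qed.

Lemma integrable_expdot (q : 'rV[R]_n) : Gam.-integrable setT (EFin \o (fun u => expR (dot u q))).
Proof.
have h : (\int[Gam]_u (expR (dot u q))%:E <= (expR (enorm q ^+ 2 / 2))%:E)%E.
  by rewrite gaussian_mgf.
exact: (ge0_integrable (measurable_expdot q) (fun x => expR_ge0 _) h (ltry _)).
Qed.

Lemma Rintegral_expdot (q : 'rV[R]_n) : \int[Gam]_u expR (dot u q) = expR (enorm q ^+ 2 / 2).
Proof. by rewrite /Rintegral gaussian_mgf. Qed.

Lemma integrable_dot2 (q : 'rV[R]_n) : Gam.-integrable setT (EFin \o (fun u => dot u q ^+ 2)).
Proof.
apply: (@integrable_le _ _ _ _ _ (fun u => expR (dot u q) + expR (dot u (- q)))).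
- exact: measurable_funX.
- move=> u; rewrite ger0_norm ?sqr_ge0// dotNr.
  by have := sqr_le_cosh (dot u q); lra.
- exact: (integrable_addr (integrable_expdot _) (integrable_expdot _)).
Qed.

Lemma integrable_dot (q : 'rV[R]_n) : Gam.-integrable setT (EFin \o (fun u => dot u q)).
Proof.
apply: (@integrable_le _ _ _ _ _ (fun u => 1 + dot u q ^+ 2)) => //.
- by move=> u; rewrite ler_norml; apply/andP; split; have := sqr_ge0 (dot u q + 1); have := sqr_ge0 (dot u q - 1); lra.
- exact: (integrable_addr (integrable_cst1 _ _) (integrable_dot2 q)).
Qed.

(** Scaling the second-order expansion of the moment generating function. *)
Lemma small_scale (b e : R) : 0 <= b -> 0 < e <= 1 ->
  let c := e / (1 + b) in let s := c ^+ 2 * b ^+ 2 / 2 in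
  [/\ 0 < c, c <= e, 0 <= s, s <= e & s <= 1 / 2].
Proof.
move=> b0 /andP[e0 e1] c s.
have b1 : 0 < 1 + b by lra.
have c0 : 0 < c by rewrite divr_gt0.
have ce : c <= e by rewrite ler_pdivrMr// ler_peMr ?(ltW e0)//; lra.
have cb : c * b <= e.
  rewrite /c -mulrA; apply: ler_piMr; first exact: ltW.
  by rewrite [leLHS]mulrC ler_pdivrMr// mul1r; lra.
have cb0 : 0 <= c * b by rewrite mulr_ge0// ltW.
have sE : s = (c * b) ^+ 2 / 2 by congr (_ / 2); rewrite -exprMn.
have sle : (c * b) ^+ 2 <= e.
  by rewrite expr2 -[leRHS]mulr1; apply: ler_pM => //; exact: le_trans cb e1.
by split => //; rewrite sE ?divr_ge0 ?sqr_ge0//; lra.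
Qed.

(** Apply [sqr_le_cosh] to a small multiple of the vector, evaluate the right-hand
    side by the moment generating function and let the multiple tend to zero. *)
Lemma second_moment_le (q : 'rV[R]_n) : \int[Gam]_u (dot u q ^+ 2) <= enorm q ^+ 2.
Proof.
set J := \int[Gam]_u _; rewrite -subr_ge0; apply: (@ge0_of_small _ _ J) => e e01.
have J0 : 0 <= J by apply: Rintegral_ge0 => u _; exact: sqr_ge0.
have [] := small_scale (enorm_ge0 q) e01; set c := e / _; set s := c ^+ 2 * _ / 2.
move=> c0 ce s0 se s12.
have h : c ^+ 2 * J <= 2 * expR s - 2.
  rewrite /J -RintegralZl//; last exact: integrable_dot2.
  have -> : 2 * expR s - 2 = \int[Gam]_u (expR (dot u (c *: q)) + expR (dot u (- (c *: q))) - 2).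
    rewrite RintegralB//; last 2 first.
    - exact: (integrable_addr (integrable_expdot _) (integrable_expdot _)).
    - exact: integrable_cst1.
    rewrite RintegralD// ?Rintegral_cst1 ?Rintegral_expdot; try exact: integrable_expdot.
    rewrite enormN enormZ exprMn real_normK ?num_real//.
    by rewrite -mulr2n mulr_natl.
  apply: le_Rintegral => //.
  - exact: (integrable_scaler _ (integrable_dot2 q)).
  - apply: integrable_subr; last exact: integrable_cst1.
    exact: (integrable_addr (integrable_expdot _) (integrable_expdot _)).
  move=> u _; rewrite dotNr dotZr -exprMn; exact: sqr_le_cosh.
have h2 : expR s - 1 <= s / (1 - s).
  have := @expR_le_inv _ s; have d : 0 < 1 - s by lra.
  have -> : s / (1 - s) = (1 - s)^-1 - 1 by field; rewrite gt_eqF.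
  by rewrite -subr_gt0 => /(_ d); lra.
have h3 : (1 - s) * J <= enorm q ^+ 2.
  have d : 0 < 1 - s by lra.
  have c2 : 0 < c ^+ 2 by rewrite exprn_gt0.
  rewrite -(ler_pM2l c2) mulrCA mulrC -ler_pdivlMr//.
  apply: le_trans h _; apply: le_trans (_ : 2 * (s / (1 - s)) <= _); first by lra.
  by rewrite mulrA /s; apply: ler_wpM2r; [rewrite invr_ge0 ltW|lra].
have : s * J <= e * J by rewrite ler_wpM2r.
lra.
Qed.

(** As for the second moment, from [1 + x <= exp x]. *)
Lemma first_moment_le0 (q : 'rV[R]_n) : \int[Gam]_u (dot u q) <= 0.
Proof.
set J := \int[Gam]_u _; rewrite -oppr_ge0.
apply: (@ge0_of_small _ _ (`|J| + enorm q ^+ 2)) => e e01.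
have [] := small_scale (enorm_ge0 q) e01; set c := e / _; set s := c ^+ 2 * _ / 2.
move=> c0 ce s0 se s12.
have h : c * J <= expR s - 1.
  rewrite /J -RintegralZl//; last exact: integrable_dot.
  have -> : expR s - 1 = \int[Gam]_u (expR (dot u (c *: q)) - 1).
    rewrite RintegralB// ?Rintegral_cst1 ?Rintegral_expdot; last 2 first.
    - exact: integrable_expdot.
    - exact: integrable_cst1.
    by rewrite enormZ exprMn real_normK ?num_real.
  apply: le_Rintegral => //.
  - exact: (integrable_scaler _ (integrable_dot q)).
  - by apply: integrable_subr; [exact: integrable_expdot|exact: integrable_cst1].
  by move=> u _; rewrite dotZr; have := expR_ge1Dx (c * dot u q); lra.
have h2 : (1 - s) * (expR s - 1) <= s.
  have := @expR_le_inv _ s; have d : 0 < 1 - s by lra.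
  rewrite -subr_gt0 => /(_ d); rewrite -[X in _ <= X]mul1r ler_pdivlMr// => h2; lra.
have h3 : (1 - s) * J <= e * enorm q ^+ 2.
  have d : 0 < 1 - s by lra.
  have h4 := ler_wpM2l (ltW d) h.
  have B0 := sqr_ge0 (enorm q).
  have h6 : c * (c * enorm q ^+ 2) <= c * (e * enorm q ^+ 2).
    by rewrite ler_wpM2l ?(ltW c0)// ler_wpM2r.
  have sE : s = c * (c * enorm q ^+ 2) / 2 by rewrite /s; ring.
  by rewrite -(ler_pM2l c0); move: s0 h2 h4 h6; rewrite sE; clear; lra.
have h5 : - (e * `|J|) <= - (s * J).
  rewrite lerN2 (le_trans (ler_norm _))// normrM (ger0_norm s0) ler_wpM2r//.
lra.
Qed.

Lemma first_moment (q : 'rV[R]_n) : \int[Gam]_u (dot u q) = 0.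
Proof.
apply/le_anti/andP; split; first exact: first_moment_le0.
have := first_moment_le0 (- q); under eq_Rintegral do rewrite dotNr -mulN1r.
rewrite RintegralZl//; last exact: integrable_dot.
by rewrite mulN1r oppr_le0.
Qed.

(** Weighted inequality of arithmetic and geometric means with the second moment. *)
Lemma abs_moment_le (q : 'rV[R]_n) : \int[Gam]_u `|dot u q| <= enorm q.
Proof.
have [->|q0] := eqVneq q 0.
  by under eq_Rintegral do rewrite dot0r normr0; rewrite Rintegral_cst1 enorm0.
have qp := enorm_gt0 q0; set b := enorm q in qp *.
have i1 : Gam.-integrable setT (EFin \o (fun u => (2 * b)^-1 * dot u q ^+ 2)).
  exact: (integrable_scaler _ (integrable_dot2 q)).
apply: (@le_trans _ _ (\int[Gam]_u ((2 * b)^-1 * dot u q ^+ 2 + b / 2))).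
  apply: le_Rintegral => //.
  - exact: integrable_normr (integrable_dot q).
  - by apply: integrable_addr => //; exact: integrable_cst1.
  move=> u _; have := sqr_ge0 (`|dot u q| - b); rewrite -[dot u q ^+ 2]real_normK ?num_real//.
  move: `|_| => a h; rewrite -(ler_pM2l (_ : 0 < 2 * b)) ?mulr_gt0//.
  have -> : 2 * b * ((2 * b)^-1 * a ^+ 2 + b / 2) = a ^+ 2 + b ^+ 2 by field; rewrite gt_eqF.
  lra.
rewrite RintegralD//; last exact: integrable_cst1.
rewrite Rintegral_cst1 RintegralZl//; last exact: integrable_dot2.
have := second_moment_le q; rewrite -/b => h.
have : (2 * b)^-1 * \int[Gam]_x (dot x q ^+ 2) <= b / 2.
  by rewrite mulrC ler_pdivrMr ?mulr_gt0//; lra.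
lra.
Qed.

End moments.

(** * Gaussian smoothing of a bounded function *)
Section Rintegral_sums.
Context d (T : measurableType d) (R : realType) (mu : {measure set T -> \bar R}).

Lemma integrable_sumr (I : Type) (r : seq I) (f : I -> T -> R) :
  (forall i, mu.-integrable setT (EFin \o f i)) ->
  mu.-integrable setT (EFin \o (fun x => \sum_(i <- r) f i x)).
Proof.
move=> hf; elim: r => [|i r ih].
  under eq_fun do rewrite big_nil; exact: integrable0.
under eq_fun do rewrite big_cons; exact: (integrable_addr (hf i) ih).
Qed.

Lemma Rintegral_sumr (I : Type) (r : seq I) (f : I -> T -> R) :
  (forall i, mu.-integrable setT (EFin \o f i)) ->
  \int[mu]_x (\sum_(i <- r) f i x) = \sum_(i <- r) \int[mu]_x f i x.
Proof.
move=> hf; elim: r => [|i r ih].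
  by under eq_Rintegral do rewrite big_nil; rewrite big_nil /Rintegral integral0.
under eq_Rintegral do rewrite big_cons.
by rewrite big_cons RintegralD// ?ih//; exact: integrable_sumr.
Qed.

End Rintegral_sums.

Section exp_remainder.
Context {R : realType} (n : nat).
Local Notation Gam := (@gaussian R n).
Variable q : 'rV[R]_n.

Let E (u : 'rV[R]_n) := expR (dot u q - enorm q ^+ 2 / 2).

Let EE u : E u = expR (- (enorm q ^+ 2 / 2)) * expR (dot u q).
Proof. by rewrite /E -expRD addrC. Qed.

Lemma measurable_tilt : measurable_fun setT E.
Proof.
by apply: measurableT_comp => //; apply: measurable_funB => //; exact: measurable_dot.
Qed.

Lemma integrable_tilt : Gam.-integrable setT (EFin \o E).
Proof.
rewrite (_ : E = fun u => expR (- (enorm q ^+ 2 / 2)) * expR (dot u q)); last first.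
  by apply/funext => u; rewrite EE.
exact: (integrable_scaler _ (integrable_expdot q)).
Qed.

Lemma Rintegral_tilt : \int[Gam]_u E u = 1.
Proof.
under eq_Rintegral do rewrite EE.
rewrite RintegralZl//; last exact: integrable_expdot.
by rewrite Rintegral_expdot -expRD addrC subrr expR0.
Qed.

Let E2E u : E u ^+ 2 = expR (- (enorm q ^+ 2)) * expR (dot u (2 *: q)).
Proof. by rewrite /E -expRM_natl -expRD dotZr; congr expR; field. Qed.

Lemma integrable_tilt2 : Gam.-integrable setT (EFin \o (fun u => E u ^+ 2)).
Proof.
rewrite (_ : (fun u => E u ^+ 2) = fun u => expR (- (enorm q ^+ 2)) * expR (dot u (2 *: q))); last first.
  by apply/funext => u; rewrite E2E.
exact: (integrable_scaler _ (integrable_expdot _)).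
Qed.

Lemma Rintegral_tilt2 : \int[Gam]_u (E u ^+ 2) = expR (enorm q ^+ 2).
Proof.
under eq_Rintegral do rewrite E2E.
rewrite RintegralZl//; last exact: integrable_expdot.
by rewrite Rintegral_expdot -expRD enormZ (ger0_norm (ler0n R 2)); congr expR; field.
Qed.

Lemma integrable_dot_tilt : Gam.-integrable setT (EFin \o (fun u => E u * dot u q)).
Proof.
apply: (@integrable_le _ _ _ _ _ (fun u => E u ^+ 2 + dot u q ^+ 2)).
- by apply: measurable_funM; [exact: measurable_tilt|exact: measurable_dot].
- move=> u; move: (E u) (dot u q) => e a; rewrite ler_norml.
  have h1 := sqr_ge0 (e - a); have h2 := sqr_ge0 (e + a); have h3 := sqr_ge0 e; have h4 := sqr_ge0 a.
  by apply/andP; split; lra.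
- exact: (integrable_addr integrable_tilt2 (integrable_dot2 q)).
Qed.

Lemma Rintegral_dot_tilt : \int[Gam]_u (E u * dot u q) = enorm q ^+ 2.
Proof.
have := gaussian_shift q (measurable_dotr q) => h.
rewrite /Rintegral -h -/(Rintegral _ _ _).
under eq_Rintegral do rewrite dotDl.
rewrite RintegralD//; [|exact: integrable_dot|exact: integrable_cst1].
by rewrite first_moment Rintegral_cst1 add0r enorm_sqr.
Qed.

(** The mean square of the remainder expands into moments known exactly, except for
    the second moment of the Gaussian, for which an upper bound suffices. *)
Lemma exp_remainder_sqr : Gam.-integrable setT (EFin \o (fun u => (E u - 1 - dot u q) ^+ 2)) /\
  \int[Gam]_u ((E u - 1 - dot u q) ^+ 2) <= expR (enorm q ^+ 2) - 1 - enorm q ^+ 2.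
Proof.
have eqf : (fun u => (E u - 1 - dot u q) ^+ 2) =
  (fun u => E u ^+ 2 + dot u q ^+ 2 + (1 + 2 * dot u q) - 2 * (E u + E u * dot u q)).
  by apply/funext => u; ring.
have i1 : Gam.-integrable setT (EFin \o (fun u => E u ^+ 2 + dot u q ^+ 2)).
  exact: (integrable_addr integrable_tilt2 (integrable_dot2 q)).
have i2 : Gam.-integrable setT (EFin \o (fun u => 1 + 2 * dot u q)).
  exact: (integrable_addr (integrable_cst1 _ _) (integrable_scaler _ (integrable_dot q))).
have i3 : Gam.-integrable setT (EFin \o (fun u => 2 * (E u + E u * dot u q))).
  exact: (integrable_scaler _ (integrable_addr integrable_tilt integrable_dot_tilt)).
rewrite eqf; split.
  exact: (integrable_subr (integrable_addr i1 i2) i3).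
rewrite RintegralB//; last exact: (integrable_addr i1 i2).
rewrite RintegralD// RintegralD//; [|exact: integrable_tilt2|exact: integrable_dot2].
rewrite RintegralD//; [|exact: integrable_cst1|exact: (integrable_scaler _ (integrable_dot q))].
rewrite !RintegralZl//; [|exact: (integrable_addr integrable_tilt integrable_dot_tilt)|exact: integrable_dot].
rewrite RintegralD//; [|exact: integrable_tilt|exact: integrable_dot_tilt].
rewrite Rintegral_tilt Rintegral_dot_tilt Rintegral_tilt2 first_moment Rintegral_cst1.
have := second_moment_le q; lra.
Qed.

(** From the mean square by the weighted inequality of arithmetic and geometric
    means. *)
Lemma exp_remainder : enorm q <= 1 / 2 ->
  Gam.-integrable setT (EFin \o (fun u => `|E u - 1 - dot u q|)) /\
  \int[Gam]_u `|E u - 1 - dot u q| <= enorm q ^+ 2.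
Proof.
move=> q12; have [i2 h2] := exp_remainder_sqr.
have i1 : Gam.-integrable setT (EFin \o (fun u => `|E u - 1 - dot u q|)).
  apply: integrable_normr; apply: integrable_subr; last exact: integrable_dot.
  apply: integrable_subr; [exact: integrable_tilt|exact: integrable_cst1].
split => //.
have [q0|q0] := eqVneq q 0.
  have E0 u : E u - 1 - dot u q = 0.
    by rewrite /E q0 dot0r enorm0 expr0n /= mul0r !subr0 expR0 subrr.
  under eq_Rintegral do rewrite E0 normr0.
  by rewrite Rintegral_cst1 sqr_ge0.
have qp := enorm_gt0 q0; set s := enorm q ^+ 2 in h2 *.
have s0 : 0 < s by rewrite exprn_gt0.
have s4 : s <= 1 / 4.
  by rewrite /s expr2; have := ler_pM (enorm_ge0 q) (enorm_ge0 q) q12 q12; lra.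
have hq := @expR_le_quad _ s; rewrite (ltW s0) s4 in hq; have {}hq := hq isT.
apply: (@le_trans _ _ (\int[Gam]_u ((2 * s)^-1 * (E u - 1 - dot u q) ^+ 2 + s / 2))).
  apply: le_Rintegral => //.
  - apply: integrable_addr; last exact: integrable_cst1.
    exact: (integrable_scaler _ i2).
  move=> u _; move: (E u - 1 - dot u q) => a.
  have := sqr_ge0 (`|a| - s); rewrite -[a ^+ 2]real_normK ?num_real//.
  move: `|a| => b h; rewrite -(ler_pM2l (_ : 0 < 2 * s)) ?mulr_gt0//.
  have -> : 2 * s * ((2 * s)^-1 * b ^+ 2 + s / 2) = b ^+ 2 + s ^+ 2 by field; rewrite gt_eqF.
  lra.
rewrite RintegralD//; [|exact: (integrable_scaler _ i2)|exact: integrable_cst1].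
rewrite Rintegral_cst1 RintegralZl//.
have : (2 * s)^-1 * \int[Gam]_u ((E u - 1 - dot u q) ^+ 2) <= s / 2.
  rewrite mulrC ler_pdivrMr ?mulr_gt0//.
  have -> : s / 2 * (2 * s) = s ^+ 2 by field.
  exact: le_trans h2 hq.
lra.
Qed.

End exp_remainder.

Section smoothing_calculus.
Context {R : realType} (n : nat) (xi B : R) (phi : 'rV[R]_n -> R).
Local Notation Gam := (@gaussian R n).
Hypothesis xi0 : 0 < xi.
Hypothesis mphi : measurable_fun setT phi.
Hypothesis phiB : forall z, `|phi z| <= B.

Definition gsmooth x := \int[Gam]_u phi (x + xi *: u).
(** The gradient of [gsmooth], with the derivative moved onto the Gaussian density. *)
Definition ggrad x : 'rV[R]_n := \row_j \int[Gam]_u (xi^-1 * u 0 j * phi (x + xi *: u)).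

Lemma B_ge0 : 0 <= B. Proof. exact: le_trans (normr_ge0 _) (phiB 0). Qed.

Lemma measurable_phi_affine x : measurable_fun setT (fun u : 'rV[R]_n => phi (x + xi *: u)).
Proof. exact: measurableT_comp mphi (measurable_affine x xi). Qed.

Lemma integrable_mul_phi (f : 'rV[R]_n -> R) x : Gam.-integrable setT (EFin \o f) ->
  Gam.-integrable setT (EFin \o (fun u : 'rV[R]_n => f u * phi (x + xi *: u))).
Proof.
move=> hf; apply: (@integrable_le _ _ _ _ _ (fun u => B * `|f u|)).
- apply: measurable_funM; last exact: measurable_phi_affine.
  exact: integrable_measurable hf.
- by move=> u; rewrite normrM mulrC; exact: ler_wpM2r (normr_ge0 _) _ _ (phiB _).
- exact: (integrable_scaler _ (integrable_normr hf)).
Qed.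

Lemma integrable_phi x : Gam.-integrable setT (EFin \o (fun u : 'rV[R]_n => phi (x + xi *: u))).
Proof. by apply: (@integrable_bounded _ _ _ _ _ B) => //; exact: measurable_phi_affine. Qed.

Lemma gsmooth_le x : `|gsmooth x| <= B.
Proof.
apply: le_trans (le_normr_Rintegral measurableT (integrable_phi x)) _.
rewrite -[leRHS](Rintegral_cst1 Gam); apply: le_Rintegral => //.
- exact: (integrable_normr (integrable_phi x)).
- exact: integrable_cst1.
Qed.

(** Testing against a vector replaces integrals of vectors by one scalar integral. *)
Lemma ggrad_dot x v : dot (ggrad x) v = \int[Gam]_u (xi^-1 * dot u v * phi (x + xi *: u)).
Proof.
have ij j : Gam.-integrable setT (EFin \o (fun u : 'rV[R]_n => xi^-1 * u 0 j * phi (x + xi *: u))).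
  apply: integrable_mul_phi; have := integrable_scaler xi^-1 (integrable_dot (delta_mx 0 j : 'rV[R]_n)).
  by under eq_fun do rewrite dot_delta.
rewrite dot_sum; transitivity (\sum_j \int[Gam]_u (v 0 j * (xi^-1 * u 0 j * phi (x + xi *: u)))).
  by apply: eq_bigr => j _; rewrite RintegralZl// mxE mulrC.
rewrite -Rintegral_sumr; last by move=> j; exact: (integrable_scaler _ (ij j)).
apply: eq_Rintegral => u _; rewrite dot_sum mulr_sumr mulr_suml.
by apply: eq_bigr => j _; ring.
Qed.

(** A translation of [x] is absorbed into the Gaussian measure, so that
    the expansion in [p] differentiates the Gaussian density only. *)
Lemma gsmooth_translate x p :
  gsmooth (x + p) = \int[Gam]_u (expR (dot u (xi^-1 *: p) - enorm (xi^-1 *: p) ^+ 2 / 2) * phi (x + xi *: u)).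
Proof.
rewrite /gsmooth /Rintegral -(gaussian_shift (xi^-1 *: p) (measurable_phi_affine x)).
congr fine; apply: eq_integral => u _; congr (phi _)%:E.
by rewrite scalerDr scalerA mulfV ?gt_eqF// scale1r addrCA addrC.
Qed.

Lemma gsmooth_taylor_near x p : enorm p <= xi / 2 ->
  `|gsmooth (x + p) - gsmooth x - dot (ggrad x) p| <= B / xi ^+ 2 * enorm p ^+ 2.
Proof.
move=> px; set q := xi^-1 *: p.
have qE : enorm q = enorm p / xi by rewrite enormZ gtr0_norm ?invr_gt0// mulrC.
have q12 : enorm q <= 1 / 2 by rewrite qE ler_pdivrMr//; lra.
have [iA hA] := exp_remainder q12.
pose E (u : 'rV[R]_n) := expR (dot u q - enorm q ^+ 2 / 2).
have i1 := integrable_mul_phi x (integrable_tilt q).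
have i2 := integrable_mul_phi x (integrable_dot q).
have -> : gsmooth (x + p) - gsmooth x - dot (ggrad x) p =
    \int[Gam]_u ((E u - 1 - dot u q) * phi (x + xi *: u)).
  rewrite gsmooth_translate ggrad_dot -/q.
  have -> : \int[Gam]_u (xi^-1 * dot u p * phi (x + xi *: u)) = \int[Gam]_u (dot u q * phi (x + xi *: u)).
    by apply: eq_Rintegral => u _; rewrite /q dotZr.
  rewrite /gsmooth -RintegralB//; last exact: integrable_phi.
  rewrite -RintegralB//; last exact: (integrable_subr i1 (integrable_phi x)).
  by apply: eq_Rintegral => u _; rewrite /E; ring.
have iE : Gam.-integrable setT (EFin \o (fun u => E u - 1 - dot u q)).
  apply: integrable_subr; last exact: integrable_dot.
  by apply: integrable_subr; [exact: integrable_tilt|exact: integrable_cst1].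
have i3 := integrable_mul_phi x iE.
apply: le_trans (le_normr_Rintegral measurableT i3) _.
apply: (@le_trans _ _ (\int[Gam]_u (B * `|E u - 1 - dot u q|))).
  apply: le_Rintegral => //.
  - exact: integrable_normr i3.
  - exact: (integrable_scaler _ iA).
  by move=> u _; rewrite normrM mulrC; exact: ler_wpM2r (normr_ge0 _) _ _ (phiB _).
rewrite RintegralZl// (le_trans (ler_wpM2l B_ge0 hA))// qE exprMn exprVn.
by rewrite le_eqVlt; apply/orP; left; apply/eqP; ring.
Qed.

(** A quadratic bound for short steps doubles: the defect at [2 p] is the sum of
    two defects at [p] and of the change of gradient, itself a sum of two defects. *)
Lemma gsmooth_taylor x p :
  `|gsmooth (x + p) - gsmooth x - dot (ggrad x) p| <= B / xi ^+ 2 * enorm p ^+ 2.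
Proof.
have main k : forall x p, enorm p <= 2 ^+ k * (xi / 2) ->
    `|gsmooth (x + p) - gsmooth x - dot (ggrad x) p| <= B / xi ^+ 2 * enorm p ^+ 2.
  elim: k => [|k ih] {}x {}p; first by rewrite expr0 mul1r; exact: gsmooth_taylor_near.
  move=> hp; pose h := 2^-1 *: p.
  have pE : p = h + h by rewrite -scalerDl (_ : 2^-1 + 2^-1 = 1) ?scale1r//; field.
  have hE : enorm p = 2 * enorm h by rewrite pE -mulr2n -scaler_nat enormZ ger0_norm.
  have hh : enorm h <= 2 ^+ k * (xi / 2).
    by move: hp; rewrite hE exprS -mulrA ler_pM2l.
  have t1 := ih x h hh; have t2 := ih (x + h) h hh.
  have := ih (x + h) (- h); rewrite enormN => /(_ hh); rewrite addrK dotNr => t3.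
  rewrite pE addrA dotDr -pE hE exprMn.
  move: t1 t2 t3; move: (gsmooth x) (gsmooth (x + h)) (gsmooth (x + h + h))
    (dot (ggrad x) h) (dot (ggrad (x + h)) h) (enorm h ^+ 2) (B / xi ^+ 2).
  move=> g0 g1 g2 d0 d1 e L; rewrite !ler_norml => /andP[? ?] /andP[? ?] /andP[? ?].
  apply/andP; split; lra.
have [k hk] : exists k, enorm p <= 2 ^+ k * (xi / 2).
  exists (Num.bound (enorm p / (xi / 2))); rewrite -ler_pdivrMr ?divr_gt0//.
  have h : 0 <= enorm p / (xi / 2) by rewrite divr_ge0 ?enorm_ge0 ?divr_ge0 ?(ltW xi0).
  apply: le_trans (ltW (archi_boundP h)) _.
  by rewrite -natrX ler_nat ltnW// ltn_expl.
exact: main hk.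
Qed.

(** The quadratic Taylor bound contains differentiability. *)
Lemma partial_gsmooth x i : is_derive x (delta_mx 0 i) gsmooth (ggrad x 0 i).
Proof.
apply: (@is_derive_quadratic _ _ _ _ _ _ (B / xi ^+ 2) 1 ltr01) => h _.
have := gsmooth_taylor x (h *: delta_mx 0 i).
by rewrite dotZr dot_delta enormZ enorm_delta mulr1 real_normK ?num_real.
Qed.

Lemma grad_gsmooth x : grad gsmooth x = ggrad x.
Proof.
by apply/rowP => i; rewrite mxE; exact: (@derive_val _ _ _ _ _ _ _ (partial_gsmooth x i)).
Qed.

(** Combines the Taylor bound at [y] with increment [p] and those at [x] with
    increments [y - x] and [y - x + p], where [p] points along the difference of the
    gradients and is as long as [y - x]. *)
Lemma ggrad_lipschitz x y : enorm (ggrad y - ggrad x) <= 6 * (B / xi ^+ 2) * enorm (y - x).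
Proof.
set L := B / xi ^+ 2; have L0 : 0 <= L by rewrite divr_ge0 ?B_ge0 ?sqr_ge0.
set D := ggrad y - ggrad x.
have [D0|D0] := eqVneq D 0; first by rewrite D0 enorm0 (mulr_ge0 (mulr_ge0 (ler0n _ 6) L0) (enorm_ge0 _)).
have Dp := enorm_gt0 D0.
pose r := enorm (y - x); pose p := (r / enorm D) *: D.
have pE : enorm p = r.
  by rewrite enormZ ger0_norm ?divr_ge0 ?enorm_ge0// divfK// gt_eqF.
have t1 := gsmooth_taylor y p; have t2 := gsmooth_taylor x (y - x + p).
have t3 := gsmooth_taylor x (y - x).
have e1 : x + (y - x) = y by rewrite addrC subrK.
rewrite addrA e1 in t2; rewrite e1 in t3.
rewrite -/L pE dotDr in t1 t2; rewrite -/L -/r in t3.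
have n2 : enorm (y - x + p) ^+ 2 <= 4 * r ^+ 2.
  have := enormD (y - x) p; rewrite pE -/r => h.
  have : enorm (y - x + p) ^+ 2 <= (r + r) ^+ 2.
    by rewrite lerXn2r ?nnegrE ?enorm_ge0 ?addr_ge0 ?enorm_ge0.
  by move=> h2; apply: le_trans h2 _; rewrite le_eqVlt; apply/orP; left; apply/eqP; ring.
have h : dot D p <= 6 * L * r ^+ 2.
  rewrite dotDl dotNl; have n3 := ler_wpM2l L0 n2.
  move: t1 t2 t3 n3; rewrite !ler_norml => /andP[? ?] /andP[? ?] /andP[? ?] ?; lra.
have dp : dot D p = r * enorm D by rewrite dotZr -enorm_sqr expr2 mulrA divfK// gt_eqF.
have [r0|r0] := eqVneq r 0.
  have /eqP := enorm_eq0 r0; rewrite subr_eq0 => /eqP yx; move: D0; rewrite /D yx subrr eqxx.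
  by [].
have rp : 0 < r by rewrite lt_def r0 enorm_ge0.
by move: h; rewrite dp expr2 mulrCA ler_pM2l.
Qed.

Lemma ggrad_bound x : enorm (ggrad x) <= B / xi.
Proof.
apply: enorm_le_dual => [|v]; first by rewrite divr_ge0 ?B_ge0// ltW.
have iv : Gam.-integrable setT (EFin \o (fun u : 'rV[R]_n => xi^-1 * dot u v)).
  exact: (integrable_scaler _ (integrable_dot v)).
rewrite ggrad_dot; apply: le_trans (ler_norm _) _.
apply: le_trans (le_normr_Rintegral measurableT (integrable_mul_phi x iv)) _.
apply: (@le_trans _ _ (\int[Gam]_u (B / xi * `|dot u v|))).
  apply: le_Rintegral => //.
  - exact: integrable_normr (integrable_mul_phi x iv).
  - exact: (integrable_scaler _ (integrable_normr (integrable_dot v))).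
  move=> u _; rewrite !normrM gtr0_norm ?invr_gt0//.
  rewrite mulrC mulrA; apply: ler_wpM2r => //; apply: ler_wpM2r; last exact: phiB.
  by rewrite invr_ge0 ltW.
rewrite RintegralZl//; last exact: (integrable_normr (integrable_dot v)).
by apply: ler_wpM2l (abs_moment_le v); rewrite divr_ge0 ?B_ge0// ltW.
Qed.

End smoothing_calculus.

(** * Kernel integrals and their perturbation *)
Section kernels.
Context {R : realType} (n : nat).
Local Notation lam := (lebesgue_rV n : {sigma_finite_measure set 'rV[R]_n -> \bar R}).
Local Notation Gam := (@gaussian R n).

Lemma derive_of_line (V : normedModType R) (F : V -> R) (x v : V) (l : R) :
  is_derive (0 : R) (1 : R) (fun t : R => F (x + t *: v)) l -> 'D_v F x = l.
Proof.
move=> h; rewrite -[RHS](@derive_val _ _ _ _ _ _ _ h) /derive.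
have -> : (fun t : R => t^-1 *: ((F \o shift x) (t *: v) - F x)) =
  (fun t : R => t^-1 *: (((fun t : R => F (x + t *: v)) \o shift (0 : R)) (t *: (1 : R)) -
     F (x + (0 : R) *: v))).
  apply/funext => t /=; congr (_ *: (F _ - F _)); last by rewrite scale0r addr0.
  by rewrite addr0 scaler1 addrC.
by [].
Qed.

Lemma gauss_line (xi : R) (w : 'rV[R]_n) j (t : R) :
  gauss xi (w + t *: delta_mx 0 j) = (2 * pi * xi ^+ 2) `^ (- (n%:R / 2)) *
    expR (- ((enorm w ^+ 2 + (2 * t * w 0 j + t ^+ 2)) / (2 * xi ^+ 2))).
Proof.
rewrite /gauss enormD_sqr enormZ enorm_delta mulr1 dotZr dot_delta real_normK ?num_real//.
by rewrite -(addrA (enorm w ^+ 2)) (mulrA 2).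
Qed.

Lemma is_derive_expR_quad (K a b d : R) :
  is_derive (0 : R) (1 : R) (fun t : R => K * expR (- ((a + (2 * t * b + t ^+ 2)) / d)))
    (K * expR (- (a / d)) * (- (2 * b / d))).
Proof.
apply: is_derive_eq.
rewrite !scaler0 !add0r /GRing.scale /= !(mulr0, mul0r, addr0, add0r, mulr1, expr0n) /=.
ring.
Qed.

Lemma grad_gauss (xi : R) (x z : 'rV[R]_n) j : 0 < xi ->
  grad (fun x' => gauss xi (x' - z)) x 0 j =
  gauss xi (x - z) * (xi^-1 * (xi^-1 * (z - x) 0 j)).
Proof.
move=> xi0; rewrite mxE /partial; apply: derive_of_line.
have -> : (fun t : R => gauss xi (x + t *: delta_mx 0 j - z)) =
   (fun t : R => (2 * pi * xi ^+ 2) `^ (- (n%:R / 2)) *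
    expR (- ((enorm (x - z) ^+ 2 + (2 * t * (x - z) 0 j + t ^+ 2)) / (2 * xi ^+ 2)))).
  apply/funext => t; rewrite -gauss_line; congr (gauss _ _).
  by rewrite -!addrA; congr (_ + _); exact: addrC.
have h := is_derive_expR_quad ((2 * pi * xi ^+ 2) `^ (- (n%:R / 2))) (enorm (x - z) ^+ 2)
  ((x - z) 0 j) (2 * xi ^+ 2).
apply: (@is_derive_eq _ _ _ _ _ _ _ _ h); rewrite /gauss; congr (_ * _).
have -> : (z - x) 0 j = - (x - z) 0 j by rewrite -opprB mxE.
by move: ((x - z) 0 j) => b; field; rewrite gt_eqF.
Qed.

(** The weight of the neighbourhood of the bifurcation set is estimated through this
    uniform bound. *)
Lemma gauss1_mul_norm_le (u : 'rV[R]_n) :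
  gauss 1 u * enorm u <= (2 * pi) `^ (- (n%:R / 2)).
Proof.
rewrite /gauss expr1n !mulr1 -mulrA ler_piMr ?powR_ge0//.
have h := expR_ge1Dx (enorm u ^+ 2 / 2).
have h2 : enorm u <= expR (enorm u ^+ 2 / 2).
  by apply: le_trans h; have := sqr_ge0 (enorm u - 1); lra.
rewrite mulrC expRN ler_pdivrMr ?expR_gt0// mul1r//.
Qed.

(** An integrand that is measurable only for the completed measure is traded for a
    Borel representative, to which the smoothing calculus applies. *)
Section ae_representative.
Variables (xi : R) (F phi : 'rV[R]_n -> R) (N : set 'rV[R]_n).
Hypothesis xi0 : 0 < xi.
Hypothesis mphi : measurable_fun setT phi.
Hypothesis mN : measurable N.
Hypothesis N0 : lam N = 0%E.
Hypothesis Fphi : forall z, ~ N z -> F z = phi z.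

Lemma smoothing_gsmooth : smoothing xi F = gsmooth xi phi.
Proof.
apply/funext => x; rewrite /smoothing /gsmooth.
rewrite (@Rintegral_ae_eq _ _ _ lam _ (fun z => gauss xi (x - z) * phi z) N)//.
  by rewrite /Rintegral gaussian_kernel.
by move=> z /Fphi ->.
Qed.

Lemma kernel_grad_ggrad : kernel_grad xi F = ggrad xi phi.
Proof.
apply/funext => x; apply/rowP => j; rewrite !mxE.
pose H z : R := xi^-1 * (xi^-1 * (z - x) 0 j) * phi z.
rewrite (@Rintegral_ae_eq _ _ _ lam _ (fun z => gauss xi (x - z) * H z) N)//; last first.
  by move=> z /Fphi ->; rewrite grad_gauss// /H -!mulrA.
have mH : measurable_fun setT H.
  apply: measurable_funM => //; apply: measurable_funM => //; apply: measurable_funM => //.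
  have -> : (fun z : 'rV[R]_n => (z - x) 0 j) = (fun z : 'rV[R]_n => z 0 j - x 0 j).
    by apply/funext => z; rewrite !mxE.
  by apply: measurable_funB => //; exact: measurable_rV_coord.
rewrite /Rintegral gaussian_kernel//; congr fine; apply: eq_integral => u _.
rewrite /H addrKl mxE; congr ((_ * _) * _)%:E.
by rewrite mulKf// gt_eqF.
Qed.

End ae_representative.

Lemma Lebesgue_measurable_bounded (F : 'rV[R]_n -> R) (B : R) :
  Lebesgue_measurable F -> (forall z, `|F z| <= B) ->
  exists (phi : 'rV[R]_n -> R) (N : set 'rV[R]_n), [/\ measurable_fun setT phi,
    (forall z, `|phi z| <= B), measurable N, lam N = 0%E & forall z, ~ N z -> F z = phi z].
Proof.
move=> [F' [mF' [N [mN N0 FF']]]] FB.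
have B0 : 0 <= B by apply: le_trans (FB 0).
exists (fun z => Num.max (- B) (Num.min B (F' z))), N; split => //.
- by apply: measurable_maxr => //; apply: measurable_minr.
- move=> z; rewrite ler_norml le_max lexx /= ge_max ge_min lexx /=; lra.
- move=> z Nz; have e : F z = F' z by apply: contrapT => h; apply: Nz; exact: FF'.
  have := FB z; rewrite -e ler_norml => /andP[h1 h2].
  by rewrite (min_idPr h2) (max_idPr h1).
Qed.

Lemma lebesgue_affine x (xi : R) (U : set 'rV[R]_n) : 0 < xi -> measurable U ->
  lam U = ((xi ^+ n)%:E * \int[lam]_u (\1_U (x + xi *: u)%R)%:E)%E.
Proof.
move=> xi0 mU; rewrite -[in LHS](setIT U) -integral_indic//.
apply: ge0_integral_affine => //.
apply/measurable_EFinP; exact: measurable_indic.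
Qed.

Section bias.
Variables (xi B eps : R) (phi psi : 'rV[R]_n -> R) (N U : set 'rV[R]_n) (V : R).
Hypothesis xi0 : 0 < xi.
Hypothesis mphi : measurable_fun setT phi.
Hypothesis mpsi : measurable_fun setT psi.
Hypothesis phiB : forall z, `|phi z| <= B.
Hypothesis psiB : forall z, `|psi z| <= B.
Hypothesis mN : measurable N.
Hypothesis N0 : lam N = 0%E.
Hypothesis mU : measurable U.
Hypothesis UV : (lam U <= V%:E)%E.
Hypothesis eps0 : 0 <= eps.
Hypothesis close : forall z, ~ N z -> `|phi z - psi z| <= eps + 2 * B * \1_U z.

Lemma indic_moment_le x (v : 'rV[R]_n) :
  \int[Gam]_u (`|dot u v| * \1_U (x + xi *: u)) <=
  (2 * pi) `^ (- (n%:R / 2)) * enorm v * ((xi ^+ n)^-1 * V).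
Proof.
set kap := (2 * pi) `^ _.
have xn : 0 < xi ^+ n by rewrite exprn_gt0.
have kv : 0 <= kap * enorm v by rewrite mulr_ge0 ?powR_ge0 ?enorm_ge0.
have m1 : measurable_fun setT (fun u : 'rV[R]_n => \1_U (x + xi *: u) : R).
  exact: (measurableT_comp (measurable_indic _) (measurable_affine x xi)).
have md : measurable_fun setT (fun u : 'rV[R]_n => `|dot u v|).
  by apply: measurableT_comp => //; exact: measurable_dotr.
have mi : measurable_fun setT (fun u : 'rV[R]_n => (`|dot u v| * \1_U (x + xi *: u))%:E).
  by apply/measurable_EFinP; exact: measurable_funM.
have V0 : 0 <= V by rewrite -lee_fin (le_trans _ UV).
have i0 z : 0 <= \1_U z :> R by rewrite indicE ler0n.
have h : (\int[Gam]_u (`|dot u v| * \1_U (x + xi *: u))%:E <=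
   (kap * enorm v * ((xi ^+ n)^-1 * V))%:E)%E.
  rewrite ge0_integral_gaussian//.
  apply: (@le_trans _ _ (\int[lam]_u ((kap * enorm v)%:E * (\1_U (x + xi *: u))%:E))%E).
    apply: ge0_le_integral => //.
    - by move=> u _; rewrite -EFinM lee_fin; apply: mulr_ge0; [exact: gauss_ge0|apply: mulr_ge0; [exact: normr_ge0|exact: i0]].
    - apply: emeasurable_funM => //; apply/measurable_EFinP; exact: measurable_gauss.
    - by apply: emeasurable_funM => //; exact/measurable_EFinP.
    move=> u _; rewrite -!EFinM lee_fin mulrA ler_wpM2r//.
    apply: (@le_trans _ _ (gauss 1 u * (enorm u * enorm v))).
      by rewrite ler_wpM2l ?gauss_ge0// dot_norm_le.
    by rewrite mulrA ler_wpM2r ?enorm_ge0// gauss1_mul_norm_le.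
  rewrite ge0_integralZl//; last by exact/measurable_EFinP.
  rewrite [X in (_ <= X)%E]EFinM; apply: lee_wpmul2l; first by rewrite lee_fin.
  have e := lebesgue_affine x xi0 mU.
  have := UV; rewrite e => h.
  have -> : (((xi ^+ n)^-1 * V)%:E = ((xi ^+ n)^-1)%:E * V%:E :> \bar R)%E by rewrite EFinM.
  by rewrite lee_pdivlMl.
have ii := ge0_integrable (measurable_funM md m1) (fun u => mulr_ge0 (normr_ge0 _) (i0 _)) h (ltry _).
by rewrite -lee_fin -Rintegral_EFin.
Qed.

(** Off [U] the error [eps] is weighted by the first absolute moment; on [U] the
    density times the norm is at most the peak of the density. *)
Lemma ggrad_bias x : enorm (ggrad xi phi x - ggrad xi psi x) <=
  xi^-1 * eps + xi^-1 * (2 * B) * ((2 * pi) `^ (- (n%:R / 2)) * ((xi ^+ n)^-1 * V)).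
Proof.
set kap := (2 * pi) `^ _.
have B0 : 0 <= B by exact: le_trans (phiB 0).
have xi'0 : 0 <= xi^-1 by rewrite invr_ge0 ltW.
have V0 : 0 <= V by rewrite -lee_fin (le_trans _ UV).
have xn : 0 < xi ^+ n by rewrite exprn_gt0.
apply: enorm_le_dual => [|v].
  by rewrite addr_ge0 ?mulr_ge0 ?powR_ge0 ?invr_ge0 ?(ltW xn)// ltW.
have iv : Gam.-integrable setT (EFin \o (fun u : 'rV[R]_n => xi^-1 * dot u v)).
  exact: (integrable_scaler _ (integrable_dot v)).
have i1 := integrable_mul_phi xi mphi phiB x iv.
have i2 := integrable_mul_phi xi mpsi psiB x iv.
rewrite dotDl dotNl (ggrad_dot xi mphi phiB) (ggrad_dot xi mpsi psiB) -RintegralB//.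
apply: le_trans (ler_norm _) _.
apply: le_trans (le_normr_Rintegral measurableT (integrable_subr i1 i2)) _.
have mN' : measurable ((fun u : 'rV[R]_n => x + xi *: u) @^-1` N).
  by rewrite -[X in measurable X]setTI; exact: measurable_affine.
pose bnd (u : 'rV[R]_n) := xi^-1 * eps * `|dot u v| + xi^-1 * (2 * B) * (`|dot u v| * \1_U (x + xi *: u)).
have ia := integrable_normr (integrable_dot v).
have ib : Gam.-integrable setT (EFin \o (fun u : 'rV[R]_n => `|dot u v| * \1_U (x + xi *: u))).
  apply: (integrable_le _ _ ia).
    apply: measurable_funM; first by apply: measurableT_comp => //; exact: measurable_dotr.
    exact: (measurableT_comp (measurable_indic _) (measurable_affine x xi)).
  move=> u; rewrite ger0_norm ?mulr_ge0// ler_piMr// indicE; by case: (_ \in _).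
have ibnd : Gam.-integrable setT (EFin \o bnd).
  exact: (integrable_addr (integrable_scaler _ ia) (integrable_scaler _ ib)).
apply: (@le_trans _ _ (\int[Gam]_u bnd u)).
  rewrite -lee_fin -!Rintegral_EFin//; last exact: (integrable_normr (integrable_subr i1 i2)).
  apply: (ge0_integral_ae_le mN' (gaussian_null x xi0 mN N0)) => //.
  - move=> u; rewrite lee_fin /bnd; apply: addr_ge0; first by rewrite !mulr_ge0.
    by rewrite mulr_ge0 ?mulr_ge0// indicE ler0n.
  move=> u /= /close h; rewrite lee_fin -mulrBr !normrM (ger0_norm xi'0) /bnd.
  have h2 := ler_wpM2l (mulr_ge0 xi'0 (normr_ge0 (dot u v))) h.
  by apply: le_trans h2 _; rewrite le_eqVlt; apply/orP; left; apply/eqP; ring.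
have -> : \int[Gam]_u bnd u = xi^-1 * eps * \int[Gam]_u `|dot u v| +
    xi^-1 * (2 * B) * \int[Gam]_u (`|dot u v| * \1_U (x + xi *: u)).
  rewrite -(RintegralZl _ measurableT ia) -(RintegralZl _ measurableT ib) -RintegralD//.
    exact: (integrable_scaler _ ia).
  exact: (integrable_scaler _ ib).
rewrite [leRHS]mulrDl; apply: lerD.
  by rewrite ler_wpM2l ?mulr_ge0// abs_moment_le.
rewrite -[leRHS]mulrA; apply: ler_wpM2l; first by rewrite !mulr_ge0.
by apply: le_trans (indic_moment_le x v) _; rewrite -/kap mulrAC.
Qed.

End bias.

End kernels.

(** * Measurability of the hyperfunction *)
Section ae_continuity.
Context {R : realType} (n : nat).
Local Notation lam := (lebesgue_rV n : {sigma_finite_measure set 'rV[R]_n -> \bar R}).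

Lemma compact_measurable_rV (X : set 'rV[R]_n) : compact X -> measurable X.
Proof.
move=> cX; rewrite -[X]setCK; apply: measurableC; apply: open_measurable_rV.
by rewrite openC; apply: compact_closed => //; exact: norm_hausdorff.
Qed.

(** Off the null set [N], the preimage of an open set is relatively open in
    [X]. *)
Lemma measurable_ae_continuous (X N : set 'rV[R]_n) (phi : 'rV[R]_n -> R) (c : R) :
  measurable X -> measurable N ->
  (forall x, X x -> ~ N x -> phi @ within X (nbhs x) --> phi x) ->
  measurable_fun setT (fun z => if z \in N then 0 else if z \in X then phi z else c).
Proof.
move=> mX mN cphi; apply: (measurability _ (measurable_realfun.RGenOpens.measurableE R)).
move=> _ [_ [a [b ->] <-]]; rewrite setTI.
set V := `]a, b[%classic.
have oV : open V by exact: interval_open.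
pose O := interior [set x | X x -> V (phi x)].
have mO : measurable O by apply: open_measurable_rV; exact: open_interior.
have mcst (p : Prop) : measurable [set z : 'rV[R]_n | p].
  have [hp|hp] := pselect p.
    by rewrite (_ : [set _ | _] = setT)//; apply/seteqP; split.
  by rewrite (_ : [set _ | _] = set0)//; apply/seteqP; split.
rewrite (_ : _ @^-1` V = (N `&` [set _ | V 0]) `|` ((X `\` N) `&` O) `|`
   ((~` X `\` N) `&` [set _ | V c])).
  by apply: measurableU; [apply: measurableU|]; apply: measurableI => //;
    apply: measurableD => //; exact: measurableC.
apply/seteqP; split => z /=.
- case: (boolP (z \in N)) => [|/negP]; first by rewrite inE => Nz V0; left; left.
  rewrite inE => Nz; case: (boolP (z \in X)) => [|/negP]; rewrite inE => Xz Vz; last by right.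
  left; right; split => //; rewrite /O /interior /=.
  have : nbhs (phi z) V by exact: open_nbhs_nbhs.
  by move=> /(cphi z Xz Nz).
- move=> [[[Nz V0]|[[Xz Nz] Oz]]|[[Xz Nz] Vc]].
  + by rewrite (mem_set Nz).
  + by rewrite (memNset Nz) (mem_set Xz); exact: (interior_subset Oz).
  + by rewrite (memNset Nz) (memNset Xz).
Qed.

Lemma cvg_within_graph m (X : set 'rV[R]_n) (f : 'rV[R]_n -> 'rV[R]_m -> R)
    (s : 'rV[R]_n -> 'rV[R]_m) x :
  {within [set p : 'rV[R]_n * 'rV[R]_m | X p.1], continuous (fun p => f p.1 p.2)} ->
  X x -> s @ within X (nbhs x) --> s x ->
  (fun z => f z (s z)) @ within X (nbhs x) --> f x (s x).
Proof.
move=> /subspace_continuousP/(_ (x, s x)) cf Xx cs V nV.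
have /= [[Q1 Q2] /= [nQ1 nQ2] hQ] := cf Xx V nV.
have nQ2' : within X (nbhs x) (s @^-1` Q2) by exact: cs.
rewrite /nbhs /= /within /=; near=> z => Xz.
apply: (hQ (z, s z)) => //; split => /=.
  by near: z.
by move: Xz; near: z.
Unshelve. all: by end_near. Qed.

End ae_continuity.

(** * Volume of a neighbourhood of a set of small Minkowski dimension *)
Section minkowski.
Context {R : realType} (n : nat).
Local Notation lam := (lebesgue_rV n : {sigma_finite_measure set 'rV[R]_n -> \bar R}).
Implicit Types (A X : set 'rV[R]_n) (c : 'rV[R]_n) (r : R).

Lemma measurable_enorm_ball c r : measurable [set z : 'rV[R]_n | enorm (z - c) <= r].
Proof.
have m : measurable_fun setT (fun z : 'rV[R]_n => enorm (z - c)).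
  by apply: measurable_enorm; apply: measurable_rVD => //; exact: measurable_cst.
rewrite (_ : [set _ | _] = (fun z : 'rV[R]_n => enorm (z - c)) @^-1` `]-oo, r]%classic).
  by rewrite -[X in measurable X]setTI; exact: m.
by apply/seteqP; split => z /=; rewrite in_itv.
Qed.

(** The Gaussian density is bounded below on a ball, and its total mass is one. *)
Lemma lebesgue_unit_ball_lty :
  exists V : R, 0 <= V /\ (lam [set z : 'rV[R]_n | (enorm z <= 1)%R] <= V%:E)%E.
Proof.
set U := [set _ | _].
pose k : R := (2 * pi) `^ (- (n%:R / 2)) * expR (- (1 / 2)).
have k0 : 0 < k by rewrite mulr_gt0 ?expR_gt0// powR_gt0// mulr_gt0// pi_gt0.
have kn : k != 0 by rewrite gt_eqF.
have mU : measurable U.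
  rewrite (_ : U = [set z | enorm (z - 0) <= 1]); first exact: measurable_enorm_ball.
  by apply/seteqP; split => z /=; rewrite subr0.
exists k^-1; split; first by rewrite invr_ge0 ltW.
rewrite -[lam U]mul1e -(mulVf kn) EFinM -muleA -[leRHS]mule1.
apply: lee_wpmul2l; first by rewrite lee_fin invr_ge0 ltW.
rewrite -(@integral_gauss R n) -[in leLHS](setIT U) -integral_indic// -ge0_integralZl//; last first.
- by rewrite lee_fin ltW.
- by apply/measurable_EFinP; exact: measurable_indic.
apply: ge0_le_integral => //.
- by move=> z _; rewrite -EFinM lee_fin mulr_ge0// ?(ltW k0)// indicE ler0n.
- by apply: emeasurable_funM => //; apply/measurable_EFinP; exact: measurable_indic.
- by apply/measurable_EFinP; exact: measurable_gauss.
move=> z _; rewrite -EFinM lee_fin indicE; case: (boolP (z \in U)) => [|_]; last first.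
  by rewrite mulr0 gauss_ge0.
rewrite inE /U /= => z1; rewrite mulr1 /gauss expr1n !mulr1 ler_wpM2l ?powR_ge0// ler_expR lerN2.
by rewrite ler_wpM2r// exprn_ile1// enorm_ge0.
Qed.

Lemma lebesgue_ball c r : 0 < r ->
  lam [set z : 'rV[R]_n | (enorm (z - c) <= r)%R] =
  ((r ^+ n)%:E * lam [set z : 'rV[R]_n | (enorm z <= 1)%R])%E.
Proof.
move=> r0; rewrite (lebesgue_affine c r0 (measurable_enorm_ball c r)); congr (_ * _)%E.
have m1 : measurable [set z : 'rV[R]_n | enorm z <= 1].
  rewrite (_ : [set z : 'rV[R]_n | enorm z <= 1] = [set z | enorm (z - 0) <= 1]).
    exact: measurable_enorm_ball.
  by apply/seteqP; split => z /=; rewrite subr0.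
rewrite -[in RHS](setIT [set z : 'rV[R]_n | enorm z <= 1]) -integral_indic//.
apply: eq_integral => u _; rewrite !indicE; congr ((nat_of_bool _)%:R%:E).
apply: asbool_equiv_eq => /=.
by rewrite addrKl enormZ gtr0_norm// -ler_pdivlMl// mulVf ?gt_eqF.
Qed.

(** Makes the set of admissible numbers of balls nonempty, since the infimum of the
    empty set is zero by convention. *)
Lemma compact_covering X r : compact X -> 0 < r ->
  exists (k : nat) (c : 'I_k -> 'rV[R]_n), forall z, X z -> exists i, enorm (z - c i) <= r.
Proof.
move=> cX r0; pose r' := r / n.+1%:R.
have r'0 : 0 < r' by rewrite divr_gt0.
move: cX; rewrite compact_cover => /(_ 'rV[R]_n setT (fun c => ball c r')) h.
have [|z _|D _ cov] := h.
- by move=> c _; exact: ball_open.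
- by exists z => //; exact: ballxx.
exists (size (enum_fset D)), (fun i => nth 0 (enum_fset D) i) => z /cov[c /= cD bz].
have ci : (index c (enum_fset D) < size (enum_fset D))%N by rewrite index_mem.
exists (Ordinal ci); rewrite /= nth_index//.
apply: le_trans (enorm_le_normr _) _.
move: bz; rewrite -ball_normE /= distrC => /ltW bz.
apply: (@le_trans _ _ (n.+1%:R * r')); last by rewrite /r' mulrC divfK.
by apply: ler_pM => //; rewrite ler_nat.
Qed.

(** The infimum that defines the covering number is approached within [1], which
    at most doubles it because a nonempty set needs at least one ball. *)
Lemma near_covering A X (d : R) : compact X -> A `<=` X -> A !=set0 ->
  upper_minkowski_dim A = d%:E -> d < n%:R ->
  exists2 r0 : R, 0 < r0 & forall r, 0 < r -> r < r0 ->
    exists (k : nat) (c : 'I_k -> 'rV[R]_n),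
      k%:R <= 2 * r `^ (- ((n%:R + d) / 2)) /\
      forall z, A z -> exists i, enorm (z - c i) <= r.
Proof.
move=> cX AX A0 dimA dn.
have : (upper_minkowski_dim A < ((n%:R + d) / 2)%:E)%E by rewrite dimA lte_fin; lra.
move=> /ereal_inf_lt[_ [W W0 <-] sW].
have [r1 /= r10 hW] := W0.
exists (Num.min r1 1); first by rewrite lt_min r10 ltr01.
move=> r r0; rewrite lt_min => /andP[rr1 r1'].
have Wr : W r.
  by apply: hW => //=; rewrite sub0r normrN gtr0_norm.
set s := (n%:R + d) / 2 in sW *.
have lnr : 0 < - ln r by rewrite oppr_gt0 ln_lt0// r0.
pose S := [set (k%:R : R) | k in [set k : nat | exists c : 'I_k -> 'rV[R]_n,
    forall z, A z -> exists i, enorm (z - c i) <= r]].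
have S1 : lbound S 1.
  move=> _ [k [c kc] <-]; case: A0 => z /kc[i _].
  by rewrite ler1n (leq_ltn_trans _ (ltn_ord i)).
have SN : S !=set0.
  have [k [c kc]] := compact_covering cX r0.
  by exists k%:R, k => //; exists c => z /AX; exact: kc.
have N1 : 1 <= covering_number A r by exact: lb_le_inf.
have [_ [k [c kc] <-] kN] := inf_adherent ltr01 (conj SN (ex_intro _ 1 S1)).
exists k, c; split => //.
have hN : ln (covering_number A r) / - ln r < s.
  by rewrite -lte_fin; apply: le_lt_trans sW; apply: ereal_sup_ubound; exists r.
have N2 : covering_number A r <= r `^ (- s).
  rewrite /powR gt_eqF// -[leLHS]lnK ?ler_expR; last by rewrite posrE (lt_le_trans ltr01).
  by rewrite mulNr -mulrN ltW// -ltr_pdivrMr.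
apply: ltW; apply: lt_le_trans kN _.
rewrite -/(covering_number A r).
apply: (@le_trans _ _ (2 * covering_number A r)); first by lra.
by rewrite ler_wpM2l.
Qed.

Lemma near_dist (x : 'rV[R]_n) A (r : R) : 0 < r -> (dist x A <= r%:E)%E ->
  exists2 z, A z & enorm (x - z) < 2 * r.
Proof.
move=> r0 h; have : (dist x A < (2 * r)%:E)%E.
  by apply: le_lt_trans h _; rewrite lte_fin; lra.
by move=> /ereal_inf_lt[_ [z Az <-]]; rewrite lte_fin => ?; exists z.
Qed.

Lemma covered_volume (k : nat) (c : 'I_k -> 'rV[R]_n) (r : R) (V : R) : 0 < r ->
  (lam [set z : 'rV[R]_n | (enorm z <= 1)%R] <= V%:E)%E ->
  (lam (\big[setU/set0]_(i < k) [set z : 'rV[R]_n | (enorm (z - c i) <= r)%R]) <=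
   (k%:R * (r ^+ n * V))%:E)%E.
Proof.
move=> r0 hV; pose f i : set 'rV[R]_n :=
  if insub i is Some j then [set z : 'rV[R]_n | enorm (z - c j) <= r] else set0.
have -> : \big[setU/set0]_(i < k) [set z : 'rV[R]_n | enorm (z - c i) <= r] =
    \big[setU/set0]_(i < k) f i.
  by apply: eq_bigr => i _; rewrite /f valK.
have mf i : measurable (f i).
  by rewrite /f; case: insub => [j|]//; exact: measurable_enorm_ball.
apply: le_trans (Boole_inequality lam (fun i _ => mf i)) _.
apply: (@le_trans _ _ (\sum_(i < k) (r ^+ n * V)%:E)%E); last first.
  by rewrite sumEFin lee_fin sumr_const card_ord -[leLHS]mulr_natl.
have hb i : (lam [set z : 'rV[R]_n | (enorm (z - c i) <= r)%R] <= (r ^+ n * V)%:E)%E.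
  by rewrite lebesgue_ball// EFinM lee_wpmul2l// lee_fin exprn_ge0// ltW.
by apply: lee_sum => i _; rewrite /f valK; exact: hb.
Qed.

(** A set covered by [r ^ (-s)] balls of radius [r] has its [r]-neighbourhood
    covered by as many balls of radius [3 r]; here [s] is taken halfway between
    the dimension and [n]. *)
Lemma minkowski_nbhd A X (d : R) : compact X -> A `<=` X ->
  upper_minkowski_dim A = d%:E -> d < n%:R ->
  exists (C r0 : R), [/\ 0 <= C, 0 < r0 & forall r, 0 < r -> r < r0 ->
    exists U, [/\ measurable U, (lam U <= (C * r `^ ((n%:R - d) / 2))%:E)%E &
      forall x, (dist x A <= r%:E)%E -> U x]].
Proof.
move=> cX AX dimA dn; have [A0|A0] := pselect (A !=set0); last first.
  exists 0, 1; split => // r r0 _; exists set0; split => //.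
    by rewrite measure0 mul0r.
  by move=> x /(near_dist r0)[z Az _]; apply: A0; exists z.
have [r0 r00 h] := near_covering cX AX A0 dimA dn.
have [V [V0 hV]] := lebesgue_unit_ball_lty.
exists (2 * 3 ^+ n * V), r0; split => //; first by rewrite !mulr_ge0// exprn_ge0.
move=> r rp /(h r rp)[k [c [kr kc]]].
exists (\big[setU/set0]_(i < k) [set z : 'rV[R]_n | enorm (z - c i) <= 3 * r]); split.
- by apply: bigsetU_measurable => i _; exact: measurable_enorm_ball.
- have r3 : 0 < 3 * r by rewrite mulr_gt0.
  apply: le_trans (covered_volume c r3 hV) _.
  rewrite lee_fin.
  have -> : (n%:R - d) / 2 = - ((n%:R + d) / 2) + n%:R by lra.
  rewrite powRD; last by apply/implyP => _; rewrite gt_eqF.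
  rewrite powR_mulrn ?(ltW rp)// exprMn.
  have W0 : 0 <= 3 ^+ n * r ^+ n * V by rewrite !mulr_ge0// exprn_ge0// ltW.
  apply: le_trans (ler_wpM2r W0 kr) _.
  by rewrite le_eqVlt; apply/orP; left; apply/eqP; ring.
- move=> x /(near_dist rp)[z /kc[i zi] xz]; rewrite (bigD1 i)//=; left => /=.
  have -> : x - c i = (x - z) + (z - c i) by rewrite addrA subrK.
  apply: le_trans (enormD _ _) _; lra.
Qed.

End minkowski.

(** * The bias of the inexact gradient *)
Lemma crude_bound (R : realDomainType) (a b c e1 e2 e3 : R) :
  a <= c -> b <= c -> 2 * c <= e3 -> 0 <= e1 -> 0 <= e2 -> a + b <= e1 + (e2 + e3).
Proof. lra. Qed.

Section null_set.
Context {R : realType} (n : nat).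
Local Notation lam := (lebesgue_rV n : {sigma_finite_measure set 'rV[R]_n -> \bar R}).

Lemma powR_small (C s r0 e : R) : 0 <= C -> 0 < s -> 0 < r0 -> 0 < e ->
  exists r, [/\ 0 < r, r < r0 & C * r `^ s <= e].
Proof.
move=> C0 s0 r00 e0; pose q := (e / (C + 1)) `^ (s^-1).
have C1 : 0 < C + 1 by rewrite ltr_wpDl.
have q0 : 0 < q by apply: powR_gt0; exact: divr_gt0.
have r2 : 0 < r0 / 2 by rewrite divr_gt0.
exists (Num.min (r0 / 2) q); split; first by rewrite lt_min r2 q0.
  by rewrite gt_min ltr_pdivrMr// mulr2n mulrDr mulr1 ltrDl r00.
have h : Num.min (r0 / 2) q `^ s <= e / (C + 1).
  have -> : e / (C + 1) = q `^ s.
    by rewrite /q -powRrM mulVf ?gt_eqF// powRr1// ltW// divr_gt0.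
  apply: ge0_ler_powR; rewrite ?nnegrE ?(ltW s0)// ?(ltW q0)//.
    by rewrite le_min (ltW r2) (ltW q0).
  by rewrite ge_min lexx orbT.
apply: le_trans (ler_wpM2l C0 h) _.
by rewrite mulrCA ler_piMr ?(ltW e0)// ler_pdivrMr// mul1r lerDl.
Qed.

(** Intersect the neighbourhoods of volume at most [1 / (k + 1)]. *)
Lemma null_of_small_volume (A : set 'rV[R]_n) :
  (forall e : R, 0 < e -> exists U, [/\ measurable U, (lam U <= e%:E)%E & A `<=` U]) ->
  exists N, [/\ measurable N, lam N = 0%E & A `<=` N].
Proof.
move=> h; have {}h k : exists U, [/\ measurable U, (lam U <= (k.+1%:R^-1 : R)%:E)%E & A `<=` U].
  by apply: h; rewrite invr_gt0.
pose U k := sval (cid (h k)).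
have [mU lU AU] : [/\ forall k, measurable (U k),
    forall k, (lam (U k) <= (k.+1%:R^-1 : R)%:E)%E & forall k, A `<=` U k].
  by split=> k; rewrite /U; case: cid => V [].
exists (\bigcap_k U k); split; first exact: bigcapT_measurable.
- apply/eqP; rewrite eq_le measure_ge0 andbT.
  apply/lee_addgt0Pr => e e0; rewrite add0e.
  have [k ke] : exists k : nat, k.+1%:R^-1 < e.
    have [k _ /(_ k (leqnn k)) hk] := near_infty_natSinv_lt (PosNum e0).
    by exists k.
  apply: (@le_trans _ _ (lam (U k))).
    by apply: le_measure; rewrite ?inE//; [exact: bigcapT_measurable|exact: bigcap_inf].
  by apply: le_trans (lU k) _; rewrite lee_fin ltW.
- by move=> x Ax k _; exact: AU.
Qed.

Lemma enorm_row_mxB m (x : 'rV[R]_n) (y y' : 'rV[R]_m) :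
  enorm (row_mx x y - row_mx x y') = enorm (y - y').
Proof.
rewrite opp_row_mx add_row_mx subrr /enorm; congr Num.sqrt.
rewrite big_split_ord /= big1 ?add0r.
  by apply: eq_bigr => i _; rewrite row_mxEr.
by move=> i _; rewrite row_mxEl mxE expr0n.
Qed.

Lemma dist_self (x : 'rV[R]_n) (A : set 'rV[R]_n) (r : R) : 0 <= r -> A x -> (dist x A <= r%:E)%E.
Proof.
move=> r0 Ax; apply: (@le_trans _ _ 0%E) => //.
by apply: ereal_inf_lbound; exists x => //; rewrite subrr enorm0.
Qed.

Lemma accumulation_closed m (y : nat -> 'rV[R]_m) (S : set 'rV[R]_m) z :
  closed S -> (forall k, S (y k)) -> accumulation_points y z -> S z.
Proof.
move=> cS yS zacc; apply: cS => B nB; apply: (zacc _ _ _ nB).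
by exists 0%N => // k _; exact: yS.
Qed.

End null_set.

Section hyperfunction.
Context {R : realType} (n m : nat).
Variables (X : set 'rV[R]_n) (f g : 'rV[R]_n -> 'rV[R]_m -> R) (y0 : 'rV[R]_m).
Variables (Lg Lgg Lf glow g0bar fbar d : R) (Y Y' : set 'rV[R]_m).
Variables (mu : R -> R) (alpha : R -> R -> R) (xi : R).
Local Notation lam := (lebesgue_rV n : {sigma_finite_measure set 'rV[R]_n -> \bar R}).
Hypothesis m0 : (0 < m)%N.
Hypothesis contf : {within [set p : 'rV[R]_n * 'rV[R]_m | X p.1],
  continuous (fun p => f p.1 p.2)}.
Hypothesis smoothg : exists W : set 'rV[R]_(n + m), [/\ open W,
  (forall x y, X x -> W (row_mx x y)) & C2_on W (joint g)].
Hypothesis cptX : compact X.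
Hypothesis lipg : forall x x' y y', X x -> X x' ->
  enorm (grad (joint g) (row_mx x y) - grad (joint g) (row_mx x' y')) <=
  Lg * enorm (row_mx x y - row_mx x' y').
Hypothesis Lgg0 : 0 < Lgg.
Hypothesis liph : forall x x' y y', X x -> X x' ->
  opnorm (hess (g x) y - hess (g x') y') <= Lgg * enorm (row_mx x y - row_mx x' y').
Hypothesis glowP : forall x y, X x -> glow <= g x y.
Hypothesis sublevel : forall x, X x -> compact [set y | g x y <= g x y0] /\
  [set y | g x y <= g x y0] `<=` Y.
Hypothesis lipf : forall x x' y y', X x -> X x' -> g x y <= g x y0 -> g x' y' <= g x' y0 ->
  `|f x y - f x' y'| <= Lf * enorm (row_mx x y - row_mx x' y').
Hypothesis g0barP : forall x, X x -> g x y0 <= g0bar.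
Hypothesis fbarP : forall x y, X x -> g x y <= g x y0 -> `|f x y| <= fbar.
Hypothesis dimB : upper_minkowski_dim (bifurcation X g) = d%:E.
Hypothesis dn : d < n%:R.
Hypothesis muP : forall delta : R, 0 < delta -> 0 < mu delta /\
  forall x y l, (X `\` bifurcation_nbhd X g delta) x -> Y' y ->
    grad (g x) y = 0 -> eigenvalue (hess (g x) y) l -> mu delta <= `|l|.
Hypothesis alphaP : forall delta r : R, 0 < delta -> 0 < r -> 0 < alpha delta r /\
  forall x y, (X `\` bifurcation_nbhd X g delta) x -> Y y ->
    (r%:E < dist y [set y' | Y' y' /\ (grad (g x) y' = 0)%R])%E ->
    alpha delta r <= enorm (grad (g x) y).
Hypothesis xi0 : 0 < xi.

Let hessL x : X x -> hess_lipschitz (g x) Lgg.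
Proof. by have [W [_ WX C2W]] := smoothg; exact: (hess_lipschitz_slice WX C2W lipg Lgg0 liph). Qed.

Section newton_outputs.
Variables (ys : 'rV[R]_n -> nat -> 'rV[R]_m) (ycd : 'rV[R]_n -> 'rV[R]_m).
Hypothesis newt : forall x, X x -> cubic_newton Lgg (g x) y0 (ys x).
Hypothesis acc : forall x, X x -> accumulation_points (ys x) (ycd x).

Lemma newton_sublevel x k : X x -> g x (ys x k) <= g x y0.
Proof. by move=> Xx; exact: (newton_le0 m0 Lgg0 (hessL Xx) (newt Xx)). Qed.

Lemma accumulation_sublevel x : X x -> g x (ycd x) <= g x y0.
Proof.
move=> Xx; have cS : closed [set y | g x y <= g x y0].
  by apply: compact_closed; [exact: norm_hausdorff|have [] := sublevel Xx].
apply: (accumulation_closed cS _ (acc Xx)) => k; exact: newton_sublevel.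
Qed.

Lemma extend_bounded (s : 'rV[R]_n -> 'rV[R]_m) z :
  (forall x, X x -> g x (s x) <= g x y0) -> `|extend X fbar f z (s z)| <= `|fbar|.
Proof.
move=> hs; rewrite /extend; case: ifPn => [|_]//; rewrite inE => Xz.
by apply: le_trans (fbarP Xz (hs _ Xz)) (ler_norm _).
Qed.

Lemma newton_close (rho delta : R) (K k : nat) x :
  0 < rho -> 0 < delta -> steps_bound g0bar glow Lgg mu alpha rho delta < K%:R ->
  X x -> ~ bifurcation_nbhd X g delta x -> best_index Lgg (g x) (ys x) K k ->
  `|f x (ys x k) - f x (ycd x)| <= `|Lf| * (2 * rho).
Proof.
move=> rho0 del0 hK Xx nx kbest.
have [mu0 heig] := muP del0.
have r0 : 0 < mu delta / (2 * Lgg) by rewrite divr_gt0// mulr_gt0.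
have [al0 hal] := alphaP del0 r0.
have hd : enorm (ys x k - ycd x) <= 2 * rho.
  apply: (newton_accuracy m0 Lgg0 (hessL Xx) (newt Xx) _ _ rho0 mu0 al0 _ _ hK kbest (acc Xx)).
  - by move=> z; exact: glowP.
  - exact: g0barP.
  - by move=> z l; exact: heig.
  - by move=> z hz; apply: hal => //; exact: (sublevel Xx).2.
apply: le_trans (lipf Xx Xx (newton_sublevel _ Xx) (accumulation_sublevel Xx)) _.
rewrite enorm_row_mxB; apply: (@le_trans _ _ (`|Lf| * enorm (ys x k - ycd x))).
  by rewrite ler_wpM2r ?enorm_ge0// ler_norm.
by rewrite ler_wpM2l.
Qed.

End newton_outputs.

Lemma bifurcation_null : exists N, [/\ measurable N, lam N = 0%E & bifurcation X g `<=` N].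
Proof.
have sub : bifurcation X g `<=` X by move=> x [].
have [C [r0 [C0 r00 hU]]] := minkowski_nbhd cptX sub dimB dn.
apply: null_of_small_volume => e e0.
have s0 : 0 < (n%:R - d) / 2 by rewrite divr_gt0// subr_gt0.
have [r [rp rr0 Cr]] := powR_small C0 s0 r00 e0.
have [U [mU lU UP]] := hU r rp rr0.
exists U; split => //; first by apply: le_trans lU _; rewrite lee_fin.
by move=> x Bx; apply: UP; exact: dist_self (ltW rp) Bx.
Qed.

(** The hyperfunction is continuous relative to [X] off a null set and constant
    outside [X]. *)
Lemma hyperfunction_measurable (ys : 'rV[R]_n -> nat -> 'rV[R]_m) (ycd : 'rV[R]_n -> 'rV[R]_m) :
  (forall x, X x -> cubic_newton Lgg (g x) y0 (ys x)) ->
  (forall x, X x -> accumulation_points (ys x) (ycd x)) ->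
  lam.-negligible [set x | (X `\` bifurcation X g) x /\ ~ (ycd @ within X (nbhs x) --> ycd x)] ->
  exists (phi : 'rV[R]_n -> R) (N : set 'rV[R]_n), [/\ measurable_fun setT phi,
    (forall z, `|phi z| <= `|fbar|), measurable N, lam N = 0%E &
    forall z, ~ N z -> extend X fbar f z (ycd z) = phi z].
Proof.
move=> newt acc [N1 [mN1 N10 hN1]].
have [N2 [mN2 N20 hN2]] := bifurcation_null.
exists (fun z => if z \in N1 `|` N2 then 0 else if z \in X then f z (ycd z) else fbar), (N1 `|` N2).
split.
- apply: measurable_ae_continuous; [exact: compact_measurable_rV|exact: measurableU|].
  move=> x Xx nN; apply: (cvg_within_graph contf Xx).
  apply: contrapT => nc; apply: nN; have [Bx|nB] := pselect (bifurcation X g x).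
    by right; exact: hN2.
  by left; apply: hN1.
- move=> z; case: ifP => _; first by rewrite normr0.
  exact: (extend_bounded z (accumulation_sublevel newt acc)).
- exact: measurableU.
- exact: null_set_setU.
- by move=> z nz; rewrite (memNset nz).
Qed.

(** Away from the bifurcation set the two integrands differ by a multiple of
    [rho]; near it they are bounded and the volume is controlled by the
    Minkowski dimension.  Radii [delta] too large for the covering estimate are
    absorbed by the crude bound on both gradients. *)
Lemma inexact_gradient_bias : exists D1 D2 : R, [/\ 0 <= D1, 0 <= D2 &
  forall (ys : 'rV[R]_n -> nat -> 'rV[R]_m) (kstar : 'rV[R]_n -> nat)
    (ycd : 'rV[R]_n -> 'rV[R]_m) (K : nat) (rho delta : R)
    (phi psi : 'rV[R]_n -> R) (N N' : set 'rV[R]_n),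
  (forall x, X x -> cubic_newton Lgg (g x) y0 (ys x)) ->
  (forall x, X x -> accumulation_points (ys x) (ycd x)) ->
  (forall x, X x -> best_index Lgg (g x) (ys x) K (kstar x)) ->
  0 < rho -> 0 < delta -> steps_bound g0bar glow Lgg mu alpha rho delta < K%:R ->
  measurable_fun setT phi -> measurable_fun setT psi ->
  (forall z, `|phi z| <= `|fbar|) -> (forall z, `|psi z| <= `|fbar|) ->
  measurable N -> lam N = 0%E -> measurable N' -> lam N' = 0%E ->
  (forall z, ~ N z -> extend X fbar f z (ycd z) = phi z) ->
  (forall z, ~ N' z -> extend X fbar f z (ys z (kstar z)) = psi z) ->
  forall x, enorm (ggrad xi psi x - ggrad xi phi x) <= bias_bound n d D1 D2 rho delta].
Proof.
have sub : bifurcation X g `<=` X by move=> x [].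
have [C [r0 [C0 r00 hU]]] := minkowski_nbhd cptX sub dimB dn.
set s := (n%:R - d) / 2 in hU.
have s0 : 0 < s by rewrite divr_gt0// subr_gt0.
pose kap : R := (2 * pi) `^ (- (n%:R / 2)).
have kap0 : 0 <= kap by exact: powR_ge0.
pose B := `|fbar|.
have B0 : 0 <= B by exact: normr_ge0.
have xi'0 : 0 <= xi^-1 by rewrite invr_ge0 ltW.
have xn0 : 0 <= (xi ^+ n)^-1 by rewrite invr_ge0 exprn_ge0// ltW.
pose D1 := xi^-1 * (`|Lf| * 2).
pose D2a := xi^-1 * (2 * B) * (kap * ((xi ^+ n)^-1 * C)).
(* Both smoothed gradients are at most B / xi, and delta ^ s >= r0 ^ s when delta >= r0. *)
pose D2b := 2 * (B / xi) / r0 `^ s.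
have D10 : 0 <= D1 by rewrite !mulr_ge0.
have D2a0 : 0 <= D2a by rewrite !mulr_ge0.
have D2b0 : 0 <= D2b by rewrite !mulr_ge0// invr_ge0 powR_ge0.
exists D1, (D2a + D2b); split => //; first by rewrite addr_ge0.
move=> ys kstar ycd K rho delta phi psi N N' newt acc best rho0 del0 hK mphi mpsi phiB psiB
  mN N0 mN' N'0 phiE psiE x.
rewrite /bias_bound -/s.
have P0 : 0 <= delta `^ s by exact: powR_ge0.
have [dr|rd] := ltP delta r0; last first.
  have h1 := ggrad_bound xi0 mphi phiB x.
  have h2 := ggrad_bound xi0 mpsi psiB x.
  have h3 : 2 * (B / xi) <= D2b * delta `^ s.
    rewrite /D2b mulrAC ler_pdivlMr ?powR_gt0// ler_wpM2l ?mulr_ge0//.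
    by apply: ge0_ler_powR; rewrite ?nnegrE ?(ltW s0)// ?(ltW r00)// ltW.
  apply: le_trans (enormD _ _) _; rewrite enormN.
  have h4 : 0 <= D1 * rho by rewrite mulr_ge0// ltW.
  have h5 : 0 <= D2a * delta `^ s by rewrite mulr_ge0.
  rewrite -/B in h1 h2.
  rewrite mulrDl; exact: crude_bound h2 h1 h3 h4 h5.
have [U [mU lU UP]] := hU delta del0 dr.
have e0 : 0 <= `|Lf| * (2 * rho) by rewrite !mulr_ge0// ltW.
have close z : ~ (N' `|` N) z -> `|psi z - phi z| <= `|Lf| * (2 * rho) + 2 * B * \1_U z.
  move=> nz; rewrite -psiE; last by move=> h; apply: nz; left.
  rewrite -phiE; last by move=> h; apply: nz; right.
  rewrite indicE; case: (boolP (z \in U)) => [_|]; last first.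
    move/negP; rewrite inE => nU; rewrite mulr0 addr0 /extend.
    case: ifPn => [|_]; last by rewrite subrr normr0.
    rewrite inE => Xz; apply: (newton_close newt acc rho0 del0 hK Xz _ (best _ Xz)).
    by move=> [_ /UP].
  rewrite mulr1; apply: le_trans (ler_normB _ _) _.
  have h1 := extend_bounded z (fun x => newton_sublevel newt (kstar x)).
  have h2 := extend_bounded z (accumulation_sublevel newt acc).
  by rewrite -/B in h1 h2; have -> : 2 * B = B + B by [rewrite mulr_natl mulr2n]; apply: le_trans (lerD h1 h2) _; rewrite lerDr.
have := ggrad_bias xi0 mpsi mphi psiB phiB (measurableU _ _ mN' mN)
  (null_set_setU mN' mN N'0 N0) mU lU e0 close x.
rewrite -/kap -/B => h; apply: le_trans h _.
have -> : xi^-1 * (`|Lf| * (2 * rho)) = D1 * rho by rewrite /D1 !mulrA.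
have -> : xi^-1 * (2 * B) * (kap * ((xi ^+ n)^-1 * (C * delta `^ s))) = D2a * delta `^ s.
  by rewrite /D2a !mulrA.
by rewrite mulrDl lerD2l lerDl mulr_ge0.
Qed.

End hyperfunction.

(** * Independence *)
Section independent_pair.
Context d d1 d2 {Om : measurableType d} {T1 : measurableType d1} {T2 : measurableType d2}.
Context {R : realType} (P : probability Om R).

Definition independent_pair (V1 : Om -> T1) (V2 : Om -> T2) := forall A B,
  measurable A -> measurable B ->
  P (V1 @^-1` A `&` V2 @^-1` B) = (P (V1 @^-1` A) * P (V2 @^-1` B))%E.

(** The joint law of an independent pair is the product of the laws, so that
    Tonelli's theorem computes expectations one variable at a time. *)
Lemma ge0_integral_independent (V1 : Om -> T1) (V2 : Om -> T2) (h : T1 * T2 -> \bar R) :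
  measurable_fun setT V1 -> measurable_fun setT V2 -> independent_pair V1 V2 ->
  measurable_fun setT h -> (forall z, 0 <= h z)%E ->
  (\int[P]_w h (V1 w, V2 w) = \int[P]_w \int[P]_w' h (V1 w, V2 w'))%E.
Proof.
move=> m1 m2 ind mh h0.
pose W1 : {RV P >-> T1} := HB.pack V1 (isMeasurableFun.Build _ _ _ _ _ m1).
pose W2 : {RV P >-> T2} := HB.pack V2 (isMeasurableFun.Build _ _ _ _ _ m2).
have m12 : measurable_fun setT (fun w => (V1 w, V2 w)) by exact: measurable_fun_pair.
pose W : {RV P >-> (T1 * T2)%type} := HB.pack (fun w => (V1 w, V2 w)) (isMeasurableFun.Build _ _ _ _ _ m12).
have -> : (\int[P]_w h (V1 w, V2 w) = \int[distribution P W]_z h z)%E.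
  by rewrite ge0_integral_distribution.
have -> : (\int[distribution P W]_z h z = \int[distribution P W1 \x distribution P W2]_z h z)%E.
  apply: eq_measure_integral => A mA _; apply/esym.
  have := @product_measure_unique _ _ T1 T2 R (distribution P W1) (distribution P W2) (distribution P W).
  apply => // B C mB mC; exact: (ind B C mB mC).
rewrite fubini_tonelli1//= ge0_integral_distribution//; last 2 first.
- exact: measurable_fun_fubini_tonelli_F.
- by move=> y; exact: integral_ge0.
apply: eq_integral => w _ /=; rewrite /fubini_F ge0_integral_distribution//.
exact: measurableT_comp mh (pair1_measurable _).
Qed.

End independent_pair.

Section independent_sigma.
Context d {Om : measurableType d} {R : realType} (P : probability Om R).

(** Independence from a fixed event extends from a family stable under
    intersection to the sigma-algebra that it generates: both sides are finite
    measures of the other event. *)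
Lemma independent_g_sigma (G : set (set Om)) (B : set Om) :
  G `<=` measurable -> setI_closed G -> G setT -> measurable B ->
  (forall A, G A -> P (A `&` B) = (P A * P B)%E) ->
  forall A, <<s G >> A -> P (A `&` B) = (P A * P B)%E.
Proof.
move=> mG GI GT mB h A GA.
have fB : P B \is a fin_num by exact: fin_num_measure.
have b0 : 0 <= fine (P B) by exact: fine_ge0.
have muE C : (P C * P B = mscale (NngNum b0) P C)%E by rewrite /mscale /= fineK// muleC.
have e : mrestr P mB A = mscale (NngNum b0) P A.
  apply: (@g_sigma_algebra_measure_unique _ R Om G mG (fun=> setT) (fun=> GT) _
    (mrestr P mB) (mscale (NngNum b0) P) GI _ _ A GA).
  - by rewrite bigcup_const.
  - by move=> C GC; exact: etrans (h C GC) (muE C).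
  - move=> k; change (P (setT `&` B) < +oo)%E; by rewrite setTI -ge0_fin_numE.
by rewrite muE -e.
Qed.

Context d' {T : measurableType d'} {I : choiceType} (D : set I) (X : I -> Om -> T).
Hypothesis mX : forall i, D i -> measurable_fun setT (X i).
Implicit Types J : {fset I}.

(** A pi-system that generates the sigma-algebra of the subfamily indexed by
    [J]. *)
Definition cylinders J : set (set Om) :=
  [set \bigcap_(i in [set` J]) X i @^-1` A i | A in [set A : I -> set T | forall i, measurable (A i)]].

Lemma cylinders_measurable J : [set` J] `<=` D -> cylinders J `<=` measurable.
Proof.
move=> JD _ [A mA <-]; apply: fin_bigcap_measurable => // i /JD Di.
by rewrite -[X in measurable X]setTI; apply: mX.
Qed.

Lemma cylinders_setI J : setI_closed (cylinders J).
Proof.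
move=> _ _ [A mA <-] [B mB <-]; exists (fun i => A i `&` B i) => [i|].
  exact: measurableI.
by rewrite -bigcapI; apply: eq_bigcapr => i _; rewrite preimage_setI.
Qed.

Lemma cylinders_setT J : cylinders J setT.
Proof.
exists (fun=> setT) => //; apply/seteqP; split => // w _ i _ //.
Qed.

Lemma cylinders_preimage J i A : i \in J -> measurable A -> cylinders J (X i @^-1` A).
Proof.
move=> iJ mA; exists (fun j => if j == i then A else setT) => [j|].
  by case: eqP.
apply/seteqP; split => [w /(_ i iJ)|w Aw j _] /=; first by rewrite eqxx.
by case: eqP => // ->.
Qed.

(** A copy of the sample space: measurability with respect to a sub-sigma-algebra
    becomes measurability on another measurable space, so that product measures
    and Tonelli's theorem apply to it. *)
Definition sub_space J := g_sigma_algebraType (cylinders J).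

Lemma measurable_sub_space J i : i \in J -> measurable_fun setT (X i : sub_space J -> T).
Proof.
move=> iJ _ A mA; rewrite setTI; apply: sub_sigma_algebra; exact: cylinders_preimage.
Qed.

Lemma measurable_to_sub_space J : [set` J] `<=` D -> measurable_fun setT (id : Om -> sub_space J).
Proof.
move=> JD _ A mA; rewrite setTI preimage_id.
exact: (smallest_sub (@sigma_algebra_measurable _ Om) (cylinders_measurable JD)) mA.
Qed.

Lemma independent_disjoint_subfamilies J1 J2 : mutually_independent P D X ->
  [set` J1] `<=` D -> [set` J2] `<=` D -> (forall i, i \in J1 -> i \notin J2) ->
  independent_pair P (id : Om -> sub_space J1) (id : Om -> sub_space J2).
Proof.
move=> ind J1D J2D dis A B mA mB; rewrite !preimage_id.
have mA' := measurable_to_sub_space J1D measurableT mA; rewrite setTI preimage_id in mA'.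
rewrite setIC muleC; apply: (independent_g_sigma (cylinders_measurable J2D)
  (@cylinders_setI J2) (cylinders_setT J2) mA' _ mB) => C cC.
have mC := cylinders_measurable J2D cC.
rewrite setIC muleC; apply: (independent_g_sigma (cylinders_measurable J1D)
  (@cylinders_setI J1) (cylinders_setT J1) mC _ mA) => {A mA mA' B mB} A cA.
case: cA => A1 mA1 <-; case: cC => A2 mA2 <-.
have J12D : [set` (J1 `|` J2)%fset] `<=` D.
  by move=> i /=; rewrite inE => /orP[/J1D|/J2D].
have := ind (J1 `|` J2)%fset (fun i => if i \in J1 then A1 i else A2 i) J12D.
rewrite (ind J1 A1 J1D mA1) (ind J2 A2 J2D mA2).
have -> : \bigcap_(i in [set` (J1 `|` J2)%fset]) X i @^-1` (if i \in J1 then A1 i else A2 i) =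
   \bigcap_(i in [set` J1]) X i @^-1` A1 i `&` \bigcap_(i in [set` J2]) X i @^-1` A2 i.
  apply/seteqP; split => w.
    move=> h; split => i /= iJ.
      by have := h i; rewrite /= inE iJ; apply.
    have := h i; rewrite /= inE iJ orbT; case: ifPn => [/dis|_]; last by apply.
    by rewrite iJ.
  move=> [h1 h2] i /=; rewrite inE; case: ifPn => [iJ _|_ /= iJ]; first exact: h1.
  exact: h2.
move=> -> //; last by move=> i; case: ifP.
rewrite (perm_big (enum_fset J1 ++ enum_fset J2)) /=; last first.
  apply: uniq_perm; rewrite ?fset_uniq// ?cat_uniq ?fset_uniq ?andbT/=.
    by apply/hasPn => i i2; apply/negP => /dis; rewrite i2.
  by move=> i; rewrite mem_cat inE.
rewrite big_cat /=; congr (_ * _)%E; apply: eq_big_seq => i iJ; first by rewrite iJ.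
by case: ifPn => // /dis; rewrite iJ.
Qed.

Lemma independent_of_subfamily d'' (T' : measurableType d'') (Y : Om -> T') J :
  independent_of_family P D X Y -> measurable_fun setT Y -> [set` J] `<=` D ->
  independent_pair P Y (id : Om -> sub_space J).
Proof.
move=> ind mY JD A B mA mB; rewrite preimage_id.
have mA' : measurable (Y @^-1` A) by rewrite -[X in measurable X]setTI; exact: mY.
rewrite setIC muleC; apply: (independent_g_sigma (cylinders_measurable JD)
  (@cylinders_setI J) (cylinders_setT J) mA' _ mB) => C [A1 mA1 <-].
by rewrite setIC muleC; exact: ind.
Qed.

End independent_sigma.

(** * Mean and variance of the estimator *)
Section gaussian_law.
Context d {Om : measurableType d} {R : realType} (P : probability Om R) (n : nat).
Local Notation Gam := (@gaussian R n).
Variable U : Om -> 'rV[R]_n.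
Hypothesis gU : standard_gaussian P U.

Lemma ge0_integral_standard_gaussian (G : 'rV[R]_n -> \bar R) :
  measurable_fun setT G -> (forall u, 0 <= G u)%E ->
  (\int[P]_w G (U w) = \int[Gam]_u G u)%E.
Proof.
move=> mG G0; have [mU PU] := gU.
pose W : {RV P >-> 'rV[R]_n} := HB.pack U (isMeasurableFun.Build _ _ _ _ _ mU).
have -> : (\int[P]_w G (U w) = \int[distribution P W]_z G z)%E.
  by rewrite ge0_integral_distribution.
by apply: eq_measure_integral => A mA _; rewrite [LHS]PU.
Qed.

Lemma integral_standard_gaussian (H : 'rV[R]_n -> R) : measurable_fun setT H ->
  (\int[P]_w (H (U w))%:E = \int[Gam]_u (H u)%:E)%E.
Proof.
move=> mH.
have h := @signed_integral_eq R _ _ _ _ Gam P (cst 1) (cst 1) U (fun _ => ler01) (fun _ => ler01) _ H mH.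
apply/esym; transitivity (\int[Gam]_u (cst 1 u * H u)%:E)%E.
  by apply: eq_integral => u _; rewrite mul1r.
rewrite h; first by apply: eq_integral => u _; rewrite mul1r.
move=> f mf f0; under eq_integral do rewrite mul1e; under [RHS]eq_integral do rewrite mul1e.
by rewrite ge0_integral_standard_gaussian.
Qed.

Lemma integrable_standard_gaussian (H : 'rV[R]_n -> R) :
  Gam.-integrable setT (EFin \o H) -> P.-integrable setT (EFin \o (fun w => H (U w))).
Proof.
move=> iH; have mH := integrable_measurable iH.
apply/integrableP; split.
  by apply/measurable_EFinP; exact: (measurableT_comp mH gU.1).
have /integrableP[_] := iH; apply: le_lt_trans; rewrite le_eqVlt; apply/orP; left; apply/eqP.
rewrite -ge0_integral_standard_gaussian//.
by apply: measurableT_comp => //; exact/measurable_EFinP.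
Qed.

Lemma Rintegral_standard_gaussian (H : 'rV[R]_n -> R) : measurable_fun setT H ->
  \int[P]_w H (U w) = \int[Gam]_u H u.
Proof. by move=> mH; rewrite /Rintegral integral_standard_gaussian. Qed.

Lemma standard_gaussian_null (x : 'rV[R]_n) (xi : R) (N : set 'rV[R]_n) : 0 < xi ->
  measurable N -> lebesgue_rV n N = 0%E -> P ((fun w => x + xi *: U w) @^-1` N) = 0%E.
Proof.
move=> xi0 mN N0; have [_ PU] := gU.
have mA : measurable ((fun u : 'rV[R]_n => x + xi *: u) @^-1` N).
  by rewrite -[X in measurable X]setTI; exact: measurable_affine.
by have := gaussian_null x xi0 mN N0; rewrite /gaussian -(PU _ mA).
Qed.

End gaussian_law.

Lemma dot_suml (R : realType) n (I : Type) (r : seq I) (F : I -> 'rV[R]_n) (u : 'rV[R]_n) :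
  dot (\sum_(i <- r) F i) u = \sum_(i <- r) dot (F i) u.
Proof. by rewrite dotC dot_sumr; apply: eq_bigr => i _; rewrite dotC. Qed.

Section second_moment.
Context d {Om : measurableType d} {R : realType} (P : probability Om R).

Lemma integral_sqr_shift d' (T : measurableType d') (Q : probability T R) (b : T -> R) (c : R) :
  Q.-integrable setT (EFin \o b) -> Q.-integrable setT (EFin \o (fun u => b u ^+ 2)) ->
  \int[Q]_u b u = 0 ->
  (\int[Q]_u ((c + b u) ^+ 2)%:E = (c ^+ 2 + \int[Q]_u (b u ^+ 2))%:E)%E.
Proof.
move=> ib ib2 b0.
have -> : (fun u => ((c + b u) ^+ 2)%:E) = EFin \o (fun u => c ^+ 2 + (2 * c * b u + b u ^+ 2)).
  by apply/funext => u /=; congr EFin; ring.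
have ic := integrable_cst1 Q (c ^+ 2).
have i2 := integrable_scaler (2 * c) ib.
rewrite Rintegral_EFin; last exact: (integrable_addr ic (integrable_addr i2 ib2)).
rewrite (RintegralD measurableT ic (integrable_addr i2 ib2)) Rintegral_cst1.
by rewrite (RintegralD measurableT i2 ib2) (RintegralZl _ measurableT ib) b0 mulr0 add0r.
Qed.

(** Second moments add when the second summand is centred and independent of
    the first; conditioning on the first summand avoids the cross term. *)
Lemma second_moment_add d1 d2 (T1 : measurableType d1) (T2 : measurableType d2)
    (V1 : Om -> T1) (V2 : Om -> T2) (s : T1 -> R) (b : T2 -> R) (v : R) :
  measurable_fun setT V1 -> measurable_fun setT V2 -> independent_pair P V1 V2 ->
  measurable_fun setT s -> measurable_fun setT b -> 0 <= v ->
  (forall c, \int[P]_w ((c + b (V2 w)) ^+ 2)%:E = (c ^+ 2 + v)%:E)%E ->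
  (\int[P]_w ((s (V1 w) + b (V2 w)) ^+ 2)%:E = \int[P]_w (s (V1 w) ^+ 2)%:E + v%:E)%E.
Proof.
move=> m1 m2 ind ms mb v0 hv.
pose h (z : T1 * T2) := ((s z.1 + b z.2) ^+ 2)%:E.
have mh : measurable_fun setT h.
  apply/measurable_EFinP; apply: measurable_funX; apply: measurable_funD.
    exact: (measurableT_comp ms measurable_fst).
  exact: (measurableT_comp mb measurable_snd).
rewrite (ge0_integral_independent m1 m2 ind mh) => [|z]; last by rewrite lee_fin sqr_ge0.
under eq_integral do rewrite /h /= hv EFinD.
rewrite ge0_integralD//; last 2 first.
- by move=> w _; rewrite lee_fin sqr_ge0.
- by apply/measurable_EFinP; apply: measurable_funX; exact: (measurableT_comp ms m1).
by congr (_ + _)%E; rewrite (Rintegral_EFin (integrable_cst1 P v)) Rintegral_cst1.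
Qed.

Context {n : nat} {I : choiceType} (D : set I) (X : I -> Om -> 'rV[R]_n).
Hypothesis gX : forall i, D i -> standard_gaussian P (X i).
Hypothesis indX : mutually_independent P D X.
Variables (N : nat) (p : nat -> I).
Hypothesis Dp : forall i, (i < N)%N -> D (p i).
Hypothesis p_inj : injective p.
Local Notation Gam := (@gaussian R n).

Definition first_indices k : {fset I} := [fset p i | i in iota 0 k]%fset.

Lemma mem_first_indices k i : (p i \in first_indices k) = (i < k)%N.
Proof.
apply/imfsetP/idP => [[j /= jk /p_inj ->]|ik]; first by rewrite mem_iota in jk.
by exists i => //=; rewrite mem_iota.
Qed.

Lemma first_indices_sub k : (k <= N)%N -> [set` first_indices k] `<=` D.
Proof.
move=> kN _ /= /imfsetP[i /= ik ->]; apply: Dp; move: ik; rewrite mem_iota => ik.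
exact: leq_trans ik kN.
Qed.

Lemma sum_second_moment (b : 'rV[R]_n -> R) k : (k <= N)%N ->
  Gam.-integrable setT (EFin \o b) -> Gam.-integrable setT (EFin \o (fun u => b u ^+ 2)) ->
  \int[Gam]_u b u = 0 ->
  (\int[P]_w ((\sum_(i < k) b (X (p i) w)) ^+ 2)%:E =
   (k%:R * \int[Gam]_u (b u ^+ 2))%:E)%E.
Proof.
move=> kN ib ib2 b0; elim: k kN => [|k ih] kN.
  rewrite mul0r; under eq_integral do rewrite big_ord0 expr0n /=.
  by rewrite integral0.
have mX i : D i -> measurable_fun setT (X i) by move=> /gX[].
have mb := integrable_measurable ib.
under eq_integral do rewrite big_ord_recr /=.
pose J1 := first_indices k; pose J2 : {fset I} := [fset p k]%fset.
have J1D : [set` J1] `<=` D by exact: first_indices_sub (ltnW kN).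
have J2D : [set` J2] `<=` D by move=> i /=; rewrite inE => /eqP ->; exact: Dp.
have dis i : i \in J1 -> i \notin J2.
  by rewrite inE => iJ; apply/eqP => e; move: iJ; rewrite e mem_first_indices ltnn.
have ind := independent_disjoint_subfamilies mX indX J1D J2D dis.
have ms : measurable_fun setT (fun w : sub_space X J1 => \sum_(i < k) b (X (p i) w)).
  apply: measurable_sum => i; apply: (measurableT_comp mb).
  by apply: measurable_sub_space; rewrite mem_first_indices.
have mb' : measurable_fun setT (fun w : sub_space X J2 => b (X (p k) w)).
  apply: (measurableT_comp mb).
  by apply: measurable_sub_space; rewrite inE.
have v0 : 0 <= \int[Gam]_u (b u ^+ 2) by apply: Rintegral_ge0 => u _; exact: sqr_ge0.
rewrite (second_moment_add (measurable_to_sub_space mX J1D) (measurable_to_sub_space mX J2D)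
  ind ms mb' v0).
  by rewrite ih ?(ltnW kN)// -EFinD -natr1 mulrDl mul1r.
move=> c; rewrite -(integral_sqr_shift c ib ib2 b0).
apply: (ge0_integral_standard_gaussian (gX (Dp kN)) (G := fun u => ((c + b u) ^+ 2)%:E)).
  by apply/measurable_EFinP; apply: measurable_funX; apply: measurable_funD.
by move=> u; rewrite lee_fin sqr_ge0.
Qed.

Variables (xi B : R) (psi : 'rV[R]_n -> R).
Hypothesis xi0 : 0 < xi.
Hypothesis N0 : (0 < N)%N.
Hypothesis mpsi : measurable_fun setT psi.
Hypothesis psiB : forall z, `|psi z| <= B.

Let est x w := estimator xi psi N (fun i => X (p i) w) x.
Let err x w := est x w - ggrad xi psi x.
Let a x q u : R := xi^-1 * dot u q * psi (x + xi *: u).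
Let ia x q : Gam.-integrable setT (EFin \o a x q).
Proof. apply: (integrable_mul_phi xi mpsi psiB); exact: (integrable_scaler _ (integrable_dot q)). Qed.

Let centred x q u : R := a x q u - dot (ggrad xi psi x) q.

Let int_a x q : \int[Gam]_u a x q u = dot (ggrad xi psi x) q.
Proof. by rewrite (ggrad_dot xi mpsi psiB). Qed.

Let i_centred x q : Gam.-integrable setT (EFin \o centred x q).
Proof. exact: (integrable_subr (ia x q) (integrable_cst1 _ _)). Qed.

Let int_centred x q : \int[Gam]_u centred x q u = 0.
Proof.
rewrite (RintegralB measurableT (ia x q) (integrable_cst1 _ _)) int_a.
by rewrite Rintegral_cst1 subrr.
Qed.

Let a_sqr_le x q u : a x q u ^+ 2 <= (B / xi) ^+ 2 * dot u q ^+ 2.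
Proof.
rewrite /a (_ : (B / xi) ^+ 2 * dot u q ^+ 2 = (xi^-1 * dot u q) ^+ 2 * B ^+ 2); last by ring.
rewrite exprMn ler_wpM2l ?sqr_ge0//.
by rewrite -real_normK ?num_real// ler_pXn2r// nnegrE// (le_trans (normr_ge0 _) (psiB 0)).
Qed.

Let i_a2 x q : Gam.-integrable setT (EFin \o (fun u => a x q u ^+ 2)).
Proof.
apply: (integrable_le (g := fun u => (B / xi) ^+ 2 * dot u q ^+ 2)).
- by apply: measurable_funX; exact: integrable_measurable (ia x q).
- by move=> u; rewrite ger0_norm ?sqr_ge0// a_sqr_le.
- exact: (integrable_scaler _ (integrable_dot2 q)).
Qed.

Let centred_sqr x q u : centred x q u ^+ 2 =
  a x q u ^+ 2 - (2 * dot (ggrad xi psi x) q * a x q u - dot (ggrad xi psi x) q ^+ 2).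
Proof. by rewrite /centred; ring. Qed.

Let i_centred2 x q : Gam.-integrable setT (EFin \o (fun u => centred x q u ^+ 2)).
Proof.
under eq_fun do rewrite centred_sqr.
exact: (integrable_subr (i_a2 x q) (integrable_subr (integrable_scaler _ (ia x q)) (integrable_cst1 _ _))).
Qed.

Let centred2_le x q : \int[Gam]_u (centred x q u ^+ 2) <= (B / xi) ^+ 2 * enorm q ^+ 2.
Proof.
under eq_Rintegral do rewrite centred_sqr.
have i1 := integrable_scaler (2 * dot (ggrad xi psi x) q) (ia x q).
have i0 := integrable_cst1 Gam (dot (ggrad xi psi x) q ^+ 2).
rewrite (RintegralB measurableT (i_a2 x q) (integrable_subr i1 i0)).
rewrite (RintegralB measurableT i1 i0) (RintegralZl _ measurableT (ia x q)) int_a Rintegral_cst1.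
apply: (@le_trans _ _ (\int[Gam]_u (a x q u ^+ 2))).
  set c := dot _ _; rewrite gerBl (_ : 2 * c * c - c ^+ 2 = c ^+ 2) ?sqr_ge0//; ring.
have id2 := integrable_scaler ((B / xi) ^+ 2) (integrable_dot2 q).
apply: (@le_trans _ _ (\int[Gam]_u ((B / xi) ^+ 2 * dot u q ^+ 2))).
  by apply: le_Rintegral => // u _; exact: a_sqr_le.
rewrite (RintegralZl _ measurableT (integrable_dot2 q)).
by rewrite ler_wpM2l ?sqr_ge0// second_moment_le.
Qed.

(** Tested against [q], the error is an average of independent centred scalars. *)
Lemma dot_estimator_error x w q :
  dot (err x w) q = N%:R^-1 * \sum_(i < N) centred x q (X (p i) w).
Proof.
have Nn : N%:R != 0 :> R by rewrite pnatr_eq0 -lt0n.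
rewrite /err /est /estimator dotDl dotNl dotZl invfM dot_suml.
under eq_bigr do rewrite dotZl.
have -> : \sum_(i < N) centred x q (X (p i) w) =
    \sum_(i < N) a x q (X (p i) w) - N%:R * dot (ggrad xi psi x) q.
  by rewrite /centred sumrB sumr_const card_ord mulr_natl.
rewrite mulrBr mulKf//; congr (_ - _).
rewrite -mulrA; congr (_ * _); rewrite mulr_sumr; apply: eq_bigr => i _.
by rewrite /a mulrCA mulrC -mulrA.
Qed.

Let pN i : (i < N)%N -> standard_gaussian P (X (p i)). Proof. by move=> /Dp /gX. Qed.

Let i_sum x q : P.-integrable setT (EFin \o (fun w => \sum_(i < N) centred x q (X (p i) w))).
Proof.
apply: integrable_sumr => i; exact: (integrable_standard_gaussian (pN (ltn_ord i)) (i_centred x q)).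
Qed.

Lemma integrable_dot_error x q : P.-integrable setT (EFin \o (fun w => dot (err x w) q)).
Proof.
by under eq_fun do rewrite dot_estimator_error; exact: (integrable_scaler _ (i_sum x q)).
Qed.

Lemma mean_dot_error x q : \int[P]_w dot (err x w) q = 0.
Proof.
under eq_Rintegral do rewrite dot_estimator_error.
rewrite (RintegralZl _ measurableT (i_sum x q)) Rintegral_sumr; last first.
  by move=> i; exact: (integrable_standard_gaussian (pN (ltn_ord i)) (i_centred x q)).
rewrite big1 ?mulr0// => i _.
rewrite (Rintegral_standard_gaussian (pN (ltn_ord i)) (H := centred x q)) ?int_centred//.
exact: integrable_measurable (i_centred x q).
Qed.

Lemma sqr_dot_error x q :
  (\int[P]_w (dot (err x w) q ^+ 2)%:E <= ((B / xi) ^+ 2 * enorm q ^+ 2 / N%:R)%:E)%E.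
Proof.
have Nn : N%:R != 0 :> R by rewrite pnatr_eq0 -lt0n.
have msum := integrable_measurable (i_sum x q).
under eq_integral do rewrite dot_estimator_error exprMn EFinM.
rewrite ge0_integralZl//; last 2 first.
- by apply/measurable_EFinP; exact: measurable_funX.
- by move=> w _; rewrite lee_fin sqr_ge0.
rewrite (sum_second_moment (leqnn N) (i_centred x q) (i_centred2 x q) (int_centred x q)).
have e : N%:R^-1 ^+ 2 * N%:R = N%:R^-1 :> R by rewrite expr2 -mulrA mulVf// mulr1.
rewrite -EFinM lee_fin mulrA e mulrC ler_wpM2r ?invr_ge0 ?ler0n//.
Qed.

Lemma enorm_sqr_coord (v : 'rV[R]_n) : enorm v ^+ 2 = \sum_j dot v (delta_mx 0 j) ^+ 2.
Proof.
by rewrite enorm_sqr dot_sum; apply: eq_bigr => j _; rewrite dot_delta -expr2.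
Qed.

Let i_dot2 x q : P.-integrable setT (EFin \o (fun w => dot (err x w) q ^+ 2)).
Proof.
apply: (ge0_integrable _ _ (sqr_dot_error x q) (ltry _)).
  by apply: measurable_funX; exact: integrable_measurable (integrable_dot_error x q).
by move=> w; exact: sqr_ge0.
Qed.

Lemma integrable_sqr_error x : P.-integrable setT (EFin \o (fun w => enorm (err x w) ^+ 2)).
Proof.
by under eq_fun do rewrite enorm_sqr_coord; apply: integrable_sumr => j; exact: i_dot2.
Qed.

Lemma estimator_variance x :
  \int[P]_w (enorm (err x w) ^+ 2) <= variance_bound n B xi N.
Proof.
under eq_Rintegral do rewrite enorm_sqr_coord.
rewrite Rintegral_sumr; last by move=> j; exact: i_dot2.
apply: (@le_trans _ _ (\sum_(j < n) (B / xi) ^+ 2 / N%:R)).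
  apply: ler_sum => j _; rewrite -lee_fin -Rintegral_EFin; last exact: i_dot2.
  by have := sqr_dot_error x (delta_mx 0 j); rewrite enorm_delta expr1n mulr1.
rewrite sumr_const card_ord -[leLHS]mulr_natl /variance_bound.
have Nn : N%:R != 0 :> R by rewrite pnatr_eq0 -lt0n.
have xn : xi != 0 by rewrite gt_eqF.
by rewrite le_eqVlt; apply/orP; left; apply/eqP; field; rewrite xn Nn.
Qed.

(** Here [g] stands for the exact gradient and [v] for the exact projected step at a
    frozen iterate; centring the estimate removes the mixed terms. *)
Lemma expected_step_error x (g v : 'rV[R]_n) (c Del : R) :
  enorm (ggrad xi psi x - g) <= Del -> enorm v <= c ->
  (\int[P]_w (dot (est x w - g) v + enorm (est x w - g) ^+ 2 + c ^+ 2)%:E <=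
   (Del * c + variance_bound n B xi N + Del ^+ 2 + c ^+ 2)%:E)%E.
Proof.
set b := ggrad xi psi x - g => bD vc.
have c0 : 0 <= c by exact: le_trans (enorm_ge0 v) vc.
have estE w : est x w - g = err x w + b by rewrite /err /b addrA subrK.
pose k := dot b v + enorm b ^+ 2 + c ^+ 2.
have -> : (fun w => (dot (est x w - g) v + enorm (est x w - g) ^+ 2 + c ^+ 2)%:E) =
    EFin \o (fun w => dot (err x w) (v + 2 *: b) + (enorm (err x w) ^+ 2 + k)).
  apply/funext => w /=; congr EFin; rewrite estE dotDl enormD_sqr dotDr dotZr /k; ring.
have i1 := integrable_dot_error x (v + 2 *: b).
have i2 := integrable_sqr_error x.
have ik := integrable_cst1 P k.
rewrite Rintegral_EFin; last exact: (integrable_addr i1 (integrable_addr i2 ik)).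
rewrite (RintegralD measurableT i1 (integrable_addr i2 ik)) mean_dot_error add0r.
rewrite (RintegralD measurableT i2 ik) Rintegral_cst1 lee_fin /k.
have h1 := estimator_variance x.
have h2 : dot b v <= Del * c.
  apply: le_trans (ler_norm _) _; apply: le_trans (dot_norm_le _ _) _.
  by apply: ler_pM => //; exact: enorm_ge0.
have h3 : enorm b ^+ 2 <= Del ^+ 2.
  by rewrite ler_pXn2r// nnegrE ?enorm_ge0// (le_trans (enorm_ge0 b)).
have -> : Del * c + variance_bound n B xi N + Del ^+ 2 + c ^+ 2 =
  variance_bound n B xi N + (Del * c + Del ^+ 2 + c ^+ 2) by ring.
by rewrite lerD// lerD// lerD.
Qed.

End second_moment.

Section estimator_of_representative.
Context d {Om : measurableType d} {R : realType} (P : probability Om R).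
Context {n : nat} {I : choiceType} (D : set I) (X : I -> Om -> 'rV[R]_n).
Hypothesis gX : forall i, D i -> standard_gaussian P (X i).
Hypothesis indX : mutually_independent P D X.
Variables (N : nat) (p : nat -> I).
Hypothesis Dp : forall i, (i < N)%N -> D (p i).
Hypothesis p_inj : injective p.
Variables (xi B : R) (F psi : 'rV[R]_n -> R) (Nul : set 'rV[R]_n).
Hypothesis xi0 : 0 < xi.
Hypothesis N0 : (0 < N)%N.
Hypothesis mpsi : measurable_fun setT psi.
Hypothesis psiB : forall z, `|psi z| <= B.
Hypothesis mNul : measurable Nul.
Hypothesis Nul0 : lebesgue_rV n Nul = 0%E.
Hypothesis Fpsi : forall z, ~ Nul z -> F z = psi z.

(** The exceptional event is that one of the sampling points hits [Nul]. *)
Lemma estimator_ae_eq x : exists E : set Om, [/\ measurable E, P E = 0%E & forall w, ~ E w ->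
  estimator xi F N (fun i => X (p i) w) x = estimator xi psi N (fun i => X (p i) w) x].
Proof.
pose bad i := (fun w => x + xi *: X (p i) w) @^-1` Nul.
have badP i : (i < N)%N -> measurable (bad i) /\ P (bad i) = 0%E.
  move=> iN; have g := gX (Dp iN); split; last exact: standard_gaussian_null.
  rewrite -[X in measurable X]setTI.
  have m : measurable_fun setT (fun w => x + xi *: X (p i) w).
    by apply: measurable_rVD => //; apply: measurable_rVZ => //; exact: g.1.
  exact: m measurableT _ mNul.
exists (\big[setU/set0]_(i < N) bad i); split.
- by apply: bigsetU_measurable => i _; have [] := badP i (ltn_ord i).
- apply/eqP; rewrite eq_le measure_ge0 andbT.
  apply: le_trans (Boole_inequality P (fun i iN => (badP i iN).1)) _.
  by rewrite big1// => i _; have [] := badP i (ltn_ord i).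
- move=> w nw; rewrite /estimator; congr (_ *: _); apply: eq_bigr => i _; congr (_ *: _).
  apply: Fpsi => bi; apply: nw; exact: (bigsetU_sup (ltn_ord i) bi).
Qed.

Lemma expectation_estimator x :
  expectation_rV P (fun w => estimator xi F N (fun i => X (p i) w) x) = ggrad xi psi x.
Proof.
apply/rowP => j; rewrite mxE unlock.
have [E [mE E0 hE]] := estimator_ae_eq x.
rewrite (integral_ae_eq (g := fun w => (dot (estimator xi psi N (fun i => X (p i) w) x -
  ggrad xi psi x) (delta_mx 0 j) + ggrad xi psi x 0 j)%:E) mE E0); last first.
  by move=> w /hE ->; rewrite dot_delta !mxE subrK.
have i1 := integrable_dot_error gX Dp xi N0 mpsi psiB x (delta_mx 0 j).
have ic := integrable_cst1 P (ggrad xi psi x 0 j).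
rewrite -/(Rintegral P setT _) (RintegralD measurableT i1 ic) Rintegral_cst1.
by rewrite (mean_dot_error gX Dp xi N0 mpsi psiB) add0r.
Qed.

Lemma variance_estimator x :
  ('E_P[fun w => (enorm (estimator xi F N (fun i => X (p i) w) x - ggrad xi psi x) ^+ 2)%R]
   <= (variance_bound n B xi N)%:E)%E.
Proof.
have [E [mE E0 hE]] := estimator_ae_eq x; rewrite unlock.
rewrite (integral_ae_eq (g := fun w => (enorm (estimator xi psi N (fun i => X (p i) w) x -
  ggrad xi psi x) ^+ 2)%:E) mE E0); last by move=> w /hE ->.
rewrite Rintegral_EFin; last exact: (integrable_sqr_error gX indX Dp p_inj xi N0 mpsi psiB).
by rewrite lee_fin; exact: (estimator_variance gX indX Dp p_inj xi0 N0 mpsi psiB).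
Qed.

End estimator_of_representative.

(** * One step of the projected method *)
Section lipschitz_measurable.
Context {R : realType} (n m : nat).

Lemma lipschitz_measurable (k : R) (F : 'rV[R]_n -> 'rV[R]_m) : 0 <= k ->
  (forall x y, enorm (F x - F y) <= k * enorm (x - y)) -> measurable_fun setT F.
Proof.
move=> k0 lipF; apply: continuous_measurable_rVrV => x.
apply/(cvgrPdist_le (F := nbhs x)) => e e0.
have kn : 0 < k * n%:R + 1 by rewrite ltr_wpDl// mulr_ge0.
have := @nbhsx_ballx R 'rV[R]_n x (e / (k * n%:R + 1)) (divr_gt0 e0 kn).
apply: filterS => y; rewrite -ball_normE /= => xy.
apply: le_trans (normr_le_enorm _) _; apply: le_trans (lipF _ _) _.
apply: le_trans (ler_wpM2l k0 (enorm_le_normr _)) _; rewrite mulrA.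
apply: (@le_trans _ _ ((k * n%:R + 1) * `|x - y|)).
  by rewrite ler_wpM2r// lerDl.
by rewrite mulrC -ler_pdivlMr// ltW.
Qed.

End lipschitz_measurable.

Lemma subr_sub_cancel (V : zmodType) (a b c : V) : a - b - (a - c) = c - b.
Proof. by rewrite opprB addrC addrA subrK. Qed.

Lemma step_arith (R : realFieldType) (beta L s0 s1 GD eps D2 : R) : 0 < beta ->
  s1 - s0 + beta * GD <= L * (beta ^+ 2 * D2) -> D2 - eps <= GD ->
  (beta - L * beta ^+ 2) * D2 <= s0 - s1 + beta * eps.
Proof.
move=> b0 h1 /(ler_wpM2l (ltW b0)); rewrite mulrBr mulrBl => h2; move: h1 h2.
by rewrite mulrA; lra.
Qed.

Section path.
Context {R : realType} (n : nat) (X : set 'rV[R]_n).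
Hypothesis cvxX : convex_set X.
Hypothesis cptX : compact X.
Hypothesis X0 : X !=set0.
Variables (xi B : R) (phi : 'rV[R]_n -> R).
Hypothesis xi0 : 0 < xi.
Hypothesis mphi : measurable_fun setT phi.
Hypothesis phiB : forall z, `|phi z| <= B.
Local Notation L := (B / xi ^+ 2).
Local Notation P := (Defs.proj X).
Local Notation G := (ggrad xi phi).
Local Notation s := (gsmooth xi phi).

Definition exact_step (beta : R) x := beta^-1 *: (x - P (x - beta *: G x)).

(** The iterate is its own projection, so nonexpansiveness bounds the step by the
    gradient. *)
Lemma exact_step_le beta x : 0 < beta -> X x -> enorm (exact_step beta x) <= B / xi.
Proof.
move=> b0 Xx; rewrite /exact_step enormZ gtr0_norm ?invr_gt0// ler_pdivrMl//.
rewrite -{1}(proj_id cptX X0 Xx).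
apply: le_trans (proj_nonexpansive cvxX cptX X0 _ _) _.
by rewrite opprB addrC subrK enormZ gtr0_norm// ler_wpM2l ?(ltW b0)// ggrad_bound.
Qed.

(** Descent over one step: smoothness of the smoothed function costs the
    quadratic term, and replacing the computed step by the exact one costs
    [enorm e ^+ 2] since the projection is nonexpansive. *)
Lemma projected_step (beta : R) (x ghat D e : 'rV[R]_n) : 0 < beta -> X x ->
  D = beta^-1 *: (x - P (x - beta *: ghat)) -> e = ghat - G x ->
  (beta - L * beta ^+ 2) * enorm D ^+ 2 <=
  s x - s (P (x - beta *: ghat)) +
  beta * (dot e (exact_step beta x) + enorm e ^+ 2).
Proof.
move=> b0 Xx DE eE.
have bn : beta != 0 by rewrite gt_eqF.
have xE : P (x - beta *: ghat) = x + (- beta) *: D.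
  by rewrite DE scaleNr scalerA divff// scale1r opprB [RHS]addrC subrK.
have obt := proj_obtuse cvxX cptX X0 (x - beta *: ghat) Xx.
have tay := gsmooth_taylor xi0 mphi phiB x ((- beta) *: D).
have De : enorm (D - exact_step beta x) <= enorm e.
  rewrite DE /exact_step -scalerBr enormZ gtr0_norm ?invr_gt0// ler_pdivrMl//.
  rewrite subr_sub_cancel.
  apply: le_trans (proj_nonexpansive cvxX cptX X0 _ _) _.
  by rewrite subr_sub_cancel -scalerBr -eE enormZ gtr0_norm.
have h1 : enorm D ^+ 2 <= dot ghat D.
  move: obt; rewrite xE.
  have -> : x - beta *: ghat - (x + - beta *: D) = beta *: (D - ghat).
    by apply/rowP => i; rewrite !mxE; ring.
  have -> : x - (x + - beta *: D) = beta *: D.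
    by rewrite opprD addrA subrr sub0r scaleNr opprK.
  rewrite dotZl dotZr pmulr_rle0// pmulr_rle0// dotDl dotNl -enorm_sqr subr_le0.
  by [].
have h2 : dot e D - enorm e ^+ 2 <= dot e (exact_step beta x).
  rewrite lerBlDl -lerBlDr.
  have -> : dot e D - dot e (exact_step beta x) = dot e (D - exact_step beta x).
    by rewrite dotDr dotNr.
  apply: le_trans (dot_le _ _) _; rewrite expr2 ler_wpM2l ?enorm_ge0//.
have h3 : dot ghat D = dot e D + dot (G x) D by rewrite -dotDl eE subrK.
rewrite xE; apply: (@step_arith _ _ _ _ _ (dot (G x) D)) => //; last by lra.
move: tay; rewrite dotZr enormZ normrN (gtr0_norm b0) exprMn => /(le_trans (ler_norm _)).
by rewrite mulNr opprK.
Qed.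

End path.

(** * The algorithm as a stochastic process *)
Section iterates.
Context {R : realType} (n : nat) (X : set 'rV[R]_n).
Hypothesis cvxX : convex_set X.
Hypothesis cptX : compact X.
Hypothesis X0 : X !=set0.

Lemma iterateS beta (G : nat -> 'rV[R]_n -> 'rV[R]_n) x1 t : (0 < t)%N ->
  iterate X beta G x1 t.+1 =
  Defs.proj X (iterate X beta G x1 t - beta t *: G t (iterate X beta G x1 t)).
Proof. by case: t. Qed.

Lemma iterate_in beta (G : nat -> 'rV[R]_n -> 'rV[R]_n) x1 t : X x1 ->
  X (iterate X beta G x1 t).
Proof. by move=> Xx1; case: t => [|[|t]]//; rewrite iterateS//; exact: proj_in. Qed.

Lemma measurable_proj : measurable_fun setT (Defs.proj X).
Proof.
apply: (@lipschitz_measurable _ _ _ 1) => // x y; rewrite mul1r; exact: proj_nonexpansive.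
Qed.

End iterates.

Lemma measurable_sum_rV d (T : measurableType d) (R : realType) n N (f : 'I_N -> T -> 'rV[R]_n) :
  (forall i, measurable_fun setT (f i)) -> measurable_fun setT (fun w => \sum_i f i w).
Proof.
move=> mf; apply: measurable_fun_rVP => j; under eq_fun do rewrite summxE.
by apply: measurable_sum => i; exact: measurable_rV_coord.
Qed.

Lemma measurable_estimator d (T : measurableType d) (R : realType) n N (xi : R)
    (psi : 'rV[R]_n -> R) (U : nat -> T -> 'rV[R]_n) (a : T -> 'rV[R]_n) :
  measurable_fun setT psi -> measurable_fun setT a ->
  (forall i, (i < N)%N -> measurable_fun setT (U i)) ->
  measurable_fun setT (fun w => estimator xi psi N (fun i => U i w) (a w)).
Proof.
move=> mpsi ma mU; apply: measurable_rVZ => //; apply: measurable_sum_rV => i.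
have mUi := mU i (ltn_ord i).
apply: measurable_rVZ => //; apply: (measurableT_comp mpsi).
by apply: measurable_rVD => //; apply: measurable_rVZ.
Qed.

Lemma sum_step_arith (R : realDomainType) (S C s1 s2 s3 Q a b q : R) :
  S + C <= s1 - s2 + Q -> a <= s2 - s3 + q -> S + a + (C + b) <= s1 - s3 + (Q + (q + b)).
Proof. lra. Qed.

Lemma loss_ge0 (R : realType) n (e v : 'rV[R]_n) (c : R) : enorm v <= c ->
  0 <= dot e v + enorm e ^+ 2 + c ^+ 2.
Proof.
move=> vc; have := dot_norm_le e v; rewrite ler_norml => /andP[h _].
have h2 : enorm e * enorm v <= enorm e * c by rewrite ler_wpM2l ?enorm_ge0.
have h3 : 0 <= enorm e ^+ 2 + c ^+ 2 - enorm e * c.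
  have := sqr_ge0 (enorm e - c); have := sqr_ge0 (enorm e); have := sqr_ge0 c.
  by move: (enorm e) => a; lra.
lra.
Qed.

Section process.
Context d {Om : measurableType d} {R : realType} (P : probability Om R) (n : nat).
Variables (X : set 'rV[R]_n) (xi B : R) (phi : 'rV[R]_n -> R).
Hypothesis cvxX : convex_set X.
Hypothesis cptX : compact X.
Hypothesis xi0 : 0 < xi.
Hypothesis mphi : measurable_fun setT phi.
Hypothesis phiB : forall z, `|phi z| <= B.
Variables (N : nat -> nat) (u : nat -> nat -> Om -> 'rV[R]_n).
Local Notation samples := [set p : nat * nat | (0 < p.1)%N /\ (p.2 < N p.1)%N].
Local Notation sample := (fun p : nat * nat => u p.1 p.2).
Hypothesis N0 : forall t, (0 < t)%N -> (0 < N t)%N.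
Hypothesis gu : forall p, samples p -> standard_gaussian P (u p.1 p.2).
Hypothesis indu : mutually_independent P samples sample.
Variables (F psi : nat -> 'rV[R]_n -> R) (Nul : nat -> set 'rV[R]_n) (Del : nat -> R).
Hypothesis mpsi : forall t, (0 < t)%N -> measurable_fun setT (psi t).
Hypothesis psiB : forall t z, (0 < t)%N -> `|psi t z| <= B.
Hypothesis mNul : forall t, (0 < t)%N -> measurable (Nul t).
Hypothesis Nul0 : forall t, (0 < t)%N -> lebesgue_rV n (Nul t) = 0%E.
Hypothesis Fpsi : forall t z, (0 < t)%N -> ~ Nul t z -> F t z = psi t z.
Hypothesis DelP : forall t x, (0 < t)%N ->
  enorm (ggrad xi (psi t) x - ggrad xi phi x) <= Del t.
Variables (x1 : 'rV[R]_n) (beta : nat -> R).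
Hypothesis Xx1 : X x1.
Hypothesis beta0 : forall t, (0 < t)%N -> 0 < beta t.
Local Notation L := (B / xi ^+ 2).
Hypothesis betaL : forall t, (0 < t)%N -> L * beta t < 1.

Let X0 : X !=set0. Proof. by exists x1. Qed.
Let est (Q : nat -> 'rV[R]_n -> R) w t x := estimator xi (Q t) (N t) (fun i => u t i w) x.
Let xs w t := iterate X beta (est psi w) x1 t.

Definition sample_block a b : {fset nat * nat} :=
  [fset p in [seq (s, i) | s <- index_iota a b, i <- iota 0 (N s)]]%fset.

Lemma mem_sample_block a b p : (p \in sample_block a b) = (a <= p.1 < b)%N && (p.2 < N p.1)%N.
Proof.
rewrite inE /=; apply/allpairsPdep/idP => [[s [i [sab iN ->]]]|/andP[sab iN]] /=.
  by move: sab iN; rewrite mem_index_iota mem_iota add0n /= => -> ->.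
by exists p.1, p.2; rewrite mem_index_iota mem_iota add0n /= sab iN -surjective_pairing.
Qed.

Lemma sample_block_sub a b : (0 < a)%N -> [set` sample_block a b] `<=` samples.
Proof.
move=> a0 p /=; rewrite mem_sample_block => /andP[/andP[ap _] pN]; split => //.
exact: leq_trans ap.
Qed.

Let mu i : samples i -> measurable_fun setT (sample i). Proof. by move=> /gu[]. Qed.

Lemma measurable_iterate (J : {fset nat * nat}) t :
  (forall p, p \in sample_block 1 t -> p \in J) ->
  measurable_fun setT ((fun w => xs w t) : sub_space sample J -> 'rV[R]_n).
Proof.
elim: t => [|[|t] ih] sub; [exact: measurable_cst|exact: measurable_cst|].
have mx : measurable_fun setT ((fun w => xs w t.+1) : sub_space sample J -> 'rV[R]_n).
  apply: ih => p; rewrite mem_sample_block => /andP[/andP[p1 pt] pN]; apply: sub.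
  by rewrite mem_sample_block p1 pN (ltn_trans pt).
rewrite (_ : (fun w => xs w t.+2) = (fun w => Defs.proj X (xs w t.+1 -
  beta t.+1 *: est psi w t.+1 (xs w t.+1))))//.
apply: (measurableT_comp (measurable_proj cvxX cptX X0)).
apply: measurable_rVD => //; apply: measurable_rVN; apply: measurable_rVZ => //.
apply: (measurable_estimator _ (mpsi (ltn0Sn t)) mx) => i iN.
apply: (@measurable_sub_space _ _ _ _ _ sample J (t.+1, i)); apply: sub.
by rewrite mem_sample_block /= iN andbT ltnSn.
Qed.

Let past t := sub_space sample (sample_block 1 t).
Let present t := sub_space sample (sample_block t t.+1).

Let m_past t : (0 < t)%N -> measurable_fun setT (id : Om -> past t).
Proof. by move=> t0; apply: (measurable_to_sub_space mu); exact: sample_block_sub. Qed.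
Let m_present t : (0 < t)%N -> measurable_fun setT (id : Om -> present t).
Proof. by move=> t0; apply: (measurable_to_sub_space mu); exact: sample_block_sub. Qed.

Lemma past_present_independent t : (0 < t)%N ->
  independent_pair P (id : Om -> past t) (id : Om -> present t).
Proof.
move=> t0; apply: (independent_disjoint_subfamilies mu indu); [exact: sample_block_sub..|].
move=> p; rewrite !mem_sample_block => /andP[/andP[_ pt] _].
by rewrite leqNgt pt.
Qed.

Let m_xs_past t : measurable_fun setT ((fun w => xs w t) : past t -> 'rV[R]_n).
Proof. exact: measurable_iterate. Qed.

Let m_u_present t i : (i < N t)%N -> measurable_fun setT (u t i : present t -> 'rV[R]_n).
Proof.
move=> iN; apply: (@measurable_sub_space _ _ _ _ _ sample _ (t, i)).
by rewrite mem_sample_block /= leqnn ltnSn.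
Qed.

(** The iterate depends on the past only, so a sampling point [x + xi u] built
    on it has a Gaussian conditional law and avoids null sets. *)
Lemma sampling_point_null t i : (0 < t)%N -> (i < N t)%N ->
  measurable [set w | Nul t (xs w t + xi *: u t i w)] /\
  P [set w | Nul t (xs w t + xi *: u t i w)] = 0%E.
Proof.
move=> t0 iN.
have ms : samples (t, i) by [].
have mz : measurable_fun setT (fun z : past t * present t => xs z.1 t + xi *: u t i z.2).
  apply: measurable_rVD; first exact: (measurableT_comp (@m_xs_past t) measurable_fst).
  apply: measurable_rVZ => //; exact: (measurableT_comp (m_u_present iN) measurable_snd).
have mw : measurable_fun setT (fun w : Om => (w : past t, w : present t)).
  by apply/measurable_fun_pairP; split; [exact: m_past|exact: m_present].
have mE : measurable [set w : Om | Nul t (xs w t + xi *: u t i w)].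
  rewrite -[X in measurable X]setTI.
  exact: (measurableT_comp mz mw measurableT (mNul t0)).
split => //.
pose h (z : past t * present t) : \bar R := (\1_(Nul t) (xs z.1 t + xi *: u t i z.2))%:E.
have mh : measurable_fun setT h.
  apply/measurable_EFinP; apply: (measurableT_comp (measurable_indic (mNul t0)) mz).
have h0 z : (0 <= h z)%E by rewrite lee_fin indicE ler0n.
have := ge0_integral_independent (m_past t0) (m_present t0) (past_present_independent t0) mh h0.
rewrite (_ : (\int[P]_w h (w, w))%E = P [set w | Nul t (xs w t + xi *: u t i w)]); last first.
  rewrite -[RHS](_ : P ([set w | Nul t (xs w t + xi *: u t i w)] `&` setT) = _); last by rewrite setIT.
  by rewrite -integral_indic.
move=> ->; rewrite -[RHS](integral0 P setT); apply: eq_integral => w _.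
have e : P ((fun w' => xs w t + xi *: u t i w') @^-1` Nul t) = 0%E.
  exact: (standard_gaussian_null (gu ms) _ xi0 (mNul t0) (Nul0 t0)).
rewrite -[RHS]e.
have m2 : measurable ((fun w' : Om => xs w t + xi *: u t i w') @^-1` Nul t).
  rewrite -[X in measurable X]setTI.
  have mu' : measurable_fun setT (fun w' : Om => xs w t + xi *: u t i w').
    by apply: measurable_rVD => //; apply: measurable_rVZ => //; exact: mu ms.
  exact: mu' measurableT _ (mNul t0).
rewrite -[in RHS](setIT ((fun w' => xs w t + xi *: u t i w') @^-1` Nul t)) -integral_indic//.
Qed.

Lemma estimator_eq (Q Q' : 'rV[R]_n -> R) M (U : nat -> 'rV[R]_n) x :
  (forall i, (i < M)%N -> Q (x + xi *: U i) = Q' (x + xi *: U i)) ->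
  estimator xi Q M U x = estimator xi Q' M U x.
Proof. by move=> h; rewrite /estimator; congr (_ *: _); apply: eq_bigr => i _; rewrite h. Qed.

(** By induction on the iterations; the exceptional events are those where a sampling
    point of the run with representatives hits a null set. *)
Lemma iterates_ae_eq T : exists E : set Om, [/\ measurable E, P E = 0%E &
  forall w, ~ E w -> forall t, (0 < t <= T)%N ->
    iterate X beta (est F w) x1 t = xs w t /\ est F w t (xs w t) = est psi w t (xs w t)].
Proof.
elim: T => [|T [E [mE E0 hE]]].
  by exists set0; split => // w _ t /andP[]; case: t.
pose bad i := [set w | Nul T.+1 (xs w T.+1 + xi *: u T.+1 i w)].
have badP i : (i < N T.+1)%N -> measurable (bad i) /\ P (bad i) = 0%E.
  by move=> iN; exact: sampling_point_null.
have mbad : measurable (\big[setU/set0]_(i < N T.+1) bad i).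
  by apply: bigsetU_measurable => i _; have [] := badP i (ltn_ord i).
have bad0 : P (\big[setU/set0]_(i < N T.+1) bad i) = 0%E.
  apply/eqP; rewrite eq_le measure_ge0 andbT.
  apply: le_trans (Boole_inequality P (fun i iN => (badP i iN).1)) _.
  by rewrite big1// => i _; have [] := badP i (ltn_ord i).
exists (E `|` \big[setU/set0]_(i < N T.+1) bad i); split.
- exact: measurableU.
- exact: null_set_setU.
move=> w nw t /andP[t0]; rewrite leq_eqVlt => /orP[/eqP ->{t t0}|tT]; last first.
  by apply: hE; [move=> Ew; apply: nw; left|rewrite t0].
have e : iterate X beta (est F w) x1 T.+1 = xs w T.+1.
  have [T0|T0] := posnP T; first by rewrite /xs T0.
  have [e1 e2] := hE w (fun Ew => nw (or_introl Ew)) T (introT andP (conj T0 (leqnn T))).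
  rewrite (iterateS X beta (est F w) x1 T0) e1 e2; apply/esym; exact: iterateS.
split; first exact: e.
apply: estimator_eq => i iN; apply: Fpsi; first exact: ltn0Sn.
move=> bi; apply: nw; right; exact: (bigsetU_sup iN bi).
Qed.

Let c := B / xi.
Let B0 : 0 <= B. Proof. exact: le_trans (normr_ge0 _) (phiB 0). Qed.
Let c0 : 0 <= c. Proof. by rewrite /c divr_ge0// ltW. Qed.
Let G := ggrad xi phi.
Let step w t := (beta t)^-1 *: (xs w t - Defs.proj X (xs w t - beta t *: est psi w t (xs w t))).
Let dev w t := est psi w t (xs w t) - G (xs w t).
(** The error terms of one step, shifted by [c ^+ 2] to be nonnegative. *)
Let loss w t := dot (dev w t) (exact_step X xi phi (beta t) (xs w t)) + enorm (dev w t) ^+ 2 + c ^+ 2.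

Let Xxs w t : X (xs w t). Proof. exact: iterate_in. Qed.

Let measurable_ggrad : measurable_fun setT G.
Proof.
apply: (@lipschitz_measurable _ _ _ (6 * L)).
  by rewrite mulr_ge0// divr_ge0// sqr_ge0.
by move=> x y; exact: (ggrad_lipschitz xi0 mphi phiB).
Qed.

(** By Tonelli's theorem the present block is integrated first, for a frozen iterate. *)
Lemma expected_loss t : (0 < t)%N ->
  (\int[P]_w (loss w t)%:E <=
   (Del t * c + variance_bound n B xi (N t) + Del t ^+ 2 + c ^+ 2)%:E)%E.
Proof.
move=> t0.
pose dev2 (z : past t * present t) := est psi z.2 t (xs z.1 t) - G (xs z.1 t).
pose h (z : past t * present t) : \bar R :=
  (dot (dev2 z) (exact_step X xi phi (beta t) (xs z.1 t)) + enorm (dev2 z) ^+ 2 + c ^+ 2)%:E.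
have mx : measurable_fun setT (fun z : past t * present t => xs z.1 t).
  exact: (measurableT_comp (@m_xs_past t) measurable_fst).
have mGx := measurableT_comp measurable_ggrad mx.
have mdev : measurable_fun setT dev2.
  apply: measurable_rVD; last exact: measurable_rVN.
  apply: (@measurable_estimator _ (past t * present t)%type R n (N t) xi (psi t)
    (fun i z => u t i z.2) (fun z => xs z.1 t) (mpsi t0) mx) => i iN.
  exact: (measurableT_comp (m_u_present iN) measurable_snd).
have mstep : measurable_fun setT (fun z : past t * present t => exact_step X xi phi (beta t) (xs z.1 t)).
  apply: measurable_rVZ => //; apply: measurable_rVD => //; apply: measurable_rVN.
  apply: (measurableT_comp (measurable_proj cvxX cptX X0)).
  by apply: measurable_rVD => //; apply: measurable_rVN; apply: measurable_rVZ.
have mh : measurable_fun setT h.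
  apply/measurable_EFinP; apply: measurable_funD => //; apply: measurable_funD.
    exact: measurable_dot.
  by apply: measurable_funX; exact: measurable_enorm.
have es w : enorm (exact_step X xi phi (beta t) (xs w t)) <= c.
  by apply: exact_step_le => //; exact: beta0.
have h0 z : (0 <= h z)%E by rewrite lee_fin; apply: loss_ge0.
rewrite (ge0_integral_independent (m_past t0) (m_present t0) (past_present_independent t0) mh h0).
set k := (X in (_ <= X%:E)%E).
have k0 : 0 <= k.
  rewrite /k !addr_ge0 ?sqr_ge0//.
    by rewrite mulr_ge0// (le_trans (enorm_ge0 _) (DelP 0 t0)).
  by rewrite /variance_bound divr_ge0// mulr_ge0// ?ler0n// sqr_ge0.
apply: (@le_trans _ _ (\int[P]_w k%:E)%E); last first.
  by rewrite (Rintegral_EFin (integrable_cst1 P k)) Rintegral_cst1.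
apply: ge0_integral_ae_le measurable0 (measure0 P) _ _ _ => [w|w|w _].
- by apply: integral_ge0 => w' _.
- by rewrite lee_fin.
have Dp i : (i < N t)%N -> samples (t, i) by [].
have pinj : injective (fun i : nat => (t, i)) by move=> i j [].
have key := @expected_step_error _ Om R P n _ samples sample gu indu (N t)
  (fun i => (t, i)) Dp pinj xi B (psi t) xi0 (N0 t0) (mpsi t0) (fun z => psiB z t0)
  (xs w t) (G (xs w t)) (exact_step X xi phi (beta t) (xs w t)) c (Del t) (DelP _ t0) (es w).
exact: key.
Qed.

(** The values of the smoothed function telescope and stay within [B] of zero. *)
Lemma sum_steps_le w T :
  \sum_(1 <= t < T.+1) weight L beta t * enorm (step w t) ^+ 2 +
    \sum_(1 <= t < T.+1) beta t * c ^+ 2 <=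
  2 * B + \sum_(1 <= t < T.+1) beta t * loss w t.
Proof.
have h : \sum_(1 <= t < T.+1) weight L beta t * enorm (step w t) ^+ 2 +
    \sum_(1 <= t < T.+1) beta t * c ^+ 2 <=
  gsmooth xi phi (xs w 1) - gsmooth xi phi (xs w T.+1) + \sum_(1 <= t < T.+1) beta t * loss w t.
  elim: T => [|T ih]; first by rewrite !big_geq// subrr !addr0.
  rewrite !(@big_nat_recr _ _ _ T.+1)//=.
  have := projected_step cvxX cptX X0 xi0 mphi phiB (beta0 (ltn0Sn T)) (Xxs w T.+1)
    (erefl (step w T.+1)) (erefl (dev w T.+1)).
  rewrite -iterateS// -/(xs w T.+2) -/(weight L beta T.+1).
  have -> : beta T.+1 * loss w T.+1 = beta T.+1 *
     (dot (dev w T.+1) (exact_step X xi phi (beta T.+1) (xs w T.+1)) + enorm (dev w T.+1) ^+ 2)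
     + beta T.+1 * c ^+ 2 by rewrite /loss mulrDr.
  exact: sum_step_arith.
apply: le_trans h _; rewrite lerD2r mulr_natl mulr2n.
apply: le_trans (ler_norm _) _; apply: le_trans (ler_normB _ _) _.
by apply: lerD; exact: gsmooth_le.
Qed.

Let on_Om (J : {fset nat * nat}) d' (T' : measurableType d') (f : Om -> T') :
  [set` J] `<=` samples -> measurable_fun setT (f : sub_space sample J -> T') ->
  measurable_fun setT f.
Proof. by move=> sJ mf; exact: (measurableT_comp mf (measurable_to_sub_space mu sJ)). Qed.

Let block_le t T : (t <= T)%N -> forall p, p \in sample_block 1 t -> p \in sample_block 1 T.
Proof.
move=> tT p; rewrite !mem_sample_block => /andP[/andP[-> pt] ->].
by rewrite (leq_trans pt tT).
Qed.

Let measurable_est t T : (0 < t <= T)%N ->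
  measurable_fun setT ((fun w => est psi w t (xs w t)) : sub_space sample (sample_block 1 T.+1) -> 'rV[R]_n).
Proof.
move=> /andP[t0 tT].
apply: (@measurable_estimator _ (sub_space sample (sample_block 1 T.+1)) R n (N t) xi (psi t)
    (u t) (fun w => xs w t) (mpsi t0)) => [|i iN].
  by apply: measurable_iterate; apply: block_le; rewrite (leq_trans tT).
apply: (@measurable_sub_space _ _ _ _ _ sample _ (t, i)).
by rewrite mem_sample_block /= t0 iN ltnS tT.
Qed.

Let measurable_xs t T : (t <= T)%N ->
  measurable_fun setT ((fun w => xs w t) : sub_space sample (sample_block 1 T.+1) -> 'rV[R]_n).
Proof. by move=> tT; apply: measurable_iterate; apply: block_le; rewrite (leq_trans tT). Qed.

Let measurable_step t T : (0 < t <= T)%N ->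
  measurable_fun setT ((fun w => step w t) : sub_space sample (sample_block 1 T.+1) -> 'rV[R]_n).
Proof.
move=> t0T; have tT : (t <= T)%N by case/andP: t0T.
have me := measurable_est t0T; have mx := measurable_xs tT.
apply: measurable_rVZ; first exact: measurable_cst.
apply: (measurable_rVD mx _); apply: measurable_rVN.
apply: (measurableT_comp (measurable_proj cvxX cptX X0)).
apply: (measurable_rVD mx _); apply: measurable_rVN; apply: (measurable_rVZ _ me).
exact: measurable_cst.
Qed.

Let measurable_loss t : (0 < t)%N -> measurable_fun setT (fun w : Om => loss w t).
Proof.
move=> t0; apply: (on_Om (@sample_block_sub 1 t.+1 isT)).
have t0t : (0 < t <= t)%N by rewrite t0 /=.
have me := measurable_est t0t; have mx := measurable_xs (leqnn t).
have mdev : measurable_fun setT ((fun w => dev w t) : sub_space sample (sample_block 1 t.+1) -> 'rV[R]_n).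
  by apply: (measurable_rVD me _); apply: measurable_rVN; exact: (measurableT_comp measurable_ggrad mx).
have mes : measurable_fun setT ((fun w => exact_step X xi phi (beta t) (xs w t)) :
    sub_space sample (sample_block 1 t.+1) -> 'rV[R]_n).
  apply: measurable_rVZ; first exact: measurable_cst.
  apply: (measurable_rVD mx _); apply: measurable_rVN.
  apply: (measurableT_comp (measurable_proj cvxX cptX X0)).
  apply: (measurable_rVD mx _); apply: measurable_rVN; apply: measurable_rVZ.
    exact: measurable_cst.
  exact: (measurableT_comp measurable_ggrad mx).
apply: measurable_funD; last exact: measurable_cst.
apply: measurable_funD; first exact: measurable_dot.
by apply: measurable_funX; exact: measurable_enorm.
Qed.

Let weight_gt0 t : (0 < t)%N -> 0 < weight L beta t.
Proof.
move=> t0; rewrite /weight expr2 mulrA -[X in X - _]mul1r -mulrBl.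
by rewrite mulr_gt0 ?beta0// subr_gt0 betaL.
Qed.

Let i_loss t : (0 < t)%N -> P.-integrable setT (EFin \o (fun w => loss w t)).
Proof.
move=> t0; apply: (ge0_integrable (measurable_loss t0) _ (expected_loss t0) (ltry _)) => w.
by apply: loss_ge0; apply: exact_step_le => //; exact: beta0.
Qed.

Lemma integrable_step t : (0 < t)%N -> P.-integrable setT (EFin \o (fun w => enorm (step w t) ^+ 2)).
Proof.
move=> t0.
have t0t : (0 < t <= t)%N by rewrite t0 /=.
have ms : measurable_fun setT (fun w : Om => step w t).
  exact: (on_Om (@sample_block_sub 1 t.+1 isT) (measurable_step t0t)).
have b0 := beta0 t0; have w0 := weight_gt0 t0.
apply: (integrable_le (g := fun w => (weight L beta t)^-1 * (2 * B + beta t * loss w t))).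
- by apply: measurable_funX; exact: measurable_enorm.
- move=> w; rewrite ger0_norm ?sqr_ge0// ler_pdivlMl//.
  have := projected_step cvxX cptX X0 xi0 mphi phiB b0 (Xxs w t)
    (erefl (step w t)) (erefl (dev w t)).
  rewrite -/(weight L beta t) => h; apply: le_trans h _; apply: lerD.
    rewrite mulr_natl mulr2n; apply: le_trans (ler_norm _) _; apply: le_trans (ler_normB _ _) _.
    by apply: lerD; exact: (gsmooth_le xi mphi phiB).
  by rewrite ler_wpM2l ?(ltW b0)// /loss lerDl sqr_ge0.
- apply: integrable_scaler; apply: integrable_addr; first exact: integrable_cst1.
  exact: integrable_scaler (i_loss t0).
Qed.

(** The constant [c ^+ 2] added to the losses cancels from both sides. *)
Lemma expected_sum_steps T :
  \sum_(1 <= t < T.+1) weight L beta t * \int[P]_w (enorm (step w t) ^+ 2) <=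
  2 * B + \sum_(1 <= t < T.+1) beta t * (Del t * c + variance_bound n B xi (N t) + Del t ^+ 2).
Proof.
have i1 (i : 'I_T) : P.-integrable setT (EFin \o (fun w => weight L beta i.+1 * enorm (step w i.+1) ^+ 2)).
  exact: (integrable_scaler _ (integrable_step (ltn0Sn i))).
have i2 (i : 'I_T) : P.-integrable setT (EFin \o (fun w => beta i.+1 * loss w i.+1)).
  exact: (integrable_scaler _ (i_loss (ltn0Sn i))).
pose C := \sum_(i < T) beta i.+1 * c ^+ 2.
have h : \int[P]_w (\sum_(i < T) weight L beta i.+1 * enorm (step w i.+1) ^+ 2 + C) <=
    \int[P]_w (2 * B + \sum_(i < T) beta i.+1 * loss w i.+1).
  apply: le_Rintegral => //.
  - exact: (integrable_addr (integrable_sumr _ i1) (integrable_cst1 _ _)).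
  - exact: (integrable_addr (integrable_cst1 _ _) (integrable_sumr _ i2)).
  - move=> w _; have := sum_steps_le w T; rewrite !big_add1 /= !big_mkord; exact.
rewrite (RintegralD measurableT (integrable_sumr _ i1) (integrable_cst1 _ _)) in h.
rewrite (RintegralD measurableT (integrable_cst1 _ _) (integrable_sumr _ i2)) in h.
rewrite !Rintegral_cst1 (Rintegral_sumr _ i1) (Rintegral_sumr _ i2) in h.
rewrite !big_add1 /= !big_mkord -(lerD2r C).
have -> : \sum_(i < T) weight L beta i.+1 * \int[P]_w (enorm (step w i.+1) ^+ 2) =
   \sum_(i < T) \int[P]_w (weight L beta i.+1 * enorm (step w i.+1) ^+ 2).
  by apply: eq_bigr => i _; rewrite (RintegralZl _ measurableT (integrable_step (ltn0Sn i))).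
apply: le_trans h _; rewrite -addrA lerD2l -big_split /=; apply: ler_sum => i _.
rewrite (RintegralZl _ measurableT (i_loss (ltn0Sn i))) -mulrDr.
rewrite ler_wpM2l ?(ltW (beta0 _))// -lee_fin -Rintegral_EFin; last exact: i_loss.
exact: expected_loss.
Qed.

Let rstep w t := projected_gradient X beta (est F w) x1 t.

(** The steps are functions of the samples, of which the random index is
    independent, so the expectation splits into the probabilities of the index
    times the mean squared steps. *)
Lemma expected_random_step T (I : Om -> nat) : (0 < T)%N ->
  measurable_fun setT I -> independent_of_family P samples sample I ->
  (forall w, (1 <= I w <= T)%N) ->
  (forall t, (1 <= t <= T)%N -> P (I @^-1` [set t]) =
    (weight L beta t / \sum_(1 <= s < T.+1) weight L beta s)%:E) ->
  ('E_P[fun w => (enorm (rstep w (I w)) ^+ 2)%R] <=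
   ((2 * B + \sum_(1 <= t < T.+1)
       beta t * (Del t * c + variance_bound n B xi (N t) + Del t ^+ 2)) /
    \sum_(1 <= t < T.+1) weight L beta t)%:E)%E.
Proof.
move=> T0 mI indI IT PI; set W := \sum_(1 <= s < T.+1) _ in PI *.
have W0 : 0 < W.
  rewrite /W big_add1 /= big_mkord; case: T T0 {IT PI W} => // T _.
  rewrite big_ord_recl /= ltr_wpDr ?weight_gt0//.
  by apply: sumr_ge0 => i _; rewrite ltW// weight_gt0.
have [E [mE E0 hE]] := iterates_ae_eq T.
rewrite unlock.
have -> : (\int[P]_w (enorm (rstep w (I w)) ^+ 2)%:E =
    \int[P]_w \sum_(i < T) ((\1_[set i.+1] (I w) : R) * enorm (step w i.+1) ^+ 2)%:E)%E.
  apply: (integral_ae_eq mE E0) => w nE.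
  have [e1 e2] := hE w nE (I w) (IT w).
  have -> : rstep w (I w) = step w (I w).
    by rewrite /rstep /projected_gradient e1 e2.
  have iT : ((I w).-1 < T)%N by have /andP[a b] := IT w; rewrite prednK.
  have Iw : (I w).-1.+1 = I w by have /andP[a b] := IT w; rewrite prednK.
  rewrite (bigD1 (Ordinal iT))//= Iw indicE mem_set// mul1r big1 ?adde0// => i ne.
  rewrite indicE memNset ?mul0r//= => e; move/eqP: ne; apply; apply: val_inj => /=.
  by rewrite e.
have sub : [set` sample_block 1 T.+1] `<=` samples by exact: sample_block_sub.
have mV2 := measurable_to_sub_space mu sub.
have ind := independent_of_subfamily mu indI mI sub.
have m1 t : measurable_fun setT (fun a : nat => \1_[set t] a : R).
  by apply: measurable_indic.
have ms t : (0 < t <= T)%N -> measurable_fun setT ((fun w => enorm (step w t) ^+ 2) :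
    sub_space sample (sample_block 1 T.+1) -> R).
  by move=> t0T; apply: measurable_funX; apply: measurable_enorm; exact: measurable_step.
have iT (i : 'I_T) : (0 < i.+1 <= T)%N by rewrite /= ltn_ord.
rewrite ge0_integral_sum//; last 2 first.
- move=> i; apply/measurable_EFinP; apply: measurable_funM.
    exact: (measurableT_comp (m1 i.+1) mI).
  exact: (on_Om sub (ms _ (iT i))).
- by move=> i w _; rewrite lee_fin mulr_ge0 ?sqr_ge0// indicE ler0n.
have key (i : 'I_T) : (\int[P]_w ((\1_[set i.+1] (I w) : R) * enorm (step w i.+1) ^+ 2)%:E =
   (weight L beta i.+1 / W * \int[P]_w (enorm (step w i.+1) ^+ 2))%:E)%E.
  pose h (z : nat * sub_space sample (sample_block 1 T.+1)) : \bar R :=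
    ((\1_[set i.+1] z.1 : R) * enorm (step z.2 i.+1) ^+ 2)%:E.
  have mh : measurable_fun setT h.
    apply/measurable_EFinP; apply: measurable_funM.
      exact: (measurableT_comp (m1 i.+1) measurable_fst).
    exact: (measurableT_comp (ms _ (iT i)) measurable_snd).
  have h0 z : (0 <= h z)%E by rewrite lee_fin mulr_ge0 ?sqr_ge0// indicE ler0n.
  have e := ge0_integral_independent mI mV2 ind mh h0.
  rewrite [LHS]e.
  have is_ := integrable_step (ltn0Sn i).
  set r := \int[P]_w (enorm (step w i.+1) ^+ 2).
  have r0 : 0 <= r by apply: Rintegral_ge0 => w _; exact: sqr_ge0.
  transitivity (\int[P]_w (r%:E * (\1_(I @^-1` [set i.+1]) w)%:E))%E.
    apply: eq_integral => w _; rewrite /h /=.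
    under eq_integral do rewrite EFinM.
    rewrite ge0_integralZl//; last 2 first.
    - by apply/measurable_EFinP; exact: integrable_measurable is_.
    - by move=> w' _; rewrite lee_fin sqr_ge0.
    by rewrite (Rintegral_EFin is_) muleC.
  have mA : measurable (I @^-1` [set i.+1]) by rewrite -[X in measurable X]setTI; exact: mI.
  rewrite ge0_integralZl//; last first.
    by apply/measurable_EFinP; exact: measurable_indic.
  by rewrite integral_indic// setIT [X in (_ * X)%E](PI i.+1 (iT i)) -EFinM mulrC.
under eq_bigr do rewrite key.
rewrite sumEFin lee_fin.
have -> : \sum_(i < T) weight L beta i.+1 / W * \int[P]_w (enorm (step w i.+1) ^+ 2) =
  (\sum_(1 <= t < T.+1) weight L beta t * \int[P]_w (enorm (step w t) ^+ 2)) / W.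
  rewrite big_add1 /= big_mkord mulr_suml; apply: eq_bigr => i _.
  by rewrite mulrAC.
by rewrite ler_wpM2r ?invr_ge0 ?(ltW W0)// expected_sum_steps.
Qed.

End process.

(** * The logarithmic rate *)
Section rate.
Context {R : realType}.

(** Telescopes [1 / (t + 1) <= ln (t + 1) - ln t]. *)
Lemma harmonic_le_ln T : \sum_(1 <= t < T.+1) (t.+1%:R)^-1 <= ln T.+1%:R :> R.
Proof.
elim: T => [|T ih]; first by rewrite big_geq// ln1.
rewrite big_nat_recr//=; apply: le_trans (lerD ih (lexx _)) _.
have t1 : 0 < T.+1%:R :> R by rewrite ltr0n.
have t2 : 0 < T.+2%:R :> R by rewrite ltr0n.
have h : ln (1 + - T.+2%:R^-1) <= - T.+2%:R^-1 :> R.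
  by apply: le_ln1Dx; rewrite ltrN2 invf_lt1// ltr1n.
have e : 1 + - T.+2%:R^-1 = T.+1%:R / T.+2%:R :> R.
  have t2n : T.+2%:R != 0 :> R by rewrite gt_eqF.
  by apply: (mulIf t2n); rewrite mulfVK// mulrDl mul1r mulNr mulVf// -[T.+2%:R]natr1 addrK.
by rewrite -lerBrDr [leRHS]addrC; move: h; rewrite e ln_div ?posrE// lerBlDr.
Qed.

Lemma ln_succ_le T : (2 <= T)%N -> ln T.+1%:R <= 2 * ln T%:R :> R.
Proof.
move=> T2; have T0 : 0 < T%:R :> R by rewrite ltr0n (ltn_trans _ T2).
have TT : 0 < T%:R * T%:R :> R by rewrite mulr_gt0.
have T1 : 0 < T.+1%:R :> R by rewrite ltr0n.
rewrite mulr_natl mulr2n -lnM ?posrE// ler_ln ?posrE//.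
rewrite -natrM ler_nat; apply: (@leq_trans (T * 2)); last by rewrite leq_mul2l T2 orbT.
by rewrite muln2 -addnn -addn1 leq_add2l ltnW.
Qed.

(** Step sizes are constant, so the denominator grows linearly, while the bias
    and the variance decay like [1 / t] and sum to a logarithm. *)
Lemma rate_bound (w1 fb A : R) (N1 : nat -> R) : 0 < w1 -> 0 <= fb -> 0 <= A ->
  (forall t, (0 < t)%N -> N1 t <= A * t.+1%:R^-1) ->
  forall T, (2 <= T)%N ->
  (2 * fb + \sum_(1 <= t < T.+1) N1 t) / (T%:R * w1) <=
  ((2 * fb / ln 2 + 2 * A) / w1) * (ln T%:R / T%:R).
Proof.
move=> w0 fb0 A0 N1A T T2.
have T0 : 0 < T%:R :> R by rewrite ltr0n (ltn_trans _ T2).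
have l2 : 0 < ln 2 :> R by rewrite ln_gt0// ltr1n.
have lT : ln 2 <= ln T%:R :> R by rewrite ler_ln ?posrE// ler_nat.
have -> : (2 * fb / ln 2 + 2 * A) / w1 * (ln T%:R / T%:R) =
  ((2 * fb / ln 2 + 2 * A) * ln T%:R) / (T%:R * w1).
  by rewrite invfM mulrACA (mulrC w1^-1).
rewrite ler_wpM2r ?invr_ge0 ?mulr_ge0 ?(ltW T0) ?(ltW w0)// [leRHS]mulrDl; apply: lerD.
  rewrite -mulrA ler_peMr ?mulr_ge0// ler_pdivlMl// mulr1//.
apply: (@le_trans _ _ (\sum_(1 <= t < T.+1) A * t.+1%:R^-1)).
  by rewrite !big_nat; apply: ler_sum => t /andP[t0 _]; exact: N1A.
rewrite -mulr_sumr (mulrC 2) -mulrA ler_wpM2l//.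
exact: le_trans (harmonic_le_ln T) (ln_succ_le T2).
Qed.

End rate.

(** * Bias, variance and convergence of the algorithm *)
Theorem theorem4p2 (R : realType) (n m : nat)
  (* problem data *)
  (X : set 'rV[R]_n) (f g : 'rV[R]_n -> 'rV[R]_m -> R) (y0 : 'rV[R]_m)
  (Lg Lgg Lf glow g0bar fbar d : R) (Y Y' : set 'rV[R]_m)
  (mu : R -> R) (alpha : R -> R -> R)
  (xi : R) :
  (0 < n)%N -> (0 < m)%N ->
  (* regularity assumptions *)
  {within [set p : 'rV[R]_n * 'rV[R]_m | X p.1],
    continuous (fun p => f p.1 p.2)} ->
  (exists W : set 'rV[R]_(n + m), [/\ open W,
    (forall x y, X x -> W (row_mx x y)) & C2_on W (joint g)]) ->
  convex_set X -> compact X ->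
  (forall x x' y y', X x -> X x' ->
    enorm (grad (joint g) (row_mx x y) - grad (joint g) (row_mx x' y')) <=
    Lg * enorm (row_mx x y - row_mx x' y')) ->
  0 < Lgg ->
  (forall x x' y y', X x -> X x' ->
    opnorm (hess (g x) y - hess (g x') y') <=
    Lgg * enorm (row_mx x y - row_mx x' y')) ->
  (forall x y, X x -> glow <= g x y) ->
  compact Y ->
  (forall x, X x -> compact [set y | g x y <= g x y0] /\
                    [set y | g x y <= g x y0] `<=` Y) ->
  (forall x x' y y', X x -> X x' -> g x y <= g x y0 -> g x' y' <= g x' y0 ->
    `|f x y - f x' y'| <= Lf * enorm (row_mx x y - row_mx x' y')) ->
  (forall x, X x -> g x y0 <= g0bar) ->
  (forall x y, X x -> g x y <= g x y0 -> `|f x y| <= fbar) ->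
  (* bifurcation set *)
  upper_minkowski_dim (bifurcation X g) = d%:E -> d < n%:R ->
  compact Y' -> Y `<=` interior Y' ->
  (forall delta : R, 0 < delta -> 0 < mu delta /\
    forall x y l, (X `\` bifurcation_nbhd X g delta) x -> Y' y ->
      grad (g x) y = 0 -> eigenvalue (hess (g x) y) l -> mu delta <= `|l|) ->
  (forall delta r : R, 0 < delta -> 0 < r -> 0 < alpha delta r /\
    forall x y, (X `\` bifurcation_nbhd X g delta) x -> Y y ->
      (r%:E < dist y [set y' | Y' y' /\ (grad (g x) y' = 0)%R])%E ->
      alpha delta r <= enorm (grad (g x) y)) ->
  0 < xi ->
  exists C1 C2 : R,
  (* lower-level method with M = Lgg: iterates, best indices, selected
     accumulation points *)
  forall (ys : 'rV[R]_n -> nat -> 'rV[R]_m) (kstar : nat -> 'rV[R]_n -> nat)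
    (ycd : 'rV[R]_n -> 'rV[R]_m) (K0 : nat),
  (forall x, X x -> cubic_newton Lgg (g x) y0 (ys x)) ->
  (forall K x, X x -> best_index Lgg (g x) (ys x) K (kstar K x)) ->
  (forall x, X x -> accumulation_points (ys x) (ycd x) /\
    forall y, accumulation_points (ys x) y -> f x (ycd x) <= f x y) ->
  (forall x y, X x -> accumulation_points (ys x) y -> grad (g x) y = 0) ->
  (forall x k, X x -> (K0 <= k)%N -> g x (ys x k) <= g x y0) ->
  (lebesgue_rV n).-negligible
    [set x | (X `\` bifurcation X g) x /\
             ~ (ycd @ within X (nbhs x) --> ycd x)] ->
  let phi := fun z => extend X fbar f z (ycd z) in
  let F := fun K z => extend X fbar f z (ys z (kstar K z)) in
  let Lphi := fbar / xi ^+ 2 in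
  forall (rho delta : nat -> R) (N K : nat -> nat),
  (forall t, (0 < t)%N ->
    [/\ 0 < rho t, 0 < delta t & (0 < N t)%N] /\
    [/\ steps_bound g0bar glow Lgg mu alpha (rho t) (delta t) < (K t)%:R,
        (K0 <= K t)%N & Lebesgue_measurable (F (K t))]) ->
  let Delta := fun t => bias_bound n d C1 C2 (rho t) (delta t) in
  let sigma2 := fun t => variance_bound n fbar xi (N t) in
  forall (disp : measure_display) (Omega : measurableType disp)
    (P : probability Omega R) (u : nat -> nat -> Omega -> 'rV[R]_n),
  let samples := [set p : nat * nat | (0 < p.1)%N /\ (p.2 < N p.1)%N] in
  let ghat := fun w t x => estimator xi (F (K t)) (N t) (fun i => u t i w) x in
  (forall p, samples p -> standard_gaussian P (u p.1 p.2)) ->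
  mutually_independent P samples (fun p => u p.1 p.2) ->
  (* bias and variance of the estimator *)
  (forall t x, (0 < t)%N ->
    [/\ enorm (expectation_rV P (fun w => ghat w t x)
               - grad (smoothing xi phi) x) =
        enorm (kernel_grad xi (F (K t)) x - grad (smoothing xi phi) x),
        enorm (kernel_grad xi (F (K t)) x - grad (smoothing xi phi) x)
          <= Delta t
      & ('E_P[fun w => (enorm (ghat w t x - kernel_grad xi (F (K t)) x) ^+ 2)%R]
          <= (sigma2 t)%:E)%E]) /\
  (* convergence of the algorithm *)
  (forall (x1 : 'rV[R]_n) (beta : nat -> R),
    X x1 ->
    (forall t, (0 < t)%N -> 0 < beta t /\ Lphi * beta t < 1) ->
    let Phi := fun t w => projected_gradient X beta (ghat w) x1 t in
    let random_index := fun T (I : {RV P >-> nat}) =>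
      [/\ forall w, (1 <= I w <= T)%N,
          forall t, (1 <= t <= T)%N ->
            P (I @^-1` [set t]) =
            (weight Lphi beta t /
             \sum_(1 <= s < T.+1) weight Lphi beta s)%:E
        & independent_of_family P samples (fun p => u p.1 p.2) I] in
    (forall T I, (1 <= T)%N -> random_index T I ->
      ('E_P[fun w => (enorm (Phi (I w) w) ^+ 2)%R] <=
       ((2 * fbar
         + \sum_(1 <= t < T.+1)
             Num.sqrt (2 / pi) * (fbar / xi) * Delta t * beta t
         + \sum_(1 <= t < T.+1) (sigma2 t + Delta t ^+ 2) * beta t)
        / \sum_(1 <= t < T.+1) weight Lphi beta t)%:E)%E) /\
    ((forall t, (0 < t)%N ->
        [/\ rho t = t.+1%:R^-1,
            delta t = (t.+1%:R `^ (2 / (n%:R - d)))^-1,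
            N t = t.+1 & beta t = beta 1%N]) ->
      exists C : R, forall T I, (2 <= T)%N -> random_index T I ->
        ('E_P[fun w => (enorm (Phi (I w) w) ^+ 2)%R] <=
         (C * (ln T%:R / T%:R))%:E)%E)).
Proof.
move=> n0 m0 contf smoothg cvxX cptX lipg Lgg0 liph glowP cptY sublevel lipf g0barP fbarP
  dimB dn cptY' YY' muP alphaP xi0.
have [D1 [D2 [D10 D20 bias]]] := inexact_gradient_bias m0 smoothg cptX lipg Lgg0 liph glowP
  sublevel lipf g0barP fbarP dimB dn muP alphaP xi0.
(* The descent estimate bounds the exact step by fbar / xi, while the statement
   multiplies Delta by sqrt (2 / pi) * (fbar / xi); the factor k = sqrt (pi / 2) >= 1
   in both constants makes up for the difference. *)
pose k : R := Num.sqrt (pi / 2).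
have pi0 : 0 < pi :> R by exact: pi_gt0.
have k1 : 1 <= k.
  by rewrite -[leLHS]sqrtr1; apply: ler_wsqrtr; rewrite ler_pdivlMr// mul1r pi_ge2.
have k0 : 0 <= k by exact: le_trans k1.
have kinv : Num.sqrt (2 / pi) * k = 1.
  rewrite /k -sqrtrM ?divr_ge0 ?(ltW pi0)// mulrA divfK ?gt_eqF// divff// sqrtr1//.
exists (k * D1), (k * D2).
move=> ys kstar ycd K0 newt best cd stat hK0 disc phi F Lphi rho delta N K hseq Delta sigma2
  disp Omega P u samples ghat gu indu.
have acc x (Xx : X x) := (cd x Xx).1.
have [phi' [N1 [mphi phiB mN1 N10 phiE]]] := hyperfunction_measurable m0 contf smoothg cptX lipg
  Lgg0 liph sublevel fbarP dimB dn newt acc disc.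
have sub x j : X x -> g x (ys x j) <= g x y0.
  exact: (newton_sublevel m0 smoothg lipg Lgg0 liph newt).
(* A bounded Borel representative and an exceptional null set for each iteration;
   iterations are numbered from 1, so that t = 0 gets a dummy value. *)
have rep t : exists p : ('rV[R]_n -> R) * set 'rV[R]_n, (0 < t)%N ->
    [/\ measurable_fun setT p.1, (forall z, `|p.1 z| <= `|fbar|), measurable p.2,
        lebesgue_rV n p.2 = 0%E & forall z, ~ p.2 z -> F (K t) z = p.1 z].
  have [->|t0] := posnP t; first by exists (fun=> 0, set0).
  have [_ [_ _ LF]] := hseq t t0.
  have FB z : `|F (K t) z| <= `|fbar|.
    by apply: (extend_bounded fbarP (s := fun x => ys x (kstar (K t) x)) z) => x Xx; exact: sub.
  have [psi [Nu hpsi]] := Lebesgue_measurable_bounded LF FB.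
  by exists (psi, Nu).
have [rep' hrep] := choice rep.
pose psi t := (rep' t).1; pose Nul t := (rep' t).2.
pose Del t := bias_bound n d D1 D2 (rho t) (delta t).
have mpsi t : (0 < t)%N -> measurable_fun setT (psi t) by case/hrep.
have psiB t z : (0 < t)%N -> `|psi t z| <= `|fbar| by case/hrep => _ h _ _ _; exact: h.
have mNul t : (0 < t)%N -> measurable (Nul t) by case/hrep.
have Nul0 t : (0 < t)%N -> lebesgue_rV n (Nul t) = 0%E by case/hrep.
have Fpsi t z : (0 < t)%N -> ~ Nul t z -> F (K t) z = psi t z by case/hrep => _ _ _ _; exact.
have N0 t : (0 < t)%N -> (0 < N t)%N by case/hseq => -[].
have DelP t x : (0 < t)%N -> enorm (ggrad xi (psi t) x - ggrad xi phi' x) <= Del t.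
  move=> t0; have [[rho0 del0 _] [hK _ _]] := hseq t t0.
  exact: (bias ys (kstar (K t)) ycd (K t) (rho t) (delta t) phi' (psi t) N1 (Nul t)
    newt acc (best (K t)) rho0 del0 hK mphi (mpsi t t0) phiB (fun z => psiB t z t0)
    mN1 N10 (mNul t t0) (Nul0 t t0) phiE (fun z => Fpsi t z t0)).
have gradE x : grad (smoothing xi phi) x = ggrad xi phi' x.
  by rewrite (smoothing_gsmooth xi0 mphi mN1 N10 phiE) (grad_gsmooth xi0 mphi phiB).
have kernelE t : (0 < t)%N -> kernel_grad xi (F (K t)) = ggrad xi (psi t).
  by move=> t0; exact: (kernel_grad_ggrad xi0 (mpsi t t0) (mNul t t0) (Nul0 t t0)
    (fun z => Fpsi t z t0)).
have DeltaE t : Delta t = k * Del t by rewrite /Delta /Del /bias_bound; ring.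
have Del0 t : (0 < t)%N -> 0 <= Del t.
  by move=> t0; exact: le_trans (enorm_ge0 _) (DelP t 0 t0).
have DelDelta t : (0 < t)%N -> Del t <= Delta t.
  by move=> t0; rewrite DeltaE ler_peMl// Del0.
have varE t : variance_bound n `|fbar| xi (N t) = sigma2 t.
  by rewrite /sigma2 /variance_bound real_normK ?num_real.
split.
  move=> t x t0; rewrite kernelE// gradE.
  have Dp i : (i < N t)%N -> samples (t, i) by [].
  have pinj : injective (fun i : nat => (t, i)) by move=> i j [].
  have mean : expectation_rV P (fun w => ghat w t x) = ggrad xi (psi t) x.
    exact: (@expectation_estimator _ _ _ P n _ samples (fun p => u p.1 p.2) gu (N t)
      (fun i => (t, i)) Dp xi `|fbar| (F (K t)) (psi t) (Nul t) xi0 (N0 t t0) (mpsi t t0)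
      (fun z => psiB t z t0) (mNul t t0) (Nul0 t t0) (fun z => Fpsi t z t0) x).
  split; first by rewrite mean.
    by apply: le_trans (DelP t x t0) _; exact: DelDelta.
  rewrite -varE.
  exact: (@variance_estimator _ _ _ P n _ samples (fun p => u p.1 p.2) gu indu (N t)
    (fun i => (t, i)) Dp pinj xi `|fbar| (F (K t)) (psi t) (Nul t) xi0 (N0 t t0) (mpsi t t0)
    (fun z => psiB t z t0) (mNul t t0) (Nul0 t t0) (fun z => Fpsi t z t0) x).
move=> x1 beta Xx1 hbeta Phi random_index.
(* X contains x1, which forces fbar to be nonnegative. *)
have fbar0 : 0 <= fbar by exact: le_trans (normr_ge0 _) (fbarP x1 y0 Xx1 (lexx _)).
have fbarE : `|fbar| = fbar by exact: ger0_norm.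
rewrite fbarE in phiB varE.
have psiB' t z : (0 < t)%N -> `|psi t z| <= fbar by move=> /(psiB t z); rewrite fbarE.
have beta0 t : (0 < t)%N -> 0 < beta t by case/hbeta.
have betaL t : (0 < t)%N -> Lphi * beta t < 1 by case/hbeta.
have weight0 t : (0 < t)%N -> 0 < weight Lphi beta t.
  move=> t0; rewrite /weight expr2 mulrA -[X in X - _]mul1r -mulrBl.
  by rewrite mulr_gt0 ?beta0// subr_gt0 betaL.
have main T (I : {RV P >-> nat}) : (1 <= T)%N -> random_index T I ->
    ('E_P[fun w => (enorm (Phi (I w) w) ^+ 2)%R] <=
     ((2 * fbar
       + \sum_(1 <= t < T.+1) Num.sqrt (2 / pi) * (fbar / xi) * Delta t * beta t
       + \sum_(1 <= t < T.+1) (sigma2 t + Delta t ^+ 2) * beta t)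
      / \sum_(1 <= t < T.+1) weight Lphi beta t)%:E)%E.
  move=> T1 [IT PI indI].
  have mI : measurable_fun setT (I : Omega -> nat) by exact: measurable_funPT.
  apply: le_trans (@expected_random_step _ _ _ P n X xi fbar phi' cvxX cptX xi0 mphi phiB N u
    N0 gu indu (fun t => F (K t)) psi Nul Del mpsi psiB' mNul Nul0 Fpsi DelP x1 beta Xx1
    beta0 betaL T I T1 mI indI IT PI) _.
  rewrite lee_fin ler_wpM2r//.
    by rewrite invr_ge0 big_nat sumr_ge0// => t /andP[t0 _]; exact/ltW/weight0.
  rewrite -addrA lerD2l -big_split /= !big_nat; apply: ler_sum => t /andP[t0 _].
  have b0 := ltW (beta0 t t0).
  rewrite -mulrDl mulrC ler_wpM2r// DeltaE varE.
  have -> : Num.sqrt (2 / pi) * (fbar / xi) * (k * Del t) = Del t * (fbar / xi).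
    by rewrite mulrACA kinv mul1r mulrC.
  rewrite -addrA lerD2l lerD2l -DeltaE.
  by rewrite ler_pXn2r// ?nnegrE ?Del0// ?DelDelta// (le_trans (Del0 t t0))// DelDelta.
split; first exact: main.
move=> hrate.
pose s : R := n%:R - d.
have s0 : s != 0 by rewrite subr_eq0 gt_eqF.
pose C := k * D1 + k * D2.
have C0 : 0 <= C by rewrite addr_ge0 ?mulr_ge0.
have rateDelta t : (0 < t)%N -> Delta t = C * t.+1%:R^-1.
  move=> t0; have [rhoE delE _ _] := hrate t t0.
  rewrite /Delta /bias_bound rhoE delE -powRN -powRrM.
  have -> : - (2 / (n%:R - d)) * ((n%:R - d) / 2) = -1 by rewrite -/s; field.
  by rewrite powR_inv1 ?ler0n// -mulrDl.
have rateSigma t : (0 < t)%N -> sigma2 t = n%:R * fbar ^+ 2 / xi ^+ 2 * t.+1%:R^-1.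
  move=> t0; have [_ _ NE _] := hrate t t0.
  by rewrite /sigma2 /variance_bound NE invfM mulrCA mulrC.
pose q := Num.sqrt (2 / pi) * (fbar / xi).
have q0 : 0 <= q by rewrite mulr_ge0 ?sqrtr_ge0// divr_ge0// ltW.
pose v := n%:R * fbar ^+ 2 / xi ^+ 2.
have v0 : 0 <= v by apply: divr_ge0; [apply: mulr_ge0; [exact: ler0n|exact: sqr_ge0]|exact: sqr_ge0].
pose b := beta 1%N.
have b0 : 0 <= b by exact/ltW/beta0.
pose A := (q * C + v + C ^+ 2) * b.
have A0 : 0 <= A by apply: mulr_ge0 => //; apply: addr_ge0; [apply: addr_ge0 => //; exact: mulr_ge0|exact: sqr_ge0].
have NA t : (0 < t)%N -> q * Delta t * beta t + (sigma2 t + Delta t ^+ 2) * beta t <=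
    A * t.+1%:R^-1.
  move=> t0; have [_ _ _ bE] := hrate t t0.
  rewrite bE -/b -mulrDl /A [leRHS]mulrAC ler_wpM2r// rateDelta// rateSigma// -/v.
  have t1 : 0 <= t.+1%:R^-1 :> R by rewrite invr_ge0.
  have t2 : (t.+1%:R^-1) ^+ 2 <= t.+1%:R^-1 :> R.
    by rewrite expr2 ler_piMr// invf_le1// ler1n.
  have -> : (q * C + v + C ^+ 2) * t.+1%:R^-1 =
    q * (C * t.+1%:R^-1) + (v * t.+1%:R^-1 + C ^+ 2 * t.+1%:R^-1) by ring.
  by rewrite lerD2l lerD2l exprMn ler_wpM2l// sqr_ge0.
exists ((2 * fbar / ln 2 + 2 * A) / weight Lphi beta 1%N) => T I T2 hI.
apply: le_trans (main T I (ltnW T2) hI) _; rewrite lee_fin.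
have -> : \sum_(1 <= t < T.+1) weight Lphi beta t = T%:R * weight Lphi beta 1%N.
  rewrite (eq_big_nat _ _ (F2 := fun=> weight Lphi beta 1%N)).
    by rewrite sumr_const_nat subn1 /= mulr_natl.
  by move=> t /andP[t0 _]; have [_ _ _ bE] := hrate t t0; rewrite /weight bE.
rewrite -addrA -big_split /=.
exact: (rate_bound (N1 := fun t => q * Delta t * beta t + (sigma2 t + Delta t ^+ 2) * beta t)
  (weight0 1%N isT) fbar0 A0 NA T2).
Qed.
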